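(* Let $n\ge2$, and let $D_0,\dots,D_5,\square$ be the elements defined in the context, regarded as elements of the algebra $\mathrm{Diff}(\mathbf P^n(\mathbb C)_{\mathbb S})$ of invariant differential operators on the unit sphere bundle of $\mathbf P^n(\mathbb C)$. Then: (1) $D_0,\dots,D_5,\square$ generate $\mathrm{Diff}(\mathbf P^n(\mathbb C)_{\mathbb S})$. (2) They satisfy the commutation relations $[D_0,D_1]=-D_3$, $[D_0,D_2]=D_3$, $[D_0,D_3]=\frac12(D_1-D_2)$, $[D_0,D_4]=-D_5$, $[D_0,D_5]=D_4$, $[D_0,\square]=0$, $[D_1,D_2]=-\{D_0,D_3\}-\{\square,D_4\}$, $[D_1,D_3]=-\frac12\{D_0,D_1\}+\frac12\{\square,D_5\}+\frac{(n-1)^2}4D_0$, $[D_1,D_4]=\square$, $[D_1,D_5]=0$, $[D_1,\square]=-\frac12\{D_1,D_4\}-\frac12\{D_3,D_5\}+\frac{(n-1)^2}4D_4$, $[D_2,D_3]=\frac12\{D_0,D_2\}+\frac12\{\square,D_5\}-\frac{(n-1)^2}4D_0$, $[D_2,D_4]=-\square$, $[D_2,D_5]=0$, $[D_2,\square]=\frac12\{D_2,D_4\}-\frac12\{D_3,D_5\}-\frac{(n-1)^2}4D_4$, $[D_3,D_4]=0$, $[D_3,D_5]=\square$, $[D_3,\square]=-\frac14\{D_1+D_2,D_5\}+\frac{(n-1)^2}4D_5$, $[D_4,D_5]=-D_0$, $[D_4,\square]=\frac12(D_1-D_2)$, $[D_5,\square]=D_3$. (3) If $n>2$, there are no further relations,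 i.e. every relation among the generators is a consequence of (2). If $n=2$, then modulo (2) there is exactly one further independent relation, $$\tfrac12\{D_1,D_2\}-D_3^2-\square^2-\tfrac14(D_0^2+D_4^2+D_5^2)=0.$$ (4) $D_0^2+D_1+D_2+D_4^2+D_5^2$ lies in the centre of $\mathrm{Diff}(\mathbf P^n(\mathbb C)_{\mathbb S})$. (5) The operators $\bar D_0,\dots,\bar D_5,\bar\square$ defined by $D_0=\sqrt{-1}\bar D_0$, $D_1=-\bar D_1$, $D_2=\bar D_2$, $D_3=\sqrt{-1}\bar D_3$, $D_4=\sqrt{-1}\bar D_4$, $D_5=\bar D_5$, $\square=\sqrt{-1}\,\bar\square$ generate $\mathrm{Diff}(\mathbf H^n(\mathbb C)_{\mathbb S})$. They satisfy $[\bar D_0,\bar D_1]=\bar D_3$, $[\bar D_0,\bar D_2]=\bar D_3$, $[\bar D_0,\bar D_3]=\frac12(\bar D_1+\bar D_2)$, $[\bar D_0,\bar D_4]=\bar D_5$, $[\bar D_0,\bar D_5]=\bar D_4$, $[\bar D_0,\bar\square]=0$, $[\bar D_1,\bar D_2]=-\{\bar D_0,\bar D_3\}-\{\bar\square,\bar D_4\}$, $[\bar D_1,\bar D_3]=-\frac12\{\bar D_0,\bar D_1\}-\frac12\{\bar\square,\bar D_5\}-\frac{(n-1)^2}4\bar D_0$, $[\bar D_1,\bar D_4]=-\bar\square$, $[\bar D_1,\bar D_5]=0$, $[\bar D_1,\bar\square]=-\frac12\{\bar D_1,\bar D_4\}+\frac12\{\bar D_3,\bar D_5\}-\frac{(n-1)^2}4\bar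 D_4$, $[\bar D_2,\bar D_3]=\frac12\{\bar D_0,\bar D_2\}+\frac12\{\bar\square,\bar D_5\}-\frac{(n-1)^2}4\bar D_0$, $[\bar D_2,\bar D_4]=-\bar\square$, $[\bar D_2,\bar D_5]=0$, $[\bar D_2,\bar\square]=\frac12\{\bar D_2,\bar D_4\}-\frac12\{\bar D_3,\bar D_5\}-\frac{(n-1)^2}4\bar D_4$, $[\bar D_3,\bar D_4]=0$, $[\bar D_3,\bar D_5]=\bar\square$, $[\bar D_3,\bar\square]=-\frac14\{\bar D_1-\bar D_2,\bar D_5\}-\frac{(n-1)^2}4\bar D_5$, $[\bar D_4,\bar D_5]=-\bar D_0$, $[\bar D_4,\bar\square]=\frac12(\bar D_1+\bar D_2)$, $[\bar D_5,\bar\square]=\bar D_3$. There are no further relations if $n>2$. If $n=2$ there is exactly one further independent relation, $\frac12\{\bar D_1,\bar D_2\}-\bar D_3^2-\bar\square^2-\frac14(\bar D_0^2+\bar D_4^2-\bar D_5^2)=0$. The operator $\bar D_0^2+\bar D_1-\bar D_2+\bar D_4^2-\bar D_5^2$ is central.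
   Context: Notation: $\{A,B\}=AB+BA$, $[A,B]=AB-BA$. For a Riemannian manifold $M$, $M_{\mathbb S}$ is the total space of its unit tangent sphere bundle. $\mathrm{Diff}(M_{\mathbb S})$ is the algebra of differential operators on $M_{\mathbb S}$ with complex coefficients that are invariant under the identity component of the isometry group of $M$. $\mathbf P^n(\mathbb C)$ is complex projective space with its standard (Fubini–Study) metric, acted on by $G=\mathrm{SU}(n+1)$, with $\mathfrak g=\mathfrak{su}(n+1)$. The stabilizer of the point of $\mathbf P^n(\mathbb C)_{\mathbb S}$ given by the line of $(1,0,\dots,0)$ and the direction of $(0,1,0,\dots,0)$ is $$K_0=\{\mathrm{diag}(a,a,U)\in\mathrm{SU}(n+1): |a|=1,\ U\in\mathrm U(n-1)\},$$ with Lie algebra $\mathfrak k_0$. So $\mathbf P^n(\mathbb C)_{\mathbb S}=G/K_0$. $U(\mathfrak g)$ is the universal enveloping algebra over $\mathbb C$, and $U(\mathfrak g)^{K_0}$ is the subalgebra of $\mathrm{Ad}_{K_0}$-invariants. $(U(\mathfrak g)\mathfrak k_0)^{K_0}$ is the set of invariants in the left ideal generated by $\mathfrak k_0$; it is a two-sided ideal of $U(\mathfrak g)^{K_0}$. One has $\mathrm{Diff}(G/K_0)\cong U(\mathfrak g)^{K_0}/(U(\mathfrak g)\mathfrak k_0)^{K_0}$, where $X_1\cdots X_m$ acts by $$f\mapsto \partial_{t_1}\cdots\partial_{t_m}\big|_{t=0}f(g\exp(t_1X_1)\cdots\exp(t_mX_m)K_0).$$ An element of $U(\mathfrak g)^{K_0}$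 and its class are denoted by the same symbol, and all relations hold in the quotient. Let $E_{kj}$ be the matrix units, $\mathbf i$ the imaginary unit as a matrix entry, and $$\Psi_{kj}=\tfrac12(E_{kj}-E_{jk}),\quad \Upsilon_{kj}=\tfrac{\mathbf i}2(E_{kj}+E_{jk}),\quad \Upsilon_*=\tfrac{\mathbf i}2(E_{11}-E_{22})$$ as elements of $\mathfrak g$ (for $k\neq j$). Define (sums over $k=3,\dots,n+1$): $D_0=-\Psi_{12}$, $D_4=\Upsilon_{12}$, $D_5=\Upsilon_*$, $D_1=\sum(\Psi_{1k}^2+\Upsilon_{1k}^2)$, $D_2=\sum(\Psi_{2k}^2+\Upsilon_{2k}^2)$, $D_3=-\frac12\sum(\{\Psi_{1k},\Psi_{2k}\}+\{\Upsilon_{1k},\Upsilon_{2k}\})$, $\square=\frac12\sum(-\{\Psi_{1k},\Upsilon_{2k}\}+\{\Psi_{2k},\Upsilon_{1k}\})$. Hyperbolic case: $\mathbf H^n(\mathbb C)$ is complex hyperbolic space. With $\mathfrak g=\mathfrak k\oplus\mathfrak p$ the Cartan decomposition at $(1:0:\dots:0)$ ($\mathfrak p$ spanned by $\Psi_{1k},\Upsilon_{1k}$, $2\le k\le n+1$), the isometry algebra of $\mathbf H^n(\mathbb C)$ is the real form $\mathfrak k\oplus\sqrt{-1}\,\mathfrak p$ of $\mathfrak g\otimes\mathbb C$. The stabilizer in $\mathbf H^n(\mathbb C)_{\mathbb S}$ has Lie algebra $\mathfrak k_0$ with the same adjoint action. So $\mathrm{Diff}(\mathbf H^n(\mathbb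 C)_{\mathbb S})$ is likewise identified with $U(\mathfrak g\otimes\mathbb C)^{K_0}/(U(\mathfrak g\otimes\mathbb C)\mathfrak k_0)^{K_0}$. Here $\sqrt{-1}$ is the scalar imaginary unit of the complexification $\mathfrak g\otimes_{\mathbb R}\mathbb C$. *)

(* Defs.v *)
From HB Require Import structures.
From mathcomp Require Import all_boot all_order all_algebra.
From mathcomp Require Import boolp reals.
From mathcomp Require Import complex.
From mathcomp Require Import finmap monalg.

Set Implicit Arguments.
Unset Strict Implicit.
Unset Printing Implicit Defensive.

Import Order.TTheory GRing.Theory Num.Theory.
Local Open Scope ring_scope.
Local Open Scope complex_scope.
Local Open Scope sesquilinear_scope.
Local Open Scope quotient_scope.

Section FreeAlgebra.
Variables (C : comNzRingType) (X : choiceType).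
Local Notation malgX := {malg C[{fmonom X}]}.

(* The monoid algebra of words in X. It is wrapped, and its operations locked,
   to keep failing conversion tests from unfolding finitely supported maps. *)
Record freealg := FreeAlg { malg_of_freealg :> malgX }.

HB.instance Definition _ := [isNew for malg_of_freealg].
HB.instance Definition _ := [Choice of freealg by <:].

Fact freealg_key : unit. Proof. by []. Qed.

Definition freealg_add : freealg -> freealg -> freealg :=
  locked_with freealg_key (fun f g => FreeAlg ((f : malgX) + (g : malgX))).

Definition freealg_opp : freealg -> freealg :=
  locked_with freealg_key (fun f => FreeAlg (- (f : malgX))).

Definition freealg_mul : freealg -> freealg -> freealg :=
  locked_with freealg_key (fun f g => FreeAlg ((f : malgX) * (g : malgX))).

Definition freealg_scale : C -> freealg -> freealg :=
  locked_with freealg_key (fun a f => FreeAlg (a *: (f : malgX))).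

Let addE f g : freealg_add f g = FreeAlg ((f : malgX) + g).
Proof. by rewrite /freealg_add locked_withE. Qed.

Let oppE f : freealg_opp f = FreeAlg (- (f : malgX)).
Proof. by rewrite /freealg_opp locked_withE. Qed.

Let mulE f g : freealg_mul f g = FreeAlg ((f : malgX) * g).
Proof. by rewrite /freealg_mul locked_withE. Qed.

Let scaleE a f : freealg_scale a f = FreeAlg (a *: (f : malgX)).
Proof. by rewrite /freealg_scale locked_withE. Qed.

Let opE := (addE, oppE, mulE, scaleE).

Lemma freealg_addA : associative freealg_add.
Proof. by move=> f g h; apply: val_inj; rewrite !opE /= addrA. Qed.

Lemma freealg_addC : commutative freealg_add.
Proof. by move=> f g; apply: val_inj; rewrite !opE /= addrC. Qed.

Lemma freealg_add0 : left_id (FreeAlg 0) freealg_add.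
Proof. by move=> f; apply: val_inj; rewrite !opE /= add0r. Qed.

Lemma freealg_addN : left_inverse (FreeAlg 0) freealg_opp freealg_add.
Proof. by move=> f; apply: val_inj; rewrite !opE /= addNr. Qed.

HB.instance Definition _ := GRing.isZmodule.Build freealg
  freealg_addA freealg_addC freealg_add0 freealg_addN.

Lemma freealg_mulA : associative freealg_mul.
Proof. by move=> f g h; apply: val_inj; rewrite !opE /= mulrA. Qed.

Lemma freealg_mul1 : left_id (FreeAlg 1) freealg_mul.
Proof. by move=> f; apply: val_inj; rewrite !opE /= mul1r. Qed.

Lemma freealg_mulr1 : right_id (FreeAlg 1) freealg_mul.
Proof. by move=> f; apply: val_inj; rewrite !opE /= mulr1. Qed.

Lemma freealg_mulDl : left_distributive freealg_mul freealg_add.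
Proof. by move=> f g h; apply: val_inj; rewrite !opE /= mulrDl. Qed.

Lemma freealg_mulDr : right_distributive freealg_mul freealg_add.
Proof. by move=> f g h; apply: val_inj; rewrite !opE /= mulrDr. Qed.

Lemma freealg_one_neq0 : FreeAlg 1 != FreeAlg 0.
Proof. exact: (oner_neq0 malgX). Qed.

HB.instance Definition _ := GRing.Zmodule_isNzRing.Build freealg
  freealg_mulA freealg_mul1 freealg_mulr1 freealg_mulDl freealg_mulDr
  freealg_one_neq0.

Lemma freealg_scaleA a b f :
  freealg_scale a (freealg_scale b f) = freealg_scale (a * b) f.
Proof. by apply: val_inj; rewrite !opE /= scalerA. Qed.

Lemma freealg_scale1 : left_id 1 freealg_scale.
Proof. by move=> f; apply: val_inj; rewrite !opE /= scale1r. Qed.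

Lemma freealg_scaleDr : right_distributive freealg_scale freealg_add.
Proof. by move=> a f g; apply: val_inj; rewrite !opE /= scalerDr. Qed.

Lemma freealg_scaleDl f : {morph freealg_scale^~ f : a b / a + b}.
Proof.
by move=> a b; apply: val_inj; rewrite -[RHS]/(val (freealg_add _ _)) !opE /= scalerDl.
Qed.

HB.instance Definition _ := GRing.Zmodule_isLmodule.Build C freealg
  freealg_scaleA freealg_scale1 freealg_scaleDr freealg_scaleDl.

Lemma malg_of_freealgD f g : malg_of_freealg (f + g) = (f : malgX) + g.
Proof. exact: congr1 (addE f g). Qed.

Lemma malg_of_freealgN f : malg_of_freealg (- f) = - (f : malgX).
Proof. exact: congr1 (oppE f). Qed.

Lemma malg_of_freealgB f g : malg_of_freealg (f - g) = (f : malgX) - (g : malgX).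
Proof. by rewrite malg_of_freealgD malg_of_freealgN. Qed.

Lemma malg_of_freealgM f g : malg_of_freealg (f * g) = (f : malgX) * g.
Proof. exact: congr1 (mulE f g). Qed.

Lemma malg_of_freealgZ a f : malg_of_freealg (a *: f) = a *: (f : malgX).
Proof. exact: congr1 (scaleE a f). Qed.

Lemma freealg_scaleAl (a : C) (f g : freealg) : a *: (f * g) = a *: f * g.
Proof.
by apply: val_inj; rewrite /= !(malg_of_freealgZ, malg_of_freealgM) scalerAl.
Qed.

HB.instance Definition _ :=
  GRing.Lmodule_isLalgebra.Build C freealg freealg_scaleAl.

Lemma freealg_scaleAr (a : C) (f g : freealg) : a *: (f * g) = f * (a *: g).
Proof.
have mulC (c : C) (h : malgX) : h * c%:MP = c *: h.
  rewrite malgM_def malgZ_def fgmulgU; apply: eq_bigr => k _.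
  by rewrite mulm1 mulrC.
apply: val_inj; rewrite /= !(malg_of_freealgZ, malg_of_freealgM).
by rewrite -!mulC mulrA.
Qed.

HB.instance Definition _ :=
  GRing.Lalgebra_isAlgebra.Build C freealg freealg_scaleAr.

Definition fvar : X -> freealg :=
  locked_with freealg_key (fun x => FreeAlg << fmu x >>).

Lemma fvarE x : fvar x = FreeAlg << fmu x >>.
Proof. by rewrite /fvar locked_withE. Qed.
End FreeAlgebra.

Section FreeEval.
Variables (C : comNzRingType) (X : choiceType) (A : algType C) (v : X -> A).

Definition fmonom_eval (m : {fmonom X}) : A := \prod_(x <- (m : seq X)) v x.

Lemma fmonom_eval_is_mmorphism : mmorphism fmonom_eval.
Proof.
split=> [m1 m2|]; first by rewrite /fmonom_eval fmM big_cat.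
by rewrite /fmonom_eval fm1 big_nil.
Qed.

HB.instance Definition _ :=
  isMultiplicative.Build _ _ fmonom_eval fmonom_eval_is_mmorphism.

Definition feval : freealg C X -> A := locked_with freealg_key
  (fun f : freealg C X =>
     \sum_(m <- msupp f) f@_m *: \prod_(x <- (m : seq X)) v x).

Lemma fevalE f : feval f = mmap (in_alg A) fmonom_eval f.
Proof.
rewrite /feval locked_withE mmapE; apply: eq_bigr => m _.
by rewrite mulr_algl.
Qed.

Lemma feval_is_zmod_morphism : zmod_morphism feval.
Proof. by move=> f g; rewrite !fevalE malg_of_freealgB mmapB. Qed.

Lemma feval_is_scalable : scalable feval.
Proof.
by move=> a f; rewrite !fevalE malg_of_freealgZ mmapZ mulr_algl.
Qed.

Lemma feval_is_monoid_morphism : monoid_morphism feval.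
Proof.
have [mulE oneE] : multiplicative (mmap (in_alg A) fmonom_eval).
  apply: commr_mmap_is_multiplicative => f m m'.
  by rewrite /GRing.comm mulr_algl mulr_algr.
by split=> [|f g]; rewrite !fevalE; [exact: oneE|rewrite malg_of_freealgM mulE].
Qed.

HB.instance Definition _ :=
  GRing.isZmodMorphism.Build (freealg C X) A feval feval_is_zmod_morphism.
HB.instance Definition _ :=
  GRing.isScalable.Build C (freealg C X) A *:%R feval feval_is_scalable.
HB.instance Definition _ :=
  GRing.isMonoidMorphism.Build (freealg C X) A feval feval_is_monoid_morphism.

Lemma feval_var x : feval (fvar C x) = v x.
Proof.
by rewrite fevalE fvarE mmapU /= scale1r mul1r /fmonom_eval fmU big_seq1.
Qed.

Lemma fevalB f g : feval (f - g) = feval f - feval g.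
Proof. exact: raddfB. Qed.

Lemma fevalD f g : feval (f + g) = feval f + feval g.
Proof. exact: raddfD. Qed.

Lemma fevalM f g : feval (f * g) = feval f * feval g.
Proof. exact: rmorphM. Qed.

Lemma feval1 : feval 1 = 1.
Proof. exact: rmorph1. Qed.

Lemma fevalZ a f : feval (a *: f) = a *: feval f.
Proof. exact: linearZ. Qed.
End FreeEval.

Definition comm (A : nzRingType) (x y : A) : A := x * y - y * x.
Definition acomm (A : nzRingType) (x y : A) : A := x * y + y * x.

Section TwoSidedIdeal.
Variable A : nzRingType.

Definition two_sided_ideal (I : A -> Prop) :=
  [/\ I 0, forall x y, I x -> I y -> I (x - y)
    & forall a b x, I x -> I (a * x * b)].

Definition ideal_gen (S : A -> Prop) (x : A) :=
  forall I, two_sided_ideal I -> (forall y, S y -> I y) -> I x.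

Lemma ideal_gen_ideal S : two_sided_ideal (ideal_gen S).
Proof.
split=> [I [? _ _] _ //|x y Sx Sy I idI SI|a b x Sx I idI SI].
  by have [_ IB _] := idI; apply: IB; [apply: Sx|apply: Sy].
by have [_ _ IM] := idI; apply: IM; apply: Sx.
Qed.

Lemma ideal_gen_sub (S : A -> Prop) x : S x -> ideal_gen S x.
Proof. by move=> Sx I _; apply. Qed.
End TwoSidedIdeal.

Section Enveloping.
Variables (R : nzRingType) (C : comNzRingType) (phi : {rmorphism R -> C}).
Variables (L : lmodType R) (br : L -> L -> L).

Inductive uea_rel : freealg C L -> Prop :=
| Uea_linear (a : R) x y :
    uea_rel (fvar _ (a *: x + y) - (phi a *: fvar _ x + fvar _ y))
| Uea_bracket x y :
    uea_rel (fvar _ (br x y) - (fvar _ x * fvar _ y - fvar _ y * fvar _ x)).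

Definition uea_ideal : {pred freealg C L} :=
  fun f => `[< ideal_gen uea_rel f >].

Lemma uea_idealP f : reflect (ideal_gen uea_rel f) (f \in uea_ideal).
Proof. exact: asboolP. Qed.

Lemma uea_ideal_zmod_closed : zmod_closed uea_ideal.
Proof.
have [I0 IB _] := ideal_gen_ideal uea_rel.
split=> [|f g /uea_idealP If /uea_idealP Ig]; apply/uea_idealP=> //.
exact: IB.
Qed.

HB.instance Definition _ :=
  GRing.isZmodClosed.Build (freealg C L) uea_ideal uea_ideal_zmod_closed.

Lemma uea_idealM a b f : f \in uea_ideal -> a * f * b \in uea_ideal.
Proof.
have [_ _ IM] := ideal_gen_ideal uea_rel.
by move=> /uea_idealP If; apply/uea_idealP; apply: IM.
Qed.

Section Evaluation.
Variables (A : algType C) (v : L -> A).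
Hypothesis v_linear : forall (a : R) x y, v (a *: x + y) = phi a *: v x + v y.
Hypothesis v_bracket : forall x y, v (br x y) = v x * v y - v y * v x.

Lemma uea_ideal_feval f : f \in uea_ideal -> feval v f = 0.
Proof.
move=> /uea_idealP /(_ (fun g => feval v g = 0)); apply.
  split=> [|g h g0 h0|g g' h h0]; first exact: raddf0.
    by rewrite fevalB g0 h0 subr0.
  by rewrite !fevalM h0 mulr0 mul0r.
move=> _ [a x y|x y].
  by rewrite fevalB fevalD fevalZ !feval_var v_linear subrr.
by rewrite !fevalB !fevalM !feval_var v_bracket subrr.
Qed.
End Evaluation.

Lemma uea_ideal1 : 1 \notin uea_ideal.
Proof.
apply/negP => /(@uea_ideal_feval C^o (fun=> 0)); rewrite feval1 => eval0.
have /eqP := oner_neq0 C; apply; apply: eval0.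
  by move=> a x y; rewrite scaler0 addr0.
by move=> x y; rewrite mulr0 subrr.
Qed.

Definition uea := Quotient.quot uea_ideal.
HB.instance Definition _ := GRing.Zmodule.on uea.
HB.instance Definition _ := EqQuotient.on uea.

Definition uea_pi (f : freealg C L) : uea := \pi f.

Lemma uea_piP f g : (uea_pi f = uea_pi g) <-> (f - g \in uea_ideal).
Proof.
by rewrite Quotient.idealrBE; split=> [/eqP|/eqP].
Qed.

Lemma uea_reprK (u : uea) : uea_pi (repr u) = u.
Proof. exact: reprK. Qed.

Lemma uea_repr_pi f : repr (uea_pi f) - f \in uea_ideal.
Proof. by apply/uea_piP; rewrite uea_reprK. Qed.

Lemma uea_piB : {morph uea_pi : f g / f - g}.
Proof.
by move=> f g; rewrite /uea_pi Quotient.pi_add Quotient.pi_opp.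
Qed.

Definition uea_one : uea := uea_pi 1.

Definition uea_mul : uea -> uea -> uea :=
  locked_with freealg_key (fun u v => uea_pi (repr u * repr v)).

Definition uea_scale : C -> uea -> uea :=
  locked_with freealg_key (fun a u => uea_pi (a *: repr u)).

Lemma uea_pi_mul f g : uea_pi (f * g) = uea_mul (uea_pi f) (uea_pi g).
Proof.
rewrite /uea_mul locked_withE.
apply/esym/uea_piP; set f' := repr _; set g' := repr _.
have -> : f' * g' - f * g = 1 * (f' - f) * g' + f * (g' - g) * 1.
  by rewrite mul1r mulr1 mulrBl mulrBr addrA subrK.
by rewrite rpredD // uea_idealM // uea_repr_pi.
Qed.

Lemma uea_pi_scale a f : uea_pi (a *: f) = uea_scale a (uea_pi f).
Proof.
rewrite /uea_scale locked_withE.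
apply/esym/uea_piP; set f' := repr _.
have -> : a *: f' - a *: f = a%:A * (f' - f) * 1.
  by rewrite mulr1 mulr_algl scalerBr.
by rewrite uea_idealM // uea_repr_pi.
Qed.

Lemma uea_ind (P : uea -> Prop) : (forall f, P (uea_pi f)) -> forall u, P u.
Proof. by move=> Ppi u; rewrite -[u]uea_reprK. Qed.

Lemma uea_piD : {morph uea_pi : f g / f + g}.
Proof.
have pi0 : uea_pi 0 = 0 by rewrite -[0 in LHS](subrr 0) uea_piB subrr.
have piN g : uea_pi (- g) = - uea_pi g by rewrite -sub0r uea_piB pi0 sub0r.
by move=> f g; rewrite -[g in LHS]opprK uea_piB piN opprK.
Qed.

Lemma uea_mulA : associative uea_mul.
Proof.
by elim/uea_ind=> f; elim/uea_ind=> g; elim/uea_ind=> h;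
   rewrite -!uea_pi_mul mulrA.
Qed.

Lemma uea_mul1 : left_id uea_one uea_mul.
Proof. by elim/uea_ind=> f; rewrite -uea_pi_mul mul1r. Qed.

Lemma uea_mulr1 : right_id uea_one uea_mul.
Proof. by elim/uea_ind=> f; rewrite -uea_pi_mul mulr1. Qed.

Lemma uea_mulDl : left_distributive uea_mul +%R.
Proof.
by elim/uea_ind=> f; elim/uea_ind=> g; elim/uea_ind=> h;
   rewrite -uea_piD -!uea_pi_mul mulrDl uea_piD.
Qed.

Lemma uea_mulDr : right_distributive uea_mul +%R.
Proof.
by elim/uea_ind=> f; elim/uea_ind=> g; elim/uea_ind=> h;
   rewrite -uea_piD -!uea_pi_mul mulrDr uea_piD.
Qed.

Lemma uea_one_neq0 : uea_one != 0.
Proof.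
have pi0 : uea_pi 0 = 0 by rewrite -[0 in LHS](subrr 0) uea_piB subrr.
by apply/eqP; rewrite -pi0 => /uea_piP; rewrite subr0; apply/negP/uea_ideal1.
Qed.

HB.instance Definition _ := GRing.Zmodule_isNzRing.Build uea
  uea_mulA uea_mul1 uea_mulr1 uea_mulDl uea_mulDr uea_one_neq0.

Lemma uea_scaleA a b u : uea_scale a (uea_scale b u) = uea_scale (a * b) u.
Proof. by elim/uea_ind: u => f; rewrite -!uea_pi_scale scalerA. Qed.

Lemma uea_scale1 : left_id 1 uea_scale.
Proof. by elim/uea_ind=> f; rewrite -uea_pi_scale scale1r. Qed.

Lemma uea_scaleDr : right_distributive uea_scale +%R.
Proof.
by move=> a; elim/uea_ind=> f; elim/uea_ind=> g;
   rewrite -uea_piD -!uea_pi_scale scalerDr uea_piD.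
Qed.

Lemma uea_scaleDl u : {morph uea_scale^~ u : a b / a + b}.
Proof.
by elim/uea_ind: u => f a b; rewrite -!uea_pi_scale scalerDl uea_piD.
Qed.

HB.instance Definition _ := GRing.Zmodule_isLmodule.Build C uea
  uea_scaleA uea_scale1 uea_scaleDr uea_scaleDl.

Lemma uea_piM f g : uea_pi (f * g) = uea_pi f * uea_pi g.
Proof. exact: uea_pi_mul. Qed.

Lemma uea_piZ a f : uea_pi (a *: f) = a *: uea_pi f.
Proof. exact: uea_pi_scale. Qed.

Lemma uea_scaleAl (a : C) (u v : uea) : a *: (u * v) = a *: u * v.
Proof.
elim/uea_ind: u => f; elim/uea_ind: v => g.
by rewrite -!(uea_piM, uea_piZ) scalerAl.
Qed.

HB.instance Definition _ := GRing.Lmodule_isLalgebra.Build C uea uea_scaleAl.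

Lemma uea_scaleAr (a : C) (u v : uea) : a *: (u * v) = u * (a *: v).
Proof.
elim/uea_ind: u => f; elim/uea_ind: v => g.
by rewrite -!(uea_piM, uea_piZ) -scalerAr.
Qed.

HB.instance Definition _ := GRing.Lalgebra_isAlgebra.Build C uea uea_scaleAr.

Definition uea_in (x : L) : uea := uea_pi (fvar _ x).

Lemma uea_in_linear (a : R) x y :
  uea_in (a *: x + y) = phi a *: uea_in x + uea_in y.
Proof.
rewrite /uea_in -uea_piZ -uea_piD; apply/uea_piP/uea_idealP.
by apply: ideal_gen_sub; apply: Uea_linear.
Qed.

Lemma uea_in_bracket x y :
  uea_in (br x y) = uea_in x * uea_in y - uea_in y * uea_in x.
Proof.
rewrite /uea_in -!uea_piM -uea_piB; apply/uea_piP/uea_idealP.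
by apply: ideal_gen_sub; apply: Uea_bracket.
Qed.

Section Lift.
Variables (A : algType C) (v : L -> A).

(* The algebra morphism extending a map [v] that is R-linear and sends [br] to
   the commutator; for other [v] the value depends on a choice of
   representatives and is meaningless. *)
Definition uea_lift (u : uea) : A := feval v (repr u).

Hypothesis v_linear : forall (a : R) x y, v (a *: x + y) = phi a *: v x + v y.
Hypothesis v_bracket : forall x y, v (br x y) = v x * v y - v y * v x.

Lemma uea_lift_pi f : uea_lift (uea_pi f) = feval v f.
Proof.
apply/eqP; rewrite -subr_eq0 -fevalB; apply/eqP.
exact: uea_ideal_feval (uea_repr_pi f).
Qed.
End Lift.

End Enveloping.

Section SpecialUnitary.
Variables (R : realType) (m : nat).
Local Notation C := R[i].

Definition su_pred : {pred 'M[C]_m} :=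
  fun x => (x ^t* == - x) && (\tr x == 0).

Lemma su_predP x : reflect (x ^t* = - x /\ \tr x = 0) (x \in su_pred).
Proof. by apply: (iffP andP) => [[/eqP-> /eqP->]|[-> ->]]. Qed.

Lemma su_pred_zmod_closed : zmod_closed su_pred.
Proof.
split=> [|x y /su_predP[xH x0] /su_predP[yH y0]]; apply/su_predP.
  by rewrite mxtrace0 trmx0 map_mx0 oppr0.
by rewrite !raddfB /= xH yH x0 y0 subrr.
Qed.

HB.instance Definition _ :=
  GRing.isZmodClosed.Build 'M[C]_m su_pred su_pred_zmod_closed.

Record su := Su { su_mx :> 'M[C]_m; su_mxP : su_mx \in su_pred }.

HB.instance Definition _ := [isSub for su_mx].
HB.instance Definition _ := [Choice of su by <:].
HB.instance Definition _ := [SubChoice_isSubZmodule of su by <:].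

Lemma su_scale_subproof (a : R) (x : su) : a%:C *: su_mx x \in su_pred.
Proof.
have /su_predP[xH x0] := su_mxP x; apply/su_predP; split; last first.
  by rewrite linearZ /= x0 mulr0.
rewrite linearZ /= map_mxZ xH scalerN; congr (- (_ *: _)).
exact: conjc_real.
Qed.

Definition su_scale (a : R) (x : su) : su := Su (su_scale_subproof a x).

Lemma su_scaleA a b x : su_scale a (su_scale b x) = su_scale (a * b) x.
Proof. by apply: val_inj; rewrite /= scalerA -rmorphM. Qed.

Lemma su_scale1 : left_id 1 su_scale.
Proof. by move=> x; apply: val_inj; rewrite /= scale1r. Qed.

Lemma su_scaleDr : right_distributive su_scale +%R.
Proof. by move=> a x y; apply: val_inj; rewrite /= scalerDr. Qed.

Lemma su_scaleDl x : {morph su_scale^~ x : a b / a + b}.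
Proof. by move=> a b; apply: val_inj; rewrite /= rmorphD scalerDl. Qed.

HB.instance Definition _ := GRing.Zmodule_isLmodule.Build R su
  su_scaleA su_scale1 su_scaleDr su_scaleDl.

Lemma su_bracket_subproof (x y : su) :
  su_mx x *m su_mx y - su_mx y *m su_mx x \in su_pred.
Proof.
have /su_predP[xH _] := su_mxP x; have /su_predP[yH _] := su_mxP y.
apply/su_predP; split; last by rewrite raddfB /= mxtrace_mulC subrr.
rewrite raddfB /= !trmx_mul raddfB /= !map_mxM xH yH.
by rewrite !mulNmx !mulmxN !opprK opprB.
Qed.

Definition su_bracket (x y : su) : su := Su (su_bracket_subproof x y).
End SpecialUnitary.

Definition su_conj (R : realType) m (k : 'M[R[i]]_m) (x : su R m) : su R m :=
  insubd 0 (k *m x *m invmx k).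

Lemma su_conjE (R : realType) m (k : 'M[R[i]]_m) (x : su R m) :
  k \is unitarymx -> su_conj k x = k *m x *m invmx k :> 'M_m.
Proof.
move=> kU; rewrite /su_conj val_insubd ifT //.
have /su_predP[xH x0] := su_mxP x; apply/su_predP; split; last first.
  by rewrite mxtrace_mulC mulmxA mulVmx ?mul1mx ?unitarymx_unit.
by rewrite invmx_unitary // !trmx_mul !map_mxM xH trmxCK mulmxA mulmxN mulNmx.
Qed.

Lemma su_conj_linear (R : realType) m (k : 'M[R[i]]_m) (a : R) (x y : su R m) :
  k \is unitarymx -> su_conj k (a *: x + y) = a *: su_conj k x + su_conj k y.
Proof.
move=> kU; have E u := su_conjE u kU; apply: val_inj.
apply: etrans (E _) (etrans _ (esym (congr2 +%R
  (congr1 ( *:%R a%:C) (E x)) (E y)))).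
by rewrite [su_mx _]/(a%:C *: su_mx x + su_mx y) mulmxDr mulmxDl
  -scalemxAr -scalemxAl.
Qed.

Lemma su_conj_bracket (R : realType) m (k : 'M[R[i]]_m) (x y : su R m) :
  k \is unitarymx ->
  su_conj k (su_bracket x y) = su_bracket (su_conj k x) (su_conj k y).
Proof.
move=> kU; have E u := su_conjE u kU; apply: val_inj.
apply: etrans (E _) (etrans _ (esym (congr2 (fun u v => u - v)
  (congr2 mulmx (E x) (E y)) (congr2 mulmx (E y) (E x))))).
rewrite [su_mx _]/(su_mx x *m su_mx y - su_mx y *m su_mx x) mulmxBr mulmxBl.
have conjM (u v : 'M[R[i]]_m) :
    k *m (u *m v) *m invmx k = k *m u *m invmx k *m (k *m v *m invmx k).
  have -> : k *m u *m invmx k *m (k *m v *m invmx k)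
      = k *m u *m (invmx k *m k) *m v *m invmx k by rewrite !mulmxA.
  by rewrite mulVmx ?unitarymx_unit // mulmx1 !mulmxA.
by congr (_ - _); apply: conjM.
Qed.

Section InvariantOperators.
Variables (R : realType) (n : nat).
Local Notation C := R[i].
Local Notation G := 'M[C]_n.+1.
Local Notation g := (su R n.+1).
Local Notation Ug :=
  (uea (real_complex R : {rmorphism R -> C}) (@su_bracket R n.+1)).

Definition env : g -> Ug := @uea_in _ _ _ _ _.

(* The matrices of the form diag(a, a, U), with U of size n - 1. *)
Definition diag_aaU (x : G) : Prop :=
  x (inord 0) (inord 0) = x (inord 1) (inord 1) /\
  forall i j : 'I_n.+1, i != j -> (i < 2)%N || (j < 2)%N -> x i j = 0.

Definition K0 (k : G) : Prop :=
  [/\ k \is unitarymx, \det k = 1 & diag_aaU k].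

(* The Lie algebra of K0: that group is cut out of SU(n+1) by linear equations
   on the entries, so the same equations define its tangent space at 1. *)
Definition k0 (x : g) : Prop := diag_aaU x.

Definition Ad (k : G) : Ug -> Ug := uea_lift (fun x => env (su_conj k x)).

Lemma Ad_pi k f : k \is unitarymx ->
  Ad k (uea_pi _ _ f) = feval (fun x => env (su_conj k x)) f.
Proof.
move=> kU; apply: uea_lift_pi => [a x y|x y].
  by rewrite su_conj_linear // [LHS]uea_in_linear.
by rewrite su_conj_bracket // [LHS]uea_in_bracket.
Qed.

(* U(g)^K0 *)
Definition K0_invariant (u : Ug) : Prop := forall k, K0 k -> Ad k u = u.

(* U(g)k0 *)
Definition left_ideal_k0 (u : Ug) : Prop :=
  exists s : seq (Ug * g),
    (forall p, p \in s -> k0 p.2) /\ u = \sum_(p <- s) p.1 * env p.2.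

(* Equality in Diff(G/K0) = U(g)^K0 / (U(g)k0)^K0. *)
Definition Diff_eq (u v : Ug) : Prop :=
  K0_invariant (u - v) /\ left_ideal_k0 (u - v).

Definition generate_Diff (I : choiceType) (D : I -> Ug) : Prop :=
  (forall j, K0_invariant (D j)) /\
  forall u, K0_invariant u -> exists f : freealg C I, Diff_eq u (feval D f).

(* Indices run from 1 to n + 1, as usual for matrix units. *)
Definition E (k j : nat) : G := delta_mx (inord k.-1) (inord j.-1).

(* The element of U(g) given by a matrix of g, and 0 for other matrices; see
   [Psi_su], [Upsilon_su] and [Upsilon_star_su]. *)
Definition of_mx (x : G) : Ug := env (insubd 0 x).

Definition Psi_mx k j : G := 2^-1 *: (E k j - E j k).
Definition Upsilon_mx k j : G := ('i%C / 2) *: (E k j + E j k).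
Definition Upsilon_star_mx : G := ('i%C / 2) *: (E 1 1 - E 2 2).

Lemma trmxC_E k j : (E k j) ^t* = E j k.
Proof. by rewrite trmx_delta map_delta_mx. Qed.

Lemma mxtrace_E k j : (0 < k <= n.+1)%N -> (0 < j <= n.+1)%N ->
  \tr (E k j) = (k == j)%:R.
Proof.
case: k j => [|k] [|j] //=; rewrite !ltnS => kn jn.
rewrite /mxtrace (bigD1 (inord k)) //= big1 => [|l lk]; last first.
  by rewrite mxE (negPf lk).
by rewrite mxE eqxx /= addr0 -val_eqE /= !inordK // eqSS.
Qed.

Lemma Psi_su k j : Psi_mx k j \in @su_pred R n.+1.
Proof.
apply/su_predP; split; last first.
  rewrite linearZ raddfB /= [\tr (E k j)](_ : _ = \tr (E j k)) ?subrr ?mulr0 //.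
  by rewrite -[LHS]mxtrace_tr trmx_delta.
rewrite linearZ /= map_mxZ raddfB /= map_mxB !trmxC_E -scalerN opprB.
by rewrite fmorphV rmorph_nat.
Qed.

Lemma trmxC_half_i (x : G) : (('i%C / 2) *: x) ^t* = - (('i%C / 2) *: x ^t*).
Proof.
rewrite linearZ /= map_mxZ -scaleNr; congr (_ *: _).
rewrite rmorphM fmorphV rmorph_nat -mulNr; congr (_ / _).
by apply/eqP; rewrite eq_complex /= oppr0 !eqxx.
Qed.

Lemma Upsilon_su k j : (0 < k <= n.+1)%N -> (0 < j <= n.+1)%N -> k != j ->
  Upsilon_mx k j \in @su_pred R n.+1.
Proof.
move=> kn jn kj; apply/su_predP; split; last first.
  rewrite linearZ raddfD /= !mxtrace_E // (eq_sym j) (negPf kj).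
  by rewrite addr0 mulr0.
rewrite trmxC_half_i; congr (- (_ *: _)).
by rewrite raddfD /= map_mxD !trmxC_E addrC.
Qed.

Lemma Upsilon_star_su : (0 < n)%N -> Upsilon_star_mx \in @su_pred R n.+1.
Proof.
move=> n_gt0; apply/su_predP; split; last first.
  by rewrite linearZ raddfB /= !mxtrace_E // subrr mulr0.
rewrite trmxC_half_i; congr (- (_ *: _)).
by rewrite raddfB /= map_mxB !trmxC_E.
Qed.

Definition Psi k j : Ug := of_mx (Psi_mx k j).
Definition Upsilon k j : Ug := of_mx (Upsilon_mx k j).
Definition Upsilon_star : Ug := of_mx Upsilon_star_mx.

Definition D0 : Ug := - Psi 1 2.
Definition D1 : Ug := \sum_(3 <= k < n.+2) (Psi 1 k ^+ 2 + Upsilon 1 k ^+ 2).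
Definition D2 : Ug := \sum_(3 <= k < n.+2) (Psi 2 k ^+ 2 + Upsilon 2 k ^+ 2).
Definition D3 : Ug := - (2^-1 : C) *: \sum_(3 <= k < n.+2)
  (acomm (Psi 1 k) (Psi 2 k) + acomm (Upsilon 1 k) (Upsilon 2 k)).
Definition D4 : Ug := Upsilon 1 2.
Definition D5 : Ug := Upsilon_star.
Definition Dsq : Ug := (2^-1 : C) *: \sum_(3 <= k < n.+2)
  (- acomm (Psi 1 k) (Upsilon 2 k) + acomm (Psi 2 k) (Upsilon 1 k)).

(* D_0, ..., D_5 followed by the square operator. *)
Definition D (j : 'I_7) : Ug := tnth [tuple D0; D1; D2; D3; D4; D5; Dsq] j.

(* The solution of D_0 = i Dbar_0, D_1 = - Dbar_1, D_2 = Dbar_2,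
   D_3 = i Dbar_3, D_4 = i Dbar_4, D_5 = Dbar_5, Dsq = i Dbarsq in
   U(g) = U(g (x) C), where i is the scalar of the complexification. This is
   also the enveloping algebra of the real form k + i p of g (x) C, so that
   the same [Diff_eq] describes the operators over hyperbolic space. *)
Definition Dbar (j : 'I_7) : Ug :=
  tnth [tuple 'i%C^-1 *: D0; - D1; D2; 'i%C^-1 *: D3; 'i%C^-1 *: D4; D5;
              'i%C^-1 *: Dsq] j.

End InvariantOperators.

(* Relations between seven elements of an algebra, as pairs of a left and a
   right hand side. The scalar c stands for (n - 1)^2 / 4. *)
Section Relations.
Variables (F : fieldType) (A : algType F) (c : F) (d : 'I_7 -> A).

Local Notation d0 := (d (inord 0)).
Local Notation d1 := (d (inord 1)).
Local Notation d2 := (d (inord 2)).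
Local Notation d3 := (d (inord 3)).
Local Notation d4 := (d (inord 4)).
Local Notation d5 := (d (inord 5)).
Local Notation sq := (d (inord 6)).
Local Notation h := (2^-1 : F).
Local Notation q := (4^-1 : F).

Definition projective_relations : seq (A * A) :=
  [:: (comm d0 d1, - d3);
      (comm d0 d2, d3);
      (comm d0 d3, h *: (d1 - d2));
      (comm d0 d4, - d5);
      (comm d0 d5, d4);
      (comm d0 sq, 0);
      (comm d1 d2, - acomm d0 d3 - acomm sq d4);
      (comm d1 d3, - h *: acomm d0 d1 + h *: acomm sq d5 + c *: d0);
      (comm d1 d4, sq);
      (comm d1 d5, 0);
      (comm d1 sq, - h *: acomm d1 d4 - h *: acomm d3 d5 + c *: d4);
      (comm d2 d3, h *: acomm d0 d2 + h *: acomm sq d5 - c *: d0);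
      (comm d2 d4, - sq);
      (comm d2 d5, 0);
      (comm d2 sq, h *: acomm d2 d4 - h *: acomm d3 d5 - c *: d4);
      (comm d3 d4, 0);
      (comm d3 d5, sq);
      (comm d3 sq, - q *: acomm (d1 + d2) d5 + c *: d5);
      (comm d4 d5, - d0);
      (comm d4 sq, h *: (d1 - d2));
      (comm d5 sq, d3)].

Definition projective_extra : A :=
  h *: acomm d1 d2 - d3 ^+ 2 - sq ^+ 2
    - q *: (d0 ^+ 2 + d4 ^+ 2 + d5 ^+ 2).

Definition projective_central : A :=
  d0 ^+ 2 + d1 + d2 + d4 ^+ 2 + d5 ^+ 2.

Definition hyperbolic_relations : seq (A * A) :=
  [:: (comm d0 d1, d3);
      (comm d0 d2, d3);
      (comm d0 d3, h *: (d1 + d2));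
      (comm d0 d4, d5);
      (comm d0 d5, d4);
      (comm d0 sq, 0);
      (comm d1 d2, - acomm d0 d3 - acomm sq d4);
      (comm d1 d3, - h *: acomm d0 d1 - h *: acomm sq d5 - c *: d0);
      (comm d1 d4, - sq);
      (comm d1 d5, 0);
      (comm d1 sq, - h *: acomm d1 d4 + h *: acomm d3 d5 - c *: d4);
      (comm d2 d3, h *: acomm d0 d2 + h *: acomm sq d5 - c *: d0);
      (comm d2 d4, - sq);
      (comm d2 d5, 0);
      (comm d2 sq, h *: acomm d2 d4 - h *: acomm d3 d5 - c *: d4);
      (comm d3 d4, 0);
      (comm d3 d5, sq);
      (comm d3 sq, - q *: acomm (d1 - d2) d5 - c *: d5);
      (comm d4 d5, - d0);
      (comm d4 sq, h *: (d1 + d2));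
      (comm d5 sq, d3)].

Definition hyperbolic_extra : A :=
  h *: acomm d1 d2 - d3 ^+ 2 - sq ^+ 2
    - q *: (d0 ^+ 2 + d4 ^+ 2 - d5 ^+ 2).

Definition hyperbolic_central : A :=
  d0 ^+ 2 + d1 - d2 + d4 ^+ 2 - d5 ^+ 2.
End Relations.

Section Presentation.
Variables (R : realType) (n : nat).
Local Notation Ug :=
  (uea (real_complex R : {rmorphism R -> R[i]}) (@su_bracket R n.+1)).
Local Notation F7 := (freealg R[i] 'I_7).

Definition satisfy (rel : seq (Ug * Ug)) : Prop :=
  forall r, r \in rel -> Diff_eq r.1 r.2.

(* The relations among the classes of the [D j] are the elements of the
   two-sided ideal of the free algebra generated by [S]. *)
Definition relations_generated_by (D : 'I_7 -> Ug) (S : F7 -> Prop) : Prop :=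
  forall f : F7, Diff_eq (feval D f) 0 <-> ideal_gen S f.

Definition central_in_Diff (z : Ug) : Prop :=
  K0_invariant z /\ forall u, K0_invariant u -> Diff_eq (comm z u) 0.
End Presentation.

Definition differences (A : nzRingType) (rel : seq (A * A)) (x : A) : Prop :=
  exists2 r, r \in rel & x = r.1 - r.2.

(* Main.v *)
From HB Require Import structures.
From mathcomp Require Import all_boot all_order all_algebra.
From mathcomp Require Import boolp reals complex.
From mathcomp Require Import mpoly ring.
Require Import Defs.

Set Implicit Arguments.
Unset Strict Implicit.
Unset Printing Implicit Defensive.

Import Order.TTheory GRing.Theory Num.Theory.
Local Open Scope ring_scope.

(** Let n = m + 1 with m > 0. The Lie algebra gl(m + 2) maps to U = U(su(m + 2)),
    the scalar matrices going to 0, and every congruence below is modulo the left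
    ideal U k0. The blocks of a matrix of size 2 + m give elements K_ij (the
    traceless part of the upper 2 x 2 block) and the symmetrized products
      Z_ij = 1/2 sum_k (r_ik l_kj + l_kj r_ik)
    of the upper right block r and the lower left block l, for i, j = 1, 2. They are
    invariant under K0, and D0, ..., D5 and the square operator are linear
    combinations of them (D_blocks).

    Commutation relations. The K_ij act on the K_pq and Z_pq as gl_2 acts on 2 x 2
    matrices, and [Z_ij, Z_pq] is a combination of the products of K and Z and,
    with the coefficient m^2 / 4, of K (comm_Zmx). All the commutation relations of the
    theorem are linear combinations of these (blocks_projective), and the centrality of
    D0^2 + D1 + D2 + D4^2 + D5^2 follows from them by computation
    (projective_central_comm). When m = 1 the matrix Z is a column times a row, so
    its determinant is of lower order (Zmx_det); this is the additional relation.
    It is not a consequence of the others, because these hold for the character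
    with D1, D2 |-> 1 and all other generators |-> 0 (extra_independent).

    Symbols. An element x of gl(m + 2) acts on the polynomials in the entries of two
    generic matrices X by the derivation X |-> [X, x]. A certain linear polynomial
    gen0 is killed by k0, and its differentials at the points q give all linear
    forms on g / k0 (lam_surj). Applying an element of order at most d to the d-th
    power of gen0 - gen0(q) and evaluating at q yields its symbol of degree d, and
    an element of order at most d whose symbols vanish is congruent to one of
    smaller order (FilJ_symb_eq0).

    Generation. The symbol of an invariant element is a polynomial in three
    coordinates t of the upper block, in x of size 2 x m and in y of size m x 2,
    invariant under (x, y) |-> (x W^-1, W y) for W unitary (invariant_symbol), hence
    for all W, because a polynomial vanishing on the unitary group vanishes
    (unitary_dense). So it is a polynomial in t and x y
    (first_fundamental_theorem), that is, in the symbols of the seven operators,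
    and induction on the order concludes (generation).

    Completeness. The commutation relations rewrite every word in the generators as
    a combination of ordered ones. When m > 1 the seven symbols are algebraically
    independent (symv_surj). When m = 1 their only relation is d1 d2 = d3^2 + d6^2,
    and the additional relation removes the ordered words containing both D1 and
    D2, after which the symbols of the others are independent (symv_indep_small).
    In both cases a combination of the remaining words which belongs to U k0 is
    zero (relations_in_ideal).

    Hyperbolic space. The operators over it are multiples of those above, and the
    rescaling of the variables maps each hyperbolic relation to a nonzero multiple
    of the projective one (hyperbolic_relation, rescale_ideal). *)


(** * Identities in noncommutative algebras by reflection *)

Section NoncommutativeReflection.
Variables (F : comNzRingType) (A : algType F).

(* Noncommutative polynomials are normalized to lists of coefficients and words;
   the vanishing of every coefficient is left to a commutative decision
   procedure, so that relations between scalars can be used. *)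
Inductive ncexpr :=
  | NCvar of nat | NCzero | NCone | NCopp of ncexpr
  | NCadd of ncexpr & ncexpr | NCmul of ncexpr & ncexpr
  | NCscale of F & ncexpr.

Fixpoint nc_eval (env : seq A) (e : ncexpr) : A :=
  match e with
  | NCvar i => nth 0 env i
  | NCzero => 0
  | NCone => 1
  | NCopp a => - nc_eval env a
  | NCadd a b => nc_eval env a + nc_eval env b
  | NCmul a b => nc_eval env a * nc_eval env b
  | NCscale c a => c *: nc_eval env a
  end.

Fixpoint nc_word_eq (v w : seq nat) : bool :=
  match v, w with
  | nil, nil => true
  | cons i v', cons j w' => if Nat.eqb i j then nc_word_eq v' w' else false
  | _, _ => false
  end.

Fixpoint nc_insert (c : F) (w : seq nat) (l : seq (F * seq nat)) :=
  match l with
  | nil => cons (c, w) nil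
  | cons (d, v) l' =>
      if nc_word_eq w v then cons (d + c, v) l' else cons (d, v) (nc_insert c w l')
  end.

Fixpoint nc_sum (l1 l2 : seq (F * seq nat)) :=
  match l1 with
  | nil => l2
  | cons (c, w) l1' => nc_insert c w (nc_sum l1' l2)
  end.

Fixpoint nc_term (c : F) (w : seq nat) (l : seq (F * seq nat)) :=
  match l with
  | nil => nil
  | cons (d, v) l' => nc_insert (c * d) (app w v) (nc_term c w l')
  end.

Fixpoint nc_prod (l1 l2 : seq (F * seq nat)) :=
  match l1 with
  | nil => nil
  | cons (c, w) l1' => nc_sum (nc_term c w l2) (nc_prod l1' l2)
  end.

Fixpoint nc_norm (e : ncexpr) : seq (F * seq nat) :=
  match e with
  | NCvar i => cons (1, cons i nil) nil
  | NCzero => nil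
  | NCone => cons (1, nil) nil
  | NCopp a => nc_term (-1) nil (nc_norm a)
  | NCadd a b => nc_sum (nc_norm a) (nc_norm b)
  | NCmul a b => nc_prod (nc_norm a) (nc_norm b)
  | NCscale c a => nc_term c nil (nc_norm a)
  end.

Fixpoint nc_vanish (l : seq (F * seq nat)) : Prop :=
  match l with
  | nil => True
  | cons (c, _) l' => c = 0 /\ nc_vanish l'
  end.

Variable env : seq A.
Let mon (w : seq nat) : A := \prod_(i <- w) nth 0 env i.
Let val (l : seq (F * seq nat)) : A := \sum_(p <- l) p.1 *: mon p.2.

Let nc_word_eqP v w : nc_word_eq v w -> v = w.
Proof.
elim: v w => [|i v IH] [|j w] //=.
by case E: (Nat.eqb i j) => // /IH->; rewrite ((PeanoNat.Nat.eqb_eq i j).1 E).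
Qed.

Let val_insert c w l : val (nc_insert c w l) = c *: mon w + val l.
Proof.
rewrite /val; elim: l => [|[d v] l IH] /=; first by rewrite big_seq1 big_nil addr0.
case: ifP => [/nc_word_eqP->|_]; rewrite !big_cons /=.
  by rewrite addrA scalerDl [c *: _ + _]addrC.
by rewrite IH addrCA.
Qed.

Let val_sum l1 l2 : val (nc_sum l1 l2) = val l1 + val l2.
Proof.
elim: l1 => [|[c w] l IH] /=; first by rewrite [val nil]big_nil add0r.
by rewrite val_insert IH addrA [in RHS]/val big_cons.
Qed.

Let val_term c w l : val (nc_term c w l) = c *: mon w * val l.
Proof.
elim: l => [|[d v] l IH] /=; first by rewrite [val nil]big_nil mulr0.
rewrite val_insert IH [in RHS]/val big_cons mulrDr /=; congr (_ + _).
by rewrite /mon big_cat /= -scalerAr -scalerAl scalerA mulrC.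
Qed.

Let val_prod l1 l2 : val (nc_prod l1 l2) = val l1 * val l2.
Proof.
elim: l1 => [|[c w] l IH] /=; first by rewrite [val nil]big_nil mul0r.
by rewrite val_sum val_term IH [in RHS]/val big_cons mulrDl.
Qed.

Let val_norm e : val (nc_norm e) = nc_eval env e.
Proof.
have mon0 : mon [::] = 1 by rewrite /mon big_nil.
elim: e => [i|||a IH|a IHa b IHb|a IHa b IHb|c a IH] /=.
- by rewrite /val big_seq1 scale1r /mon big_seq1.
- by rewrite /val big_nil.
- by rewrite /val big_seq1 scale1r mon0.
- by rewrite val_term IH mon0 scaleN1r mulN1r.
- by rewrite val_sum IHa IHb.
- by rewrite val_prod IHa IHb.
- by rewrite val_term IH mon0 -scalerAl mul1r.
Qed.

Lemma nc_eval_eq0 e : nc_vanish (nc_norm e) -> nc_eval env e = 0.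
Proof.
rewrite -val_norm /val; elim: (nc_norm e) => [|[c w] l IH] /=.
  by rewrite big_nil.
by case=> -> /IH; rewrite big_cons scale0r add0r.
Qed.
End NoncommutativeReflection.

Ltac nc_add x l :=
  lazymatch l with
  | context [cons x _] => l
  | _ => constr:(cons x l)
  end.

Ltac nc_atoms t l :=
  lazymatch t with
  | @GRing.zero _ => l
  | @GRing.one _ => l
  | @GRing.opp _ ?a => nc_atoms a l
  | @GRing.add _ ?a ?b => let l' := nc_atoms a l in nc_atoms b l'
  | @GRing.mul _ ?a ?b => let l' := nc_atoms a l in nc_atoms b l'
  | @GRing.scale _ _ _ ?a => nc_atoms a l
  | _ => nc_add t l
  end.

Ltac nc_index x l :=
  lazymatch l with
  | cons x _ => constr:(0%nat)
  | cons _ ?l' => let i := nc_index x l' in constr:(S i)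
  end.

Ltac nc_reify F t l :=
  lazymatch t with
  | @GRing.zero _ => constr:(@NCzero F)
  | @GRing.one _ => constr:(@NCone F)
  | @GRing.opp _ ?a => let a' := nc_reify F a l in constr:(@NCopp F a')
  | @GRing.add _ ?a ?b =>
      let a' := nc_reify F a l in let b' := nc_reify F b l in
      constr:(@NCadd F a' b')
  | @GRing.mul _ ?a ?b =>
      let a' := nc_reify F a l in let b' := nc_reify F b l in
      constr:(@NCmul F a' b')
  | @GRing.scale _ _ ?c ?a =>
      let a' := nc_reify F a l in constr:(@NCscale F c a')
  | _ => let i := nc_index t l in constr:(@NCvar F i)
  end.

(* Reduces an equation between elements of an algebra [A] over [F] to the
   equations between the coefficients of the words in its atoms. *)
Ltac nc_coefs F A :=
  apply/eqP; rewrite -subr_eq0; apply/eqP;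
  lazymatch goal with |- ?t = _ =>
    let l := nc_atoms t (@nil A) in
    let e := nc_reify F t l in
    refine (@nc_eval_eq0 F A l e _);
    cbv beta iota zeta delta [nc_norm nc_sum nc_term nc_prod nc_insert
      nc_word_eq nc_vanish Nat.eqb app];
    repeat split
  end.


(** * Polynomial identities over infinite fields *)

Section Polynomials.
Variable F : numFieldType.

Lemma poly_eq0_seq (f : nat -> F) (q : {poly F}) :
  injective f -> (forall k, q.[f k] = 0) -> q = 0.
Proof.
move=> f_inj q0; apply/eqP/negP => /negP nz_q.
have := @max_poly_roots _ q (map f (iota 0 (size q))) nz_q.
rewrite size_map size_iota ltnn => H; apply: notF; apply: H.
  by apply/allP => _ /mapP[k _ ->]; apply/rootP.
by rewrite map_inj_uniq ?iota_uniq.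
Qed.

Lemma poly_eq0_nat (q : {poly F}) : (forall k : nat, q.[k%:R] = 0) -> q = 0.
Proof. by apply: poly_eq0_seq => i j /eqP; rewrite eqr_nat => /eqP. Qed.

(** Weighted components of an identity: rescaling by every s separates the terms
    by their weights e. *)
Lemma sum_powers_eq0 (T : Type) (r : seq T) (c : T -> F) (e : T -> nat) :
  (forall s : F, s != 0 -> \sum_(t <- r) c t * s ^+ e t = 0) ->
  forall k, \sum_(t <- r | e t == k) c t = 0.
Proof.
move=> H k; pose q : {poly F} := \sum_(t <- r) c t *: 'X^(e t).
have q0 : q = 0.
  apply: (@poly_eq0_seq (fun k : nat => k.+1%:R)) => [i j /eqP|i].
    by rewrite eqr_nat eqSS => /eqP.
  rewrite horner_sum -[RHS](H i.+1%:R) ?pnatr_eq0 //; apply: eq_bigr => t _.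
  by rewrite hornerZ hornerXn.
have := congr1 (fun q : {poly F} => q`_k) q0.
rewrite coef0 coef_sum => E; apply: etrans E; rewrite [LHS]big_mkcond /=.
apply: eq_bigr => t _.
by rewrite coefZ coefXn eq_sym; case: eqP; rewrite ?mulr1 ?mulr0.
Qed.

Lemma sum_digits_inj B n (a b : 'I_n -> nat) :
  (forall i, a i < B)%N -> (forall i, b i < B)%N ->
  (\sum_i a i * B ^ i = \sum_i b i * B ^ i)%N -> a =1 b.
Proof.
elim: n a b => [|n IH] a b aB bB; first by move=> _ [].
have S0 c : (\sum_(i < n.+1) c i * B ^ i
    = c ord0 + B * \sum_(i < n) c (lift ord0 i) * B ^ i)%N.
  rewrite big_ord_recl muln1 big_distrr /=; congr (_ + _)%N.
  by apply: eq_bigr => i _; rewrite /bump add1n expnS mulnCA.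
rewrite !S0 => E; have B0 : (0 < B)%N by apply: leq_ltn_trans (aB ord0).
have E0 : a ord0 = b ord0.
  have := congr1 (modn^~ B) E.
  by rewrite ![(_ + B * _)%N]addnC ![(B * _)%N]mulnC !modnMDl !modn_small.
have := IH (a \o lift ord0) (b \o lift ord0) (fun i => aB _) (fun i => bB _).
have /eqP : (B * \sum_(i < n) a (lift ord0 i) * B ^ i
    = B * \sum_(i < n) b (lift ord0 i) * B ^ i)%N.
  by apply/eqP; rewrite -(eqn_add2l (a ord0)) {2}E0 E.
rewrite eqn_pmul2l // => /eqP E1 /(_ E1) E2 i.
by case: (unliftP ord0 i) => [j|] ->; [apply: E2 | apply: E0].
Qed.

Section Multivariate.
Variable n : nat.
Implicit Types p : {mpoly F[n]}.

Lemma mmap_meval (S : comNzRingType) (f : {rmorphism F -> S})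
    (h : 'I_n -> S) (g : {rmorphism S -> F}) p :
  cancel f g -> g (mmap f h p) = p.@[fun i => g (h i)].
Proof.
move=> fK; rewrite mevalE /mmap rmorph_sum /=; apply: eq_bigr => m _.
rewrite rmorphM fK rmorph_prod; congr (_ * _); apply: eq_bigr => i _.
by rewrite rmorphXn.
Qed.

(** Restricting to the curve [i |-> s ^ (B ^ i)] with B large turns distinct
    monomials into distinct powers of s. *)
Lemma meval_eq0 p : (forall v, p.@[v] = 0) -> p = 0.
Proof.
move=> p0; apply/mpolyP => m; rewrite mcoeff0.
have [mp|/memN_msupp_eq0 //] := boolP (m \in msupp p).
pose wt (m : 'X_{1..n}) := (\sum_i m i * (msize p) ^ i)%N.
have := @sum_powers_eq0 _ (msupp p) (fun m => p@_m) wt _ (wt m).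
have Ewt m' : m' \in msupp p -> (wt m' == wt m) = (m' == m).
  move=> m'p; apply/eqP/eqP => [|->//] /sum_digits_inj H; apply/mnmP/H => i.
    by apply: leq_ltn_trans (msize_mdeg_lt m'p); rewrite mdegE (bigD1 i) // leq_addr.
  by apply: leq_ltn_trans (msize_mdeg_lt mp); rewrite mdegE (bigD1 i) // leq_addr.
rewrite big_mkcond (bigD1_seq m) ?msupp_uniq //= eqxx big_seq_cond big1 ?addr0.
  2: by move=> m' /andP[m'p]; rewrite Ewt // => /negPf->.
apply=> s _; apply: etrans (p0 (fun i => s ^+ (msize p ^ i))); rewrite mevalE.
apply: eq_bigr => m' _; congr (_ * _); rewrite /wt -prodrXr.
by apply: eq_bigr => i _; rewrite mulnC exprM.
Qed.
End Multivariate.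
End Polynomials.

(** * Density of the unitary matrices and invariants of the unitary group *)

Local Open Scope sesquilinear_scope.

Lemma meval_sum (F : numClosedFieldType) n (v : 'I_n -> F) (T : Type) (s : seq T)
    (P : pred T) (h : T -> {mpoly F[n]}) :
  (\sum_(i <- s | P i) h i).@[v] = \sum_(i <- s | P i) (h i).@[v].
Proof. exact: (big_morph (meval v) (mevalD v) (meval0 v)). Qed.

(** The Cayley transform of the natural numbers. *)
Lemma unit_norm_seq (F : numClosedFieldType) :
  exists2 f : nat -> F, injective f & forall k, `|f k| = 1.
Proof.
pose u k : F := 1 + 'i * k%:R.
have ii : 'i * 'i = -1 :> F by rewrite -expr2 sqrCi.
have uC k : (u k)^* = 1 - 'i * k%:R.
  by rewrite /u rmorphD rmorphM rmorph1 rmorph_nat /= conjCi mulNr.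
have nz k : u k != 0.
  have E : u k * (u k)^* = 1 + (k * k)%:R.
    by rewrite uC /u natrM; ring: ii.
  apply/eqP => u0; move: E; rewrite u0 mul0r => /esym/eqP.
  by rewrite -(natrD _ 1) pnatr_eq0.
have nzC k : (u k)^* != 0 by rewrite conjC_eq0.
exists (fun k => u k / (u k)^*) => [k l|k].
  move=> E; have /eqP : u k * (u l)^* = u l * (u k)^*.
    have := congr1 (fun z => z * (u k)^* * (u l)^*) E.
    by rewrite /= divfK // mulrAC divfK.
  rewrite -subr_eq0 !uC /u.
  have -> : (1 + 'i * k%:R) * (1 - 'i * l%:R) - (1 + 'i * l%:R) * (1 - 'i * k%:R)
      = 'i * 2 * (k%:R - l%:R) :> F by ring.
  rewrite !mulf_eq0 (negPf (neq0Ci F)) pnatr_eq0 /= subr_eq0.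
  by rewrite eqr_nat => /eqP.
by rewrite normf_div norm_conjC divff // normr_eq0.
Qed.

Section UnitaryDensity.
Variables (F : numClosedFieldType) (m : nat).

Definition polynomial_on_lines (g : 'M[F]_m -> F) :=
  forall A B, exists q : {poly F}, forall s, q.[s] = g (A + s *: B).

(** Vanishing spreads from the unitary matrices to P^* D P with P unitary and D
    diagonal, one diagonal entry at a time, because the unit circle is infinite;
    by the spectral theorem this covers the Hermitian matrices, and every matrix
    lies on the complex line through two Hermitian ones H1, H2 whose points
    H1 + k H2, with k a natural number, are Hermitian. *)
Lemma unitary_dense g : polynomial_on_lines g ->
  (forall W, W \is unitarymx -> g W = 0) -> forall W, g W = 0.
Proof.
move=> gpol g0; have [f f_inj f1] := unit_norm_seq F.
have diag0 (P : 'M[F]_m) (d : 'rV[F]_m) : P \is unitarymx ->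
    g (P^t* *m diag_mx d *m P) = 0.
  move=> PU; suff H k : forall d : 'rV[F]_m,
      (forall i : 'I_m, (k <= i)%N -> `|d 0 i| = 1) ->
      g (P^t* *m diag_mx d *m P) = 0.
    by apply: (H m) => i; rewrite leqNgt ltn_ord.
  elim: k => {d} [|k IH] d dk.
    apply: g0; rewrite !(mul_unitarymx, trmxC_unitary) //.
    apply/unitarymxP; rewrite tr_diag_mx map_diag_mx mulmx_diag.
    rewrite -diag_const_mx; congr diag_mx; apply/rowP => i; rewrite !mxE.
    by rewrite -normCK dk // expr1n.
  have [km|mk] := ltnP k m; last first.
    by apply: IH => i ki; case/negP: (leq_gtF (leq_trans mk ki)); apply: ltn_ord.
  pose d' : 'rV[F]_m := \row_i (if i == Ordinal km then 0 else d 0 i).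
  pose de : 'rV[F]_m := delta_mx 0 (Ordinal km).
  have line s : P^t* *m diag_mx d' *m P + s *: (P^t* *m diag_mx de *m P)
      = P^t* *m diag_mx (d' + s *: de) *m P.
    by rewrite linearD linearZ /= mulmxDr mulmxDl -scalemxAr -scalemxAl.
  have [q qE] := gpol (P^t* *m diag_mx d' *m P) (P^t* *m diag_mx de *m P).
  have q0 : q = 0.
    apply: (poly_eq0_seq f_inj) => j; rewrite qE line; apply: IH => i ki.
    rewrite !mxE eqxx /=; case: eqP => [_|/eqP ik]; first by rewrite mulr1 add0r.
    rewrite mulr0 addr0; apply: dk; rewrite ltn_neqAle ki andbT.
    by apply: contraNneq ik => ki'; apply/eqP/val_inj.
  have := qE (d 0 (Ordinal km)); rewrite q0 horner0 line => /esym.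
  congr (g (_ *m diag_mx _ *m _) = 0); apply/rowP => i; rewrite !mxE eqxx /=.
  by case: eqP => [->|_]; rewrite ?mulr1 ?add0r // mulr0 addr0.
have herm0 (H : 'M[F]_m) : H^t* = H -> g H = 0.
  move=> HH; have /orthomx_spectralP -> : H \is normalmx by apply/normalmxP; rewrite HH.
  by rewrite invmx_unitary ?spectral_unitarymx // diag0 ?spectral_unitarymx.
move=> W; pose H1 := 2^-1 *: (W + W^t*); pose H2 := (- 'i / 2) *: (W - W^t*).
have ii : 'i * 'i = -1 :> F by rewrite -expr2 sqrCi.
have H1H : H1^t* = H1.
  rewrite /H1 linearZ /= map_mxZ raddfD /= map_mxD trmxCK addrC.
  by rewrite fmorphV rmorph_nat.
have H2H : H2^t* = H2.
  rewrite /H2 linearZ /= map_mxZ raddfB /= map_mxB trmxCK.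
  by rewrite rmorphM rmorphN fmorphV rmorph_nat /= conjCi opprK
    -[W - _]opprB scalerN -scaleNr mulNr opprK.
have [q qE] := gpol H1 H2.
have q0 : q = 0.
  apply: poly_eq0_nat => k; rewrite qE; apply: herm0.
  by rewrite raddfD /= map_mxD H1H linearZ /= map_mxZ H2H rmorph_nat.
have := qE 'i; rewrite q0 horner0 => /esym; congr (g _ = 0).
rewrite /H1 /H2 scalerA mulrA mulrN ii opprK mul1r -scalerDr addrACA subrr addr0.
by rewrite -mulr2n -scaler_nat scalerA mulVf ?pnatr_eq0 // scale1r.
Qed.
End UnitaryDensity.


Local Open Scope sesquilinear_scope.

(** Indices of a basis of p = g / k0: three elements of the upper 2 x 2 block,
    then the upper right and the lower left block. *)
Definition pindex m : finType := ('I_3 + ('I_2 * 'I_m + 'I_m * 'I_2))%type.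

Definition ppoint (S : Type) m (t : 'I_3 -> S) (x : 'M[S]_(2, m))
    (y : 'M[S]_(m, 2)) (a : pindex m) : S :=
  match a with
  | inl j => t j
  | inr (inl (i, k)) => x i k
  | inr (inr (k, j)) => y k j
  end.

Notation pvar m := 'I_#|pindex m|.

Definition peval (S : Type) m t x y (i : pvar m) : S := ppoint t x y (enum_val i).

(* The symbols of D0, ..., D5 and the square operator as functions of the values
   t of a linear form on E11 - E22, E12, E21 and of the matrix Z = x y of its
   values on the quadratic invariants; I stands for the imaginary unit. *)
Section SymbolCoordinates.
Variables (S : comNzRingType) (I : S).

Definition block_of_symbols (v : 'I_7 -> S) (j : 'I_3) : S :=
  nth 0 [:: - (I *+ 2) * v (inord 5);
            - v (inord 0) - I * v (inord 4);
            v (inord 0) - I * v (inord 4)] j.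

Definition quad_of_symbols (v : 'I_7 -> S) : 'M[S]_2 :=
  \matrix_(i, j)
    if i == 0 :> nat then
      if j == 0 :> nat then - v (inord 1) else v (inord 3) + I * v (inord 6)
    else
      if j == 0 :> nat then v (inord 3) - I * v (inord 6) else - v (inord 2).
End SymbolCoordinates.

Section SymbolCoordinatesField.
Variables (F : numFieldType) (I : F).
Hypothesis II : I * I = -1.

Definition symbols (t : 'I_3 -> F) (Z : 'M[F]_2) (j : 'I_7) : F :=
  nth 0 [:: (t (inord 2) - t (inord 1)) / 2;
            - Z (inord 0) (inord 0);
            - Z (inord 1) (inord 1);
            (Z (inord 0) (inord 1) + Z (inord 1) (inord 0)) / 2;
            I / 2 * (t (inord 1) + t (inord 2));
            I / 2 * t (inord 0);
            I / 2 * (Z (inord 1) (inord 0) - Z (inord 0) (inord 1))] j.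

Lemma symbolsK_block t Z : block_of_symbols I (symbols t Z) =1 t.
Proof.
move=> j; rewrite -[j in RHS]inord_val /block_of_symbols /symbols !inordK //=.
by case: j => -[|[|[|//]]] lt /=; field: II.
Qed.

Lemma symbolsK_quad t Z : quad_of_symbols I (symbols t Z) = Z.
Proof.
apply/matrixP => i j; rewrite -[i in RHS]inord_val -[j in RHS]inord_val.
rewrite mxE /symbols !inordK //=.
by case: i j => -[|[|//]] lti [] [|[|//]] ltj /=; rewrite ?opprK //; field: II.
Qed.

Lemma symbols_surj v : symbols (block_of_symbols I v) (quad_of_symbols I v) =1 v.
Proof.
move=> j; rewrite -[j in RHS]inord_val.
rewrite /symbols /block_of_symbols !mxE !inordK //=.
by case: j => -[|[|[|[|[|[|[|//]]]]]]] lt /=; rewrite ?opprK //; field: II.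
Qed.

Lemma symbols_scale (s : F) t Z (j : 'I_7) :
  symbols (fun i => s * t i) ((s ^+ 2) *: Z) j
    = s ^+ (nth 0 [:: 1; 2; 2; 2; 1; 1; 2] j)%N * symbols t Z j.
Proof.
rewrite /symbols !mxE.
by case: j => -[|[|[|[|[|[|[|//]]]]]]] lt /=; ring.
Qed.

Lemma symbols_ext t t' Z : t =1 t' -> symbols t Z =1 symbols t' Z.
Proof. by move=> E j; rewrite /symbols !E. Qed.
End SymbolCoordinatesField.

Section FirstFundamentalTheorem.
Variables (F : numClosedFieldType) (m : nat) (I : F).
Hypothesis II : I * I = -1.

Lemma peval_surj (v : pvar m -> F) : exists t x y, v =1 peval t x y.
Proof.
exists (fun j => v (enum_rank (inl j : pindex m))).
exists (\matrix_(i, k) v (enum_rank (inr (inl (i, k)) : pindex m))).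
exists (\matrix_(k, j) v (enum_rank (inr (inr (k, j)) : pindex m))).
move=> i; rewrite -[i in LHS]enum_valK /peval.
by case: (enum_val i) => [j|[[k j]|[k j]]] //=; rewrite mxE.
Qed.

Definition block_invariant (p : {mpoly F[#|pindex m|]}) :=
  forall t x y W, W \is unitarymx ->
    p.@[peval t (x *m W) y] = p.@[peval t x (W *m y)].

Lemma block_invariant_density p : block_invariant p ->
  forall t x y W, p.@[peval t (x *m W) y] = p.@[peval t x (W *m y)].
Proof.
move=> p_inv t x y W; apply/eqP; rewrite -subr_eq0; apply/eqP.
pose g W := p.@[peval t (x *m W) y] - p.@[peval t x (W *m y)].
apply: (@unitary_dense _ _ g) => {W} [A B|W WU]; last first.
  by rewrite /g p_inv // subrr.
pose line x' y' t1 x1 y1 : {poly F} := mmap (@polyC F) (fun i : pvar m =>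
  (peval t x' y' i)%:P + (peval t1 x1 y1 i)%:P * 'X) p.
have lineE x' y' t1 x1 y1 s :
    (line x' y' t1 x1 y1).[s]
      = p.@[fun i => peval t x' y' i + peval t1 x1 y1 i * s].
  rewrite -[LHS]/(horner_eval s _) /line mmap_meval => [|c]; last exact: hornerC.
  by apply: meval_eq => i; rewrite /= /horner_eval hornerD hornerM !hornerC hornerX.
exists (line (x *m A) y (fun _ => 0) (x *m B) 0
        - line x (A *m y) (fun _ => 0) 0 (B *m y)) => s.
rewrite hornerD hornerN !lineE /g; congr (_ - _); apply: meval_eq => i.
  rewrite /peval; case: (enum_val i) => [j|[[k j]|[k j]]] /=.
  - by rewrite mul0r addr0.
  - by rewrite mulmxDr -scalemxAr !mxE mulrC.
  - by rewrite mxE mul0r addr0.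
rewrite /peval; case: (enum_val i) => [j|[[k j]|[k j]]] /=.
- by rewrite mul0r addr0.
- by rewrite mxE mul0r addr0.
- by rewrite mulmxDl -scalemxAl !mxE mulrC.
Qed.

(** When m >= 2 every x is [1 0] W for a square W, so p(t, x, y) equals
    p(t, [1 0], W y), and W can be taken with W y = (x y) completed by zeros. *)
Lemma fft_large p : (2 <= m)%N -> block_invariant p ->
  exists Q : {mpoly F[7]}, forall t x y,
    p.@[peval t x y] = Q.@[symbols I t (x *m y)].
Proof.
move=> m2 /block_invariant_density p_inv.
pose J (S : nzRingType) : 'M[S]_(2, m) := pid_mx 2.
have JJ : J F *m (J F)^T = 1%:M.
  by rewrite /J tr_pid_mx mul_pid_mx minnn (minn_idPr m2) pid_mx_1.
pose P := {mpoly F[7]}; pose X : 'I_7 -> P := fun j => 'X_j.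
pose h : pvar m -> P := peval (block_of_symbols I%:MP X) (J P)
  ((J P)^T *m quad_of_symbols I%:MP X).
exists (mmap (@mpolyC 7 F) h p) => t x y.
rewrite -[x in LHS]mul1mx -JJ -mulmxA p_inv -mulmxA.
have EJ v i k : (J P i k).@[v] = J F i k.
  by rewrite !mxE; case: andP => _; rewrite ?meval1 ?meval0.
pose v := symbols I t (x *m y).
rewrite -[RHS]/(meval v _) mmap_meval => [|c]; last exact: mevalC.
apply: meval_eq => i; rewrite /= /h /peval; case: (enum_val i) => [j|[[k j]|[k j]]] /=.
- transitivity (block_of_symbols I v j); first by rewrite symbolsK_block.
  case: j => -[|[|[|//]]] lt /=;
  by rewrite ?mevalM ?mevalB ?mevalN ?mevalMn ?mevalM ?mevalC ?mevalXU.
- by rewrite EJ.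
- rewrite !mxE raddf_sum /=; apply: eq_bigr => l _.
  rewrite mevalM; congr (_ * _); first by rewrite [LHS]mxE [in RHS]mxE EJ.
  transitivity (quad_of_symbols I v l j); first by rewrite (symbolsK_quad II).
  rewrite !mxE; by case: ifP => _; case: ifP => _;
    rewrite ?mevalB ?mevalN ?mevalD ?mevalN ?mevalM ?mevalC ?mevalXU.
Qed.

Let xdeg (al : 'X_{1..#|pindex m|}) :=
  (\sum_i (if enum_val i is inr (inl _) then al i else 0))%N.
Let ydeg (al : 'X_{1..#|pindex m|}) :=
  (\sum_i (if enum_val i is inr (inr _) then al i else 0))%N.

(** Scalar matrices W = z already force every monomial of an invariant to have
    the same degree in x and in y. *)
Lemma block_invariant_degree p : block_invariant p ->
  {in msupp p, forall al, xdeg al = ydeg al}.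
Proof.
move=> /block_invariant_density p_inv.
have scale_mon t x y (z : F) (al : 'X_{1..#|pindex m|}) :
    \prod_i peval t (x *m z%:M) y i ^+ al i
      = \prod_i peval t x y i ^+ al i * z ^+ xdeg al
    /\ \prod_i peval t x (z%:M *m y) i ^+ al i
      = \prod_i peval t x y i ^+ al i * z ^+ ydeg al.
  rewrite /xdeg /ydeg -!prodrXr -!big_split /=.
  split; apply: eq_bigr => i _; rewrite /peval;
    case: (enum_val i) => [j|[[k j]|[k j]]] /=; rewrite ?expr0 ?mulr1 //.
    by rewrite mul_mx_scalar mxE mulrC exprMn.
  by rewrite mul_scalar_mx mxE mulrC exprMn.
pose q d v : {poly F} := \sum_(al <- msupp p)
  (p@_al * \prod_i (v i) ^+ al i) *: 'X^(d al).
have q_eq v : q xdeg v = q ydeg v.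
  apply/eqP; rewrite -subr_eq0; apply/eqP/poly_eq0_nat => k.
  apply/eqP; rewrite hornerD hornerN subr_eq0 !horner_sum.
  have [t [x [y Ev]]] := peval_surj v.
  apply/eqP; have := p_inv t x y (k%:R)%:M; rewrite !mevalE.
  congr (_ = _); apply: eq_bigr => al _;
    rewrite hornerZ hornerXn -mulrA; congr (_ * _).
    by rewrite (scale_mon _ _ _ _ _).1; congr (_ * _); apply: eq_bigr => i _; rewrite Ev.
  by rewrite (scale_mon _ _ _ _ _).2; congr (_ * _); apply: eq_bigr => i _; rewrite Ev.
pose part (d : 'X_{1..#|pindex m|} -> nat) (k : nat) : {mpoly F[#|pindex m|]} :=
  \sum_(al <- msupp p | d al == k) p@_al *: 'X_[al].
have partE d v k : (q d v)`_k = (part d k).@[v].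
  rewrite coef_sum raddf_sum /= [RHS]big_mkcond; apply: eq_bigr => al _.
  rewrite coefZ coefXn eq_sym; case: eqP => _; rewrite ?mulr0 // mulr1.
  by rewrite mevalZ mevalX.
have part_coef d k al : al \in msupp p ->
    (part d k)@_al = if d al == k then p@_al else 0.
  move=> alp; rewrite raddf_sum /= big_mkcond (bigD1_seq al) ?msupp_uniq //=.
  rewrite big1 ?addr0 => [|be /negPf ne]; last first.
    by case: ifP => // _; rewrite mcoeffZ mcoeffX ne mulr0.
  by case: ifP => // _; rewrite mcoeffZ mcoeffX eqxx mulr1.
move=> al alp; have /(congr1 (mcoeff al)) : part xdeg (xdeg al) = part ydeg (xdeg al).
  apply/eqP; rewrite -subr_eq0; apply/eqP/meval_eq0 => v.
  by rewrite mevalB -!partE q_eq subrr.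
rewrite !part_coef // eqxx; case: eqP => // _ /eqP; rewrite mcoeff_eq0.
by rewrite alp.
Qed.

(** When m = 1, x and y are vectors of size two, and a monomial with as many
    factors from x as from y is a product of entries of x y. *)
Lemma fft_small p : m = 1%N -> block_invariant p ->
  exists Q : {mpoly F[7]}, forall t x y,
    p.@[peval t x y] = Q.@[symbols I t (x *m y)].
Proof.
move=> m1 /block_invariant_degree p_deg.
have ord_m (a b : 'I_m) : a = b.
  by move: a b; rewrite m1 => a b; rewrite [a]ord1 [b]ord1.
pose X : 'I_7 -> {mpoly F[7]} := fun j => 'X_j.
have evalT v j : (block_of_symbols I%:MP X j).@[v] = block_of_symbols I v j.
  rewrite /block_of_symbols; case: j => -[|[|[|//]]] lt /=;
  by rewrite ?mevalM ?mevalB ?mevalN ?mevalMn ?mevalM ?mevalC ?mevalXU.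
have evalZ v i j : (quad_of_symbols I%:MP X i j).@[v] = quad_of_symbols I v i j.
  rewrite !mxE; by case: ifP => _; case: ifP => _;
    rewrite ?mevalB ?mevalN ?mevalD ?mevalN ?mevalM ?mevalC ?mevalXU.
(* Pair each factor of x with a factor of y. *)
pose isx (i : pvar m) := if enum_val i is inr (inl _) then true else false.
pose isy (i : pvar m) := if enum_val i is inr (inr _) then true else false.
have words (s : seq (pvar m)) : count isx s = count isy s ->
    exists Q : {mpoly F[7]}, forall t x y,
      \prod_(i <- s) peval t x y i = Q.@[symbols I t (x *m y)].
  have [n] := ubnP (size s); elim: n s => // n IH s sn Es.
  have [/hasP[i si ix]|] := boolP (has isx s).
    have /hasP[j sj jy] : has isy s.
      by rewrite has_count -Es -has_count; apply/hasP; exists i.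
    have [nix niy] : isy i = false /\ isx j = false.
      move: ix jy; rewrite /isx /isy.
      by case: (enum_val i) => [|[]]; case: (enum_val j) => [|[]].
    have sj' : j \in rem i s.
      apply: rem_mem sj; apply/eqP => ji; move: niy; by rewrite ji ix.
    have P1 := perm_to_rem si; have P2 := perm_to_rem sj'.
    have [||Q QE] := IH (rem j (rem i s)).
    - have := perm_size P1; rewrite /= (perm_size P2) /= => E.
      by move: sn; rewrite E !ltnS => /ltnW.
    - have := (permP P1 isx); have := (permP P1 isy); rewrite /= !(permP P2) /=.
      rewrite ix jy nix niy Es => -> /eqP; rewrite !add0n eqn_add2l => /eqP //.
    move: ix jy; rewrite /isx /isy.
    case Ei : (enum_val i) => [|[[k k0]|]] // _.
    case Ej : (enum_val j) => [|[|[l0 l]]] // _.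
    exists (quad_of_symbols I%:MP X k l * Q) => t x y.
    rewrite (perm_big _ P1) big_cons (perm_big _ P2) big_cons /= mulrA.
    rewrite mevalM -QE evalZ (symbolsK_quad II); congr (_ * _).
    rewrite /peval Ei Ej /= mxE (bigD1 k0) //= big1 ?addr0 => [|l1].
      by rewrite (ord_m l0 k0).
    by rewrite (ord_m l1 k0) eqxx.
  move=> nx; have ny : ~~ has isy s by rewrite has_count -Es -has_count.
  exists (\prod_(i <- s) if enum_val i is inl j then block_of_symbols I%:MP X j else 1).
  move=> t x y; rewrite rmorph_prod /= !big_seq; apply: eq_bigr => i si.
  move/hasPn: nx => /(_ i si); move/hasPn: ny => /(_ i si).
  rewrite /isx /isy /peval; case: (enum_val i) => [j _ _|[]] //=.
  by rewrite evalT symbolsK_block.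
have mons (al : 'X_{1..#|pindex m|}) : xdeg al = ydeg al ->
    exists Q : {mpoly F[7]}, forall t x y,
      \prod_i peval t x y i ^+ al i = Q.@[symbols I t (x *m y)].
  pose s := flatten [seq nseq (al i) i | i <- index_enum (pvar m)].
  have cs a : count a s = (\sum_i (if a i then al i else 0))%N.
    rewrite count_flatten -map_comp sumnE big_map; apply: eq_bigr => i _ /=.
    by rewrite count_nseq; case: (a i); rewrite ?mul1n.
  move=> Ea; have [|Q QE] := words s.
    rewrite !cs; transitivity (xdeg al); last rewrite Ea; apply: eq_bigr => i _;
      by rewrite /isx /isy; case: (enum_val i) => [|[]].
  exists Q => t x y; rewrite -QE /s big_flatten big_map; apply: eq_bigr => i _.
  by rewrite big_nseq iter_mulr_1.
have /choice[Qf QfE] : forall al, exists Q : {mpoly F[7]},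
    xdeg al = ydeg al -> forall t x y,
      \prod_i peval t x y i ^+ al i = Q.@[symbols I t (x *m y)].
  move=> al.
  have [/mons [Q QE]|] := eqVneq (xdeg al) (ydeg al); first by exists Q.
  by move=> /eqP ne; exists 0.
exists (\sum_(al <- msupp p) p@_al *: Qf al) => t x y.
rewrite mevalE raddf_sum /= !big_seq; apply: eq_bigr => al alp.
by rewrite mevalZ QfE ?p_deg.
Qed.

Lemma first_fundamental_theorem p : (0 < m)%N -> block_invariant p ->
  exists Q : {mpoly F[7]}, forall t x y,
    p.@[peval t x y] = Q.@[symbols I t (x *m y)].
Proof.
case: (ltngtP m 1%N) => [|m2 _|m1 _]; first by [].
  exact: fft_large.
exact: fft_small.
Qed.
End FirstFundamentalTheorem.

(** * The algebra of linear endomorphisms of an algebra *)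

Section LinearEndomorphisms.
Variables (F : comNzRingType) (V : lalgType F).

Record lendo := Lendo {
  lendo_fun :> V -> V;
  lendo_linear : forall a u v, lendo_fun (a *: u + v) = a *: lendo_fun u + lendo_fun v }.

HB.instance Definition _ := gen_eqMixin lendo.
HB.instance Definition _ := gen_choiceMixin lendo.

Lemma lendoP (f g : lendo) : f =1 g -> f = g.
Proof.
case: f g => f fL [g gL] /= /funext E; case: g / E gL => gL.
by congr Lendo; apply: Prop_irrelevance.
Qed.

Fact lendo_zero_subproof (a : F) (u v : V) : 0 = a *: 0 + 0 :> V.
Proof. by rewrite scaler0 addr0. Qed.
Fact lendo_one_subproof (a : F) (u v : V) : a *: u + v = a *: u + v.
Proof. by []. Qed.
Fact lendo_opp_subproof (f : lendo) a u v :
  - f (a *: u + v) = a *: (- f u) + - f v.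
Proof. by rewrite lendo_linear opprD scalerN. Qed.
Fact lendo_add_subproof (f g : lendo) a u v :
  f (a *: u + v) + g (a *: u + v) = a *: (f u + g u) + (f v + g v).
Proof. by rewrite !lendo_linear scalerDr addrACA. Qed.
Fact lendo_mul_subproof (f g : lendo) a u v :
  f (g (a *: u + v)) = a *: f (g u) + f (g v).
Proof. by rewrite !lendo_linear. Qed.
Fact lendo_scale_subproof b (f : lendo) a u v :
  b *: f (a *: u + v) = a *: (b *: f u) + b *: f v.
Proof. by rewrite lendo_linear scalerDr !scalerA mulrC. Qed.

Definition lendo_zero := @Lendo (fun=> 0) lendo_zero_subproof.
Definition lendo_one := @Lendo id lendo_one_subproof.
Definition lendo_opp f := Lendo (lendo_opp_subproof f).
Definition lendo_add f g := Lendo (lendo_add_subproof f g).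
Definition lendo_mul f g := Lendo (lendo_mul_subproof f g).
Definition lendo_scale b f := Lendo (lendo_scale_subproof b f).

Fact lendo_addA : associative lendo_add.
Proof. by move=> f g h; apply: lendoP => x; apply: addrA. Qed.
Fact lendo_addC : commutative lendo_add.
Proof. by move=> f g; apply: lendoP => x; apply: addrC. Qed.
Fact lendo_add0 : left_id lendo_zero lendo_add.
Proof. by move=> f; apply: lendoP => x; apply: add0r. Qed.
Fact lendo_addN : left_inverse lendo_zero lendo_opp lendo_add.
Proof. by move=> f; apply: lendoP => x; apply: addNr. Qed.

HB.instance Definition _ := GRing.isZmodule.Build lendo
  lendo_addA lendo_addC lendo_add0 lendo_addN.

Fact lendo_mulA : associative lendo_mul.
Proof. by move=> f g h; apply: lendoP. Qed.
Fact lendo_mul1 : left_id lendo_one lendo_mul.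
Proof. by move=> f; apply: lendoP. Qed.
Fact lendo_mulr1 : right_id lendo_one lendo_mul.
Proof. by move=> f; apply: lendoP. Qed.
Fact lendo_mulDl : left_distributive lendo_mul +%R.
Proof. by move=> f g h; apply: lendoP. Qed.
Fact lendo_mulDr : right_distributive lendo_mul +%R.
Proof.
move=> f g h; apply: lendoP => x; rewrite -[RHS]/(f (g x) + f (h x)).
by rewrite -[LHS]/(f (g x + h x)) -[g x]scale1r lendo_linear !scale1r.
Qed.
Fact lendo_one_neq0 : lendo_one != 0.
Proof.
by apply/eqP => /(congr1 (fun f : lendo => f 1)) /eqP; rewrite oner_eq0.
Qed.

HB.instance Definition _ := GRing.Zmodule_isNzRing.Build lendo
  lendo_mulA lendo_mul1 lendo_mulr1 lendo_mulDl lendo_mulDr lendo_one_neq0.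

Fact lendo_scaleA a b f : lendo_scale a (lendo_scale b f) = lendo_scale (a * b) f.
Proof. by apply: lendoP => x; apply: scalerA. Qed.
Fact lendo_scale1 : left_id 1 lendo_scale.
Proof. by move=> f; apply: lendoP => x; apply: scale1r. Qed.
Fact lendo_scaleDr : right_distributive lendo_scale +%R.
Proof. by move=> a f g; apply: lendoP => x; apply: scalerDr. Qed.
Fact lendo_scaleDl f : {morph lendo_scale^~ f : a b / a + b}.
Proof. by move=> a b; apply: lendoP => x; apply: scalerDl. Qed.

HB.instance Definition _ := GRing.Zmodule_isLmodule.Build F lendo
  lendo_scaleA lendo_scale1 lendo_scaleDr lendo_scaleDl.

Fact lendo_scaleAl a (f g : lendo) : a *: (f * g) = a *: f * g.
Proof. by apply: lendoP. Qed.
HB.instance Definition _ := GRing.Lmodule_isLalgebra.Build F lendo lendo_scaleAl.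

Fact lendo_scaleAr a (f g : lendo) : a *: (f * g) = f * (a *: g).
Proof.
have f0 : f 0 = 0.
  by have := lendo_linear f (-1) 0 0; rewrite scaler0 addr0 scaleN1r addNr.
apply: lendoP => x; rewrite -[LHS]/(a *: f (g x)) -[RHS]/(f (a *: g x)).
by rewrite -[a *: g x]addr0 lendo_linear f0 addr0.
Qed.
HB.instance Definition _ := GRing.Lalgebra_isAlgebra.Build F lendo lendo_scaleAr.

Lemma lendoD f g u : (f + g : lendo) u = f u + g u. Proof. by []. Qed.
Lemma lendoB f g u : (f - g : lendo) u = f u - g u. Proof. by []. Qed.
Lemma lendoM f g u : (f * g : lendo) u = f (g u). Proof. by []. Qed.
Lemma lendoZ a f u : (a *: f : lendo) u = a *: f u. Proof. by []. Qed.
End LinearEndomorphisms.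

(* Commutators of matrices given as functions of two indices, so that entries in a
   ring of polynomials need no matrix over that ring. *)
Section CommutatorEntries.
Variables (S : comNzRingType) (N : nat).
Implicit Types X A B : 'I_N -> 'I_N -> S.

Definition cbr X A (i j : 'I_N) : S :=
  \sum_k X i k * A k j - \sum_k A i k * X k j.

Lemma cbr_ext X X' A A' i j :
  (forall i j, X i j = X' i j) -> (forall i j, A i j = A' i j) ->
  cbr X A i j = cbr X' A' i j.
Proof.
by move=> EX EA; congr (_ - _); apply: eq_bigr => k _; rewrite EX EA.
Qed.

Lemma cbr_linear X A B c i j :
  cbr X (fun i j => c * A i j + B i j) i j = c * cbr X A i j + cbr X B i j.
Proof.
rewrite /cbr mulrBr !mulr_sumr addrACA -opprD -!big_split /=.
by congr (_ - _); apply: eq_bigr => k _; ring.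
Qed.

Let cbr_mx X A i j : cbr X A i j
  = ((\matrix_(i, j) X i j) *m (\matrix_(i, j) A i j)
     - (\matrix_(i, j) A i j) *m (\matrix_(i, j) X i j)) i j.
Proof.
by rewrite !mxE; congr (_ - _); apply: eq_bigr => k _; rewrite !mxE.
Qed.

Lemma cbr_scalar X c i j : cbr X (fun i j => c *+ (i == j)) i j = 0.
Proof.
rewrite cbr_mx [X in _ *m X - X *m _](_ : _ = c%:M) ?scalar_mxC ?subrr ?mxE //.
by apply/matrixP => k l; rewrite !mxE.
Qed.

Lemma cbr_Jacobi X A B i j :
  cbr X (cbr A B) i j = cbr (cbr X A) B i j - cbr (cbr X B) A i j.
Proof.
rewrite !cbr_mx.
have E Y C : \matrix_(i, j) cbr Y C i j
    = (\matrix_(i, j) Y i j) *m (\matrix_(i, j) C i j)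
      - (\matrix_(i, j) C i j) *m (\matrix_(i, j) Y i j).
  by apply/matrixP => k l; rewrite mxE cbr_mx.
by rewrite !E !mulmxBr !mulmxBl !mulmxA !mxE; ring.
Qed.
End CommutatorEntries.

(** * Derivations of the polynomials in the entries of two generic matrices *)

Section GenericMatrices.
Variables (F : fieldType) (N : nat).

Local Notation I2 := (bool * 'I_N * 'I_N)%type.
Local Notation r := #|{: I2}|.
Local Notation P := {mpoly F[r]}.

(* The entries of the matrices X_b of variables, for b = true and b = false. *)
Definition genmx (b : bool) (i j : 'I_N) : P := 'X_(enum_rank (b, i, j)).

Definition der (p : {mpoly F[r]}) (h : I2 -> P) : P :=
  \sum_a (p^`M(enum_rank a) * h a).

Definition cmx (x : 'M[F]_N) (i j : 'I_N) : P := (x i j)%:MP.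

(* The derivation with X_b |-> [X_b, x]. *)
Definition dbr (x : 'M[F]_N) (b : bool) : 'I_N -> 'I_N -> P := cbr (genmx b) (cmx x).

Definition dfun (x : 'M[F]_N) (p : P) : P :=
  der p (fun a => dbr x a.1.1 a.1.2 a.2).

Lemma dfun_linear x a p q : dfun x (a *: p + q) = a *: dfun x p + dfun x q.
Proof.
rewrite /dfun /der scaler_sumr -big_split; apply: eq_bigr => c _ /=.
by rewrite mderivD mderivZ mulrDl scalerAl.
Qed.

Definition dop (x : 'M[F]_N) : lendo P := Lendo (dfun_linear x).

Lemma dfunD x p q : dfun x (p + q) = dfun x p + dfun x q.
Proof. by rewrite -[p in LHS]scale1r dfun_linear scale1r. Qed.

Lemma dfunB x p q : dfun x (p - q) = dfun x p - dfun x q.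
Proof. by rewrite addrC -scaleN1r dfun_linear scaleN1r addrC. Qed.

Lemma dfunM x p q : dfun x (p * q) = dfun x p * q + p * dfun x q.
Proof.
rewrite /dfun /der mulr_suml mulr_sumr -big_split; apply: eq_bigr => c _ /=.
by rewrite mderivM; ring.
Qed.

Lemma dfunC x c : dfun x c%:MP = 0.
Proof. by rewrite /dfun /der big1 // => a _; rewrite mderivC mul0r. Qed.

Lemma dfunX x b i j : dfun x (genmx b i j) = dbr x b i j.
Proof.
rewrite /dfun /der /genmx (bigD1 (b, i, j)) //= big1 => [|a ne].
  rewrite addr0 mderivX mnm1E eqxx scale1r.
  by rewrite -[X in 'X_[X - _]]add0m addmK mpolyX0 mul1r.
rewrite mderivX mnm1E; case: eqP => [/enum_rank_inj E|_].
  by rewrite E eqxx in ne.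
by rewrite scale0r mul0r.
Qed.

Lemma dfun_sum x (T : Type) (s : seq T) (h : T -> P) :
  dfun x (\sum_(i <- s) h i) = \sum_(i <- s) dfun x (h i).
Proof.
have d0 : dfun x 0 = 0 by rewrite -mpolyC0 dfunC.
elim: s => [|i s IH]; first by rewrite !big_nil.
by rewrite !big_cons dfunD IH.
Qed.

Lemma dfun_dbr x y b i j : dfun x (dbr y b i j) = cbr (dbr x b) (cmx y) i j.
Proof.
rewrite /dbr /cbr dfunB !dfun_sum.
congr (_ - _); apply: eq_bigr => k _; rewrite dfunM dfunX dfunC.
  by rewrite mulr0 addr0.
by rewrite mul0r add0r.
Qed.

Lemma der_eq0 (D : P -> P) :
    (forall a p q, D (a *: p + q) = a *: D p + D q) ->
    (forall p q, D (p * q) = D p * q + p * D q) ->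
    (forall b i j, D (genmx b i j) = 0) ->
  forall p, D p = 0.
Proof.
move=> DL DM DX.
have D0 : D 0 = 0 by have := DL (-1) 0 0; rewrite scaler0 addr0 scaleN1r addNr.
have D1 : D 1 = 0.
  by have := DM 1 1; rewrite !mulr1 mul1r => /eqP; rewrite -subr_eq subrr => /eqP.
have DX' i : D 'X_i = 0.
  by have := DX (enum_val i).1.1 (enum_val i).1.2 (enum_val i).2;
     rewrite /genmx -!surjective_pairing enum_valK.
have DXm m : D 'X_[m] = 0.
  rewrite mpolyXE_id; elim/big_ind: _ => //= [p q Dp Dq|i _].
    by rewrite DM Dp Dq mul0r mulr0 addr0.
  elim: (m i) => [|k IH]; first by rewrite expr0.
  by rewrite exprS DM DX' IH mul0r mulr0 addr0.
move=> p; rewrite (mpolyE p); elim: (msupp p) => [|m s IH].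
  by rewrite big_nil.
by rewrite big_cons DL DXm scaler0 add0r.
Qed.

Lemma dop_linear a x y : dop (a *: x + y) = a *: dop x + dop y.
Proof.
apply: lendoP => p; rewrite lendoD lendoZ /= /dfun /der scaler_sumr -big_split.
apply: eq_bigr => c _ /=; rewrite scalerAr -mulrDr; congr (_ * _).
rewrite -mul_mpolyC -cbr_linear; apply: cbr_ext => // i j.
by rewrite /cmx !mxE mpolyCD mpolyCM.
Qed.

(** Both sides are derivations, and on the variables this is the Jacobi identity. *)
Lemma dop_bracket x y : dop (x *m y - y *m x) = dop x * dop y - dop y * dop x.
Proof.
apply/eqP; rewrite -subr_eq0; apply/eqP/lendoP => p.
rewrite -[RHS]/(0 : P).
apply: (@der_eq0 (dop (x *m y - y *m x) - (dop x * dop y - dop y * dop x) : lendo P)).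
- exact: lendo_linear.
- move=> p1 p2; rewrite !(lendoB, lendoM) /= !dfunM.
  by rewrite !dfunD !dfunM; ring.
move=> b i j; rewrite !(lendoB, lendoM) /= !dfunX !dfun_dbr.
apply/eqP; rewrite subr_eq0 -cbr_Jacobi; apply/eqP/cbr_ext => // k l.
by rewrite /cmx /cbr !mxE mpolyCB !rmorph_sum /=; congr (_ - _);
  apply: eq_bigr => h _; rewrite mpolyCM.
Qed.

Lemma dop_scalar c : dop c%:M = 0.
Proof.
apply: lendoP => p; rewrite /= /dfun /der big1 // => a _.
apply/eqP; rewrite mulf_eq0; apply/orP; right; apply/eqP.
rewrite -[RHS](cbr_scalar (genmx a.1.1) c%:MP a.1.2 a.2); apply: cbr_ext => // i j.
by rewrite /cmx mxE rmorphMn.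
Qed.
End GenericMatrices.

(** * Symbols *)

Lemma ord2_cases (i : 'I_2) : i = 0 \/ i = 1.
Proof. by case: i => -[|[|//]] lt; [left|right]; apply: val_inj. Qed.

Section Positions.
Variable m : nat.

(* The positions 1, 2 and 3, ..., m + 2 of the matrix entries. *)
Definition up (i : 'I_2) : 'I_(2 + m) := lshift m i.
Definition lo (k : 'I_m) : 'I_(2 + m) := rshift 2 k.

Lemma up_inj i j : (up i == up j) = (i == j).
Proof. by rewrite /up (inj_eq (@lshift_inj _ _)). Qed.
Lemma lo_inj i j : (lo i == lo j) = (i == j).
Proof. by rewrite /lo (inj_eq (@rshift_inj _ _)). Qed.
Lemma up_lo i k : (up i == lo k) = false.
Proof. by rewrite /up /lo eq_lrshift. Qed.
Lemma lo_up i k : (lo k == up i) = false.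
Proof. by rewrite /up /lo eq_rlshift. Qed.
End Positions.

Section Symbols.
Variables (F : numFieldType) (m : nat).
Local Notation N := (2 + m)%N.
Local Notation P := {mpoly F[#|{: bool * 'I_N * 'I_N}|]}.

Local Notation up := (up m).

(* The complexification of k0, together with the scalar matrices. *)
Definition stabilizer (x : 'M[F]_N) : Prop :=
  exists a (u : 'M[F]_m), x = block_mx a%:M 0 0 u.

Lemma delta_lo_lo (k l : 'I_m) :
  delta_mx (lo k) (lo l) = block_mx 0 0 0 (delta_mx k l) :> 'M[F]_N.
Proof.
apply/matrixP => i j.
case: (split_ordP i) => {}i ->; case: (split_ordP j) => {}j ->.
- by rewrite block_mxEul -!/(up _) !mxE up_lo.
- by rewrite block_mxEur -!/(up _) !mxE up_lo.
- by rewrite block_mxEdl -!/(up _) !mxE up_lo andbF.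
- by rewrite block_mxEdr -!/(lo _) !mxE !lo_inj.
Qed.

Lemma stabilizer_lo k l : stabilizer (delta_mx (lo k) (lo l)).
Proof. by exists 0, (delta_mx k l); rewrite raddf0 delta_lo_lo. Qed.

Lemma up_block a : a *: (delta_mx (up 0) (up 0) + delta_mx (up 1) (up 1))
  = block_mx a%:M 0 0 0 :> 'M[F]_N.
Proof.
apply/matrixP => i j; rewrite 2!mxE.
case: (split_ordP i) => {}i ->; case: (split_ordP j) => {}j ->.
- rewrite block_mxEul -!/(up _) !mxE !up_inj.
  by case: (ord2_cases i) => ->; case: (ord2_cases j) => -> /=;
    rewrite ?addr0 ?add0r ?mulr1 ?mulr0.
- by rewrite block_mxEur -!/(up _) -!/(lo _) !mxE !lo_up !andbF addr0 mulr0.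
- by rewrite block_mxEdl -!/(up _) -!/(lo _) !mxE !lo_up addr0 mulr0.
- by rewrite block_mxEdr -!/(lo _) !mxE !lo_up addr0 mulr0.
Qed.

Lemma stabilizer_up a :
  stabilizer (a *: (delta_mx (up 0) (up 0) + delta_mx (up 1) (up 1))).
Proof. by exists a, 0; rewrite up_block. Qed.

(* The pairing of the generic matrices with E12 and E21, whose common centralizer
   is the stabilizer. *)
Definition gen0 : P := genmx F true (up 1) (up 0) + genmx F false (up 0) (up 1).

Definition sympoint (q : bool -> 'M[F]_N) (i : 'I_#|{: bool * 'I_N * 'I_N}|) : F :=
  q (enum_val i).1.1 (enum_val i).1.2 (enum_val i).2.

(* The differential of gen0 along the action, at the point q: a linear form on
   g / k0. *)
Definition lam (q : bool -> 'M[F]_N) (x : 'M[F]_N) : F :=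
  (q true *m x - x *m q true) (up 1) (up 0)
  + (q false *m x - x *m q false) (up 0) (up 1).

Lemma sympoint_genmx q b i j : (genmx F b i j).@[sympoint q] = q b i j.
Proof. by rewrite /genmx mevalXU /sympoint enum_rankK. Qed.

Lemma dfun_gen0 q x : (dfun x gen0).@[sympoint q] = lam q x.
Proof.
have E b i j : (dbr x b i j).@[sympoint q] = (q b *m x - x *m q b) i j.
  rewrite /dbr /cbr mevalB !rmorph_sum !mxE /=.
  by congr (_ - _); apply: eq_bigr => k _; rewrite mevalM sympoint_genmx mevalC.
by rewrite dfunD !dfunX mevalD !E.
Qed.

Lemma dfun_gen0_stabilizer x : stabilizer x -> dfun x gen0 = 0.
Proof.
move=> [a [u xE]]; rewrite dfunD !dfunX /dbr.
have xup k j : x k (up j) = a *+ (k == up j).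
  rewrite xE /up; case: (splitP k) => l; [move=> /= kl|move=> /= kl].
    have -> : k = lshift m l by apply: val_inj.
    by rewrite block_mxEul mxE (inj_eq (@lshift_inj _ _)).
  have -> : k = rshift 2 l by apply: val_inj.
  by rewrite block_mxEdl mxE eq_rlshift.
have upx k i : x (up i) k = a *+ (up i == k).
  rewrite xE /up; case: (splitP k) => l; [move=> /= kl|move=> /= kl].
    have -> : k = lshift m l by apply: val_inj.
    by rewrite block_mxEul mxE (inj_eq (@lshift_inj _ _)).
  have -> : k = rshift 2 l by apply: val_inj.
  by rewrite block_mxEur mxE eq_lrshift.
have E (X : 'I_N -> 'I_N -> P) i j : cbr X (cmx x) (up i) (up j) = 0.
  rewrite /cbr (bigD1 (up j)) //= [X in _ - X](bigD1 (up i)) //= /cmx xup upx !eqxx.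
  rewrite !big1 => [|k ne|k ne]; first by rewrite !addr0 mulrC subrr.
    by rewrite upx eq_sym (negPf ne) mpolyC0 mul0r.
  by rewrite xup (negPf ne) mpolyC0 mulr0.
by rewrite !E addr0.
Qed.

(** The polynomial gen0 - gen0(q) vanishes at q, and each derivation lowers the
    order of vanishing of its powers by at most one. *)
Lemma dop_word_power q (s : seq 'M[F]_N) d : (size s <= d)%N ->
  let f : P := gen0 - (gen0.@[sympoint q])%:MP in
  exists h : P, (\prod_(x <- s) dop x : lendo P) (f ^+ d)
    = ((d ^_ size s)%:R * \prod_(x <- s) dfun x gen0) * f ^+ (d - size s)
      + f ^+ (d - size s).+1 * h.
Proof.
move=> + f; have df x : dfun x f = dfun x gen0 by rewrite /f dfunB dfunC subr0.
have dfX x k : dfun x (f ^+ k) = k%:R * f ^+ k.-1 * dfun x gen0.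
  elim: k => [|k IH]; first by rewrite expr0 mulr0n !mul0r -mpolyC1 dfunC.
  rewrite exprS dfunM IH df; case: k {IH} => [|k] /=; last first.
    by rewrite exprS mulrS; ring.
  by rewrite !expr0 !mul1r !mulr1 mul0r !mulr0 addr0.
elim: s => [_|x s IH sd].
  exists 0; rewrite !big_nil mulr0 addr0 ffactn0 !mul1r subn0.
  by rewrite -[LHS]/(f ^+ d).
have [h hE] := IH (ltnW sd).
rewrite !big_cons lendoM hE /=; set k := (d - size s)%N.
have kE : (d - (size s).+1 = k.-1)%N by rewrite subnS.
have k0 : (0 < k)%N by rewrite subn_gt0.
set G := \prod_(y <- s) dfun y gen0; set c := (d ^_ size s)%:R.
exists (c * dfun x G + k.+1%:R * dfun x gen0 * h + f * dfun x h).
rewrite kE prednK // dfunD !dfunM !dfX /= ffactnSr natrM -/c -/k.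
have -> : dfun x c = 0 by rewrite /c -mpolyC_nat dfunC.
by rewrite [f ^+ k.+1]exprS; ring.
Qed.

(* The symbol of degree d of L at the linear form lam q: for an operator of order
   d, the value at q depends only on the products of d first derivatives. *)
Definition chi q d (L : lendo P) : F :=
  (L ((gen0 - (gen0.@[sympoint q])%:MP) ^+ d)).@[sympoint q] / d`!%:R.

Lemma chi_linear q d a L L' : chi q d (a *: L + L') = a * chi q d L + chi q d L'.
Proof. by rewrite /chi lendoD lendoZ mevalD mevalZ mulrDl mulrA. Qed.

Lemma chi_word q d (s : seq 'M[F]_N) : (size s <= d)%N ->
  chi q d (\prod_(x <- s) dop x) = if size s == d then \prod_(x <- s) lam q x else 0.
Proof.
move=> sd; have [h hE] := dop_word_power q sd.
rewrite /chi hE mevalD !mevalM !rmorphXn /= mevalB mevalC subrr.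
rewrite exprS !mul0r addr0 expr0n subn_eq0.
case: (ltngtP (size s) d) sd => // [_ _|-> _]; first by rewrite mulr0 mul0r.
rewrite mulr1 rmorph_nat ffactnn mulrAC divff ?pnatr_eq0 -?lt0n ?fact_gt0 // mul1r.
by rewrite rmorph_prod; apply: eq_bigr => x _; apply: dfun_gen0.
Qed.

Lemma chi_stabilizer q d L x : stabilizer x -> chi q d (L * dop x) = 0.
Proof.
move=> xs; rewrite /chi lendoM.
have L0 u : L (0 *: u) = 0.
  by have := lendo_linear L (-1) 0 0; rewrite scaler0 addr0 !scaleN1r addNr scale0r.
rewrite [dop x _](_ : _ = 0 *: 0) ?L0 ?meval0 ?mul0r //.
rewrite scaler0 /=; elim: d => [|d IH]; first by rewrite expr0 -mpolyC1 dfunC.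
by rewrite exprS dfunM IH dfunB dfunC dfun_gen0_stabilizer // subrr mul0r mulr0 addr0.
Qed.

Lemma lam_delta q a b : lam q (delta_mx a b)
  = (q true (up 1) a *+ (b == up 0) - q true b (up 0) *+ (up 1 == a))
    + (q false (up 0) a *+ (b == up 1) - q false b (up 1) *+ (up 0 == a)).
Proof.
have Er (M : 'M[F]_N) i j : (M *m delta_mx a b) i j = M i a *+ (b == j).
  rewrite mxE (bigD1 a) //= big1 ?addr0 => [|k ka].
    by rewrite mxE eqxx /= (eq_sym j) mulr_natr.
  by rewrite mxE (negPf ka) mulr0.
have El (M : 'M[F]_N) i j : (delta_mx a b *m M) i j = M b j *+ (i == a).
  rewrite mxE (bigD1 b) //= big1 ?addr0 => [|k kb].
    by rewrite mxE eqxx andbT mulr_natl.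
  by rewrite mxE (negPf kb) andbF mul0r.
have mxB (A B : 'M[F]_N) i j : (A - B) i j = A i j - B i j by rewrite !mxE.
by rewrite /lam !mxB !Er !El.
Qed.

Lemma lam_linear q a x y : lam q (a *: x + y) = a * lam q x + lam q y.
Proof.
have E (M : 'M[F]_N) : M *m (a *: x + y) - (a *: x + y) *m M
    = a *: (M *m x - x *m M) + (M *m y - y *m M).
  by rewrite mulmxDr mulmxDl -scalemxAr -scalemxAl scalerBr addrACA opprD.
have mxL (A B : 'M[F]_N) i j : (a *: A + B) i j = a * A i j + B i j by rewrite !mxE.
by rewrite /lam !E !mxL; ring.
Qed.

(* A basis of a complement of the stabilizer. *)
Definition pbasis (a : pindex m) : 'M[F]_N :=
  match a with
  | inl j => nth 0 [:: delta_mx (up 0) (up 0) - delta_mx (up 1) (up 1);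
                       delta_mx (up 0) (up 1); delta_mx (up 1) (up 0)] j
  | inr (inl (i, k)) => delta_mx (up i) (lo k)
  | inr (inr (k, j)) => delta_mx (lo k) (up j)
  end.

(** Every linear form on g / k0 occurs. One generic matrix would not do: a matrix
    belongs to its own centralizer, and the matrices commuting with all diag(a, a, u)
    are the diag(b, b, c, ..., c), which all of gl_2 centralizes. *)
Lemma lam_surj t x y : exists q, forall a, lam q (pbasis a) = ppoint t x y a.
Proof.
pose M0 : 'M[F]_N := block_mx
  (\matrix_(i, j) if i == 1 then if j == 0 then t (inord 0) / 2 else t (inord 2) else 0)
  (\matrix_(i, k) if i == 1 then y k 0 else 0)
  (\matrix_(k, j) if j == 0 then - x 1 k else 0) 0.
pose M1 : 'M[F]_N := block_mx
  (\matrix_(i, j) if (i == 0) && (j == 0) then t (inord 1) else 0)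
  (\matrix_(i, k) if i == 0 then y k 1 else 0)
  (\matrix_(k, j) if j == 1 then - x 0 k else 0) 0.
pose q (b : bool) := if b then M0 else M1.
have lamB a b c d : lam q (delta_mx a b - delta_mx c d)
    = lam q (delta_mx a b) - lam q (delta_mx c d).
  by rewrite addrC -scaleN1r lam_linear mulN1r addrC.
exists q => -[j|[[i k]|[k i]]] /=.
- rewrite -[j in t j]inord_val; case: j => -[|[|[|//]]] lt /=.
  + rewrite lamB !lam_delta !up_inj /= !mulr0n !mulr1n ?addr0 ?subr0 ?sub0r ?add0r.
    by rewrite /M0 /M1 !block_mxEul !mxE /= oppr0 !addr0; field.
  + rewrite !lam_delta !up_inj /= !mulr0n !mulr1n ?addr0 ?subr0 ?sub0r ?add0r.
    by rewrite /M0 /M1 !block_mxEul !mxE /= ?oppr0 ?subr0 ?addr0 ?add0r.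
  + rewrite !lam_delta !up_inj /= !mulr0n !mulr1n ?addr0 ?subr0 ?sub0r ?add0r.
    by rewrite /M0 /M1 !block_mxEul !mxE /= ?oppr0 ?subr0 ?addr0 ?add0r.
- rewrite !lam_delta !lo_up !up_inj /= !mulr0n ?addr0 ?subr0 ?sub0r ?add0r.
  rewrite /M0 /M1 !block_mxEdl !mxE /=.
  by case: (ord2_cases i) => -> /=; rewrite !mulr0n !mulr1n ?oppr0 ?addr0 ?add0r opprK.
- rewrite !lam_delta !up_lo !up_inj /= !mulr0n ?addr0 ?subr0 ?sub0r ?add0r.
  rewrite /M0 /M1 !block_mxEur !mxE /=.
  by case: (ord2_cases i) => -> /=; rewrite !mulr0n !mulr1n ?oppr0 ?addr0 ?add0r.
Qed.
End Symbols.

(** * Filtrations and symbols in an enveloping algebra *)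

Section MonomialWords.
Variable n : nat.

Definition mword (al : 'X_{1..n}) : seq 'I_n :=
  flatten [seq nseq (al i) i | i <- enum 'I_n].

Definition word_mnm (s : seq 'I_n) : 'X_{1..n} := [multinom count_mem i s | i < n].

Lemma count_mword (a : pred 'I_n) al :
  count a (mword al) = (\sum_i (if a i then al i else 0))%N.
Proof.
rewrite count_flatten -map_comp sumnE big_map big_enum; apply: eq_bigr => i _ /=.
by rewrite count_nseq; case: (a i); rewrite ?mul1n.
Qed.

Lemma perm_mword s : perm_eq s (mword (word_mnm s)).
Proof.
apply/permP => a; rewrite count_mword -sum1_count.
rewrite (partition_big id xpredT) //= big_mkcond /=; apply: eq_bigr => i _.
case: ifP => ai; last first.
  by rewrite big_pred0 // => j; apply/andP => -[aj /eqP ji]; rewrite -ji aj in ai.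
rewrite mnmE -sum1_count; apply: eq_bigl => j.
by rewrite /= andbC; case: (eqVneq j i) => [->|].
Qed.

Lemma prod_mword (S : comNzRingType) (h : 'I_n -> S) al :
  \prod_(i <- mword al) h i = \prod_i h i ^+ al i.
Proof.
rewrite /mword big_flatten big_map big_enum; apply: eq_bigr => i _.
by rewrite big_nseq iter_mulr_1.
Qed.

Lemma sum_mword (h : 'I_n -> nat) al :
  (\sum_(i <- mword al) h i = \sum_i h i * al i)%N.
Proof.
rewrite /mword big_flatten big_map big_enum; apply: eq_bigr => i _.
by rewrite big_nseq iter_addn_0.
Qed.
End MonomialWords.

(** Sorting the factors of a product, when commutators of factors are of lower
    order: Phi d is to be read as the set of elements of weight less than d. *)
Section SortingFactors.
Variables (A : nzRingType) (T : eqType) (h : T -> A) (w : T -> nat).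
Variable Phi : nat -> A -> Prop.
Hypothesis Phi0 : forall d, Phi d 0.
Hypothesis PhiD : forall d u v, Phi d u -> Phi d v -> Phi d (u + v).
Hypothesis Phi_mul : forall d x u, Phi d u -> Phi (w x + d) (h x * u).
Hypothesis Phi_comm : forall x y s,
  Phi (w x + (w y + \sum_(z <- s) w z))
    ((h x * h y - h y * h x) * \prod_(z <- s) h z).

Lemma Phi_perm s t : perm_eq s t ->
  Phi (\sum_(z <- s) w z) (\prod_(z <- s) h z - \prod_(z <- t) h z).
Proof.
have move1 x s1 s2 : Phi (\sum_(z <- x :: s1 ++ s2) w z)
    (\prod_(z <- x :: s1 ++ s2) h z - \prod_(z <- s1 ++ x :: s2) h z).
  elim: s1 => [|y s1 IH] /=; first by rewrite subrr.
  have -> : \prod_(z <- [:: x, y & s1 ++ s2]) h z - \prod_(z <- y :: s1 ++ x :: s2) h z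
      = (h x * h y - h y * h x) * \prod_(z <- s1 ++ s2) h z
        + h y * (\prod_(z <- x :: s1 ++ s2) h z - \prod_(z <- s1 ++ x :: s2) h z).
    by rewrite !big_cons mulrBr mulrBl !mulrA addrA subrK.
  apply: PhiD; first by rewrite !big_cons; apply: Phi_comm.
  by move: IH => /(Phi_mul y); rewrite !big_cons addnCA.
elim: s t => [|x s IH] t st.
  by rewrite (size0nil (esym (perm_size st))) subrr.
have xt : x \in t by rewrite -(perm_mem st) mem_head.
case/splitPr: xt st => t1 t2; rewrite perm_sym -cat1s perm_catCA perm_cons perm_sym => st.
have -> : \prod_(z <- x :: s) h z - \prod_(z <- t1 ++ x :: t2) h z
    = h x * (\prod_(z <- s) h z - \prod_(z <- t1 ++ t2) h z)
      + (\prod_(z <- x :: t1 ++ t2) h z - \prod_(z <- t1 ++ x :: t2) h z).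
  by rewrite mulrBr !big_cons addrA subrK.
apply: PhiD; first by rewrite big_cons; apply/Phi_mul/IH.
have -> : \sum_(z <- x :: s) w z = \sum_(z <- x :: t1 ++ t2) w z.
  by apply: perm_big; rewrite perm_cons.
exact: move1.
Qed.
End SortingFactors.

(* An algebra generated by an image of gl_(m+2), mapping to the algebra of linear
   operators by the derivations of the polynomials in two generic matrices. *)
Record enveloping (F : numClosedFieldType) (m : nat) := Enveloping {
  ualg : algType F;
  uin : 'M[F]_(2 + m) -> ualg;
  uin_linear : forall a x y, uin (a *: x + y) = a *: uin x + uin y;
  uin_bracket : forall x y, uin (x *m y - y *m x) = uin x * uin y - uin y * uin x;
  uact : ualg -> lendo {mpoly F[#|{: bool * 'I_(2 + m) * 'I_(2 + m)}|]};
  uact_linear : forall a u v, uact (a *: u + v) = a *: uact u + uact v;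
  uactM : forall u v, uact (u * v) = uact u * uact v;
  uact1 : uact 1 = 1;
  uact_in : forall x, uact (uin x) = dop x
}.

Section Filtration.
Variables (F : numClosedFieldType) (m : nat).
Local Notation N := (2 + m)%N.
Local Notation M := 'M[F]_N.
Local Notation P := {mpoly F[#|{: bool * 'I_N * 'I_N}|]}.
Local Notation r := #|pindex m|.
Variable V : enveloping F m.
Local Notation U := (ualg V).
Local Notation e := (@uin F m V).
Let e_linear := @uin_linear F m V.
Let e_bracket := @uin_bracket F m V.
Local Notation Theta := (@uact F m V).
Let Theta_linear := @uact_linear F m V.
Let ThetaM := @uactM F m V.
Let Theta_e := @uact_in F m V.

Definition word (s : seq M) : U := \prod_(x <- s) e x.

(* The span of the products of fewer than d elements of the Lie algebra. *)
Inductive Fil (d : nat) : U -> Prop :=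
| Fil0 : Fil d 0
| FilW s : (size s < d)%N -> Fil d (word s)
| FilL a u v : Fil d u -> Fil d v -> Fil d (a *: u + v).

Definition Jk (u : U) : Prop := exists s : seq (U * M),
  (forall p, p \in s -> stabilizer p.2) /\ u = \sum_(p <- s) p.1 * e p.2.

(* The same filtration modulo the left ideal generated by k0. *)
Definition FilJ d u := exists2 v, Fil d v & Jk (u - v).

Let e0 : e 0 = 0.
Proof. by have := e_linear (-1) 0 0; rewrite scaler0 addr0 scaleN1r addNr. Qed.

Lemma Jk0 : Jk 0.
Proof. by exists [::]; rewrite big_nil. Qed.

Lemma JkL a u v : Jk u -> Jk v -> Jk (a *: u + v).
Proof.
move=> [s [sP ->]] [t [tP ->]].
exists ([seq (a *: p.1, p.2) | p <- s] ++ t); split=> [p|].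
  by rewrite mem_cat => /orP[/mapP[p' /sP ? ->]|/tP].
rewrite big_cat big_map scaler_sumr; congr (_ + _).
by apply: eq_bigr => p _; rewrite scalerAl.
Qed.

Lemma JkM w u : Jk u -> Jk (w * u).
Proof.
move=> [s [sP ->]]; exists [seq (w * p.1, p.2) | p <- s]; split=> [p|].
  by move=> /mapP[p' /sP ? ->].
by rewrite big_map mulr_sumr; apply: eq_bigr => p _; rewrite mulrA.
Qed.

Lemma Jk_e u x : stabilizer x -> Jk (u * e x).
Proof.
by move=> xs; exists [:: (u, x)]; rewrite big_seq1; split=> // p; rewrite inE => /eqP->.
Qed.

Lemma FilJ_of d u : Fil d u -> FilJ d u.
Proof. by move=> Fu; exists u => //; rewrite subrr; exact: Jk0. Qed.

Lemma FilJ_Jk d u : Jk u -> FilJ d u.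
Proof. by move=> Ju; exists 0; [exact: Fil0 | rewrite subr0]. Qed.

Lemma FilJL d a u v : FilJ d u -> FilJ d v -> FilJ d (a *: u + v).
Proof.
move=> [u' Fu Ju] [v' Fv Jv]; exists (a *: u' + v'); first exact: FilL.
by rewrite opprD addrACA -scalerBr; apply: JkL.
Qed.

Lemma FilJ0 d : FilJ d 0. Proof. exact/FilJ_of/Fil0. Qed.

Lemma FilJD d u v : FilJ d u -> FilJ d v -> FilJ d (u + v).
Proof. by rewrite -[u in u + v]scale1r; apply: FilJL. Qed.

Lemma FilJB d u v : FilJ d u -> FilJ d v -> FilJ d (u - v).
Proof. by move=> Fu Fv; rewrite -scaleN1r addrC; apply: FilJL. Qed.

Lemma Fil_le d d' u : (d <= d')%N -> Fil d u -> Fil d' u.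
Proof.
move=> dd'; elim=> [|s sd|a x y _ IHx _ IHy]; first exact: Fil0.
  by apply: FilW; apply: leq_trans sd dd'.
exact: FilL.
Qed.

Lemma Fil_zero u : Fil 0 u -> u = 0.
Proof. by elim=> // a x y _ -> _ ->; rewrite scaler0 addr0. Qed.

Lemma FilD d u v : Fil d u -> Fil d v -> Fil d (u + v).
Proof. by rewrite -[u in u + v]scale1r; apply: FilL. Qed.

Lemma FilZ d a u : Fil d u -> Fil d (a *: u).
Proof. by rewrite -[a *: u]addr0 => Fu; apply: FilL => //; apply: Fil0. Qed.

Lemma FilB d u v : Fil d u -> Fil d v -> Fil d (u - v).
Proof. by move=> Fu Fv; rewrite -scaleN1r addrC; apply: FilL. Qed.

Lemma Fil_sum d (T : eqType) (s : seq T) (h : T -> U) :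
  (forall t, t \in s -> Fil d (h t)) -> Fil d (\sum_(t <- s) h t).
Proof.
move=> H; rewrite big_seq; elim/big_ind: _ => //; [exact: Fil0 | exact: FilD].
Qed.

Lemma word_nil : word [::] = 1.
Proof. by rewrite /word big_nil. Qed.

Lemma word_cat s t : word (s ++ t) = word s * word t.
Proof. by rewrite /word big_cat. Qed.

Lemma FilM d d' u v : Fil d.+1 u -> Fil d'.+1 v -> Fil (d + d').+1 (u * v).
Proof.
move=> Fu Fv; elim: Fu => [|s sd|a x y _ IHx _ IHy]; first by rewrite mul0r; exact: Fil0.
  elim: Fv => [|t td|a x y _ IHx _ IHy]; first by rewrite mulr0; exact: Fil0.
    rewrite -word_cat; apply: FilW; rewrite size_cat ltnS.
    by rewrite leq_add // -ltnS.
  by rewrite mulrDr -scalerAr; apply: FilL.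
by rewrite mulrDl -scalerAl; apply: FilL.
Qed.

Lemma Fil_e x : Fil 2 (e x).
Proof. by rewrite -[e x](big_seq1 *%R x e); apply: (@FilW 2 [:: x]). Qed.

Lemma word_perm s t : perm_eq s t -> Fil (size s) (word s - word t).
Proof.
move=> st; rewrite -sum1_size.
apply: (@Phi_perm _ _ e (fun=> 1%N) Fil) st => [d|d u v|[|d] x u|x y {}s].
- exact: Fil0.
- exact: FilD.
- by move=> /Fil_zero ->; rewrite mulr0; exact: Fil0.
- exact: (FilM (Fil_e x)).
rewrite sum1_size -e_bracket.
have -> : e (x *m y - y *m x) * \prod_(z <- s) e z = word ((x *m y - y *m x) :: s).
  by rewrite /word big_cons.
exact: FilW.
Qed.

Lemma word_stabilizer s x : x \in s -> stabilizer x -> FilJ (size s) (word s).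
Proof.
move=> xs xst; have st : perm_eq s (rcons (rem x s) x).
  by rewrite perm_sym perm_rcons perm_sym perm_to_rem.
rewrite -[word s](subrK (word (rcons (rem x s) x))); apply: FilJD.
  exact/FilJ_of/word_perm.
apply: FilJ_Jk; rewrite -cats1 word_cat [word [:: x]]big_seq1; exact: Jk_e.
Qed.

Definition pbas (i : 'I_r) : M := pbasis F (enum_val i).

Lemma pbas_ind (Q : M -> Prop) :
  (forall a x y, Q x -> Q y -> Q (a *: x + y)) ->
  (forall i, Q (pbas i)) -> (forall x, stabilizer x -> Q x) -> forall x, Q x.
Proof.
move=> QL Qb Qs.
have Q0 : Q 0 by apply: Qs; exists 0, 0; rewrite raddf0 block_mx0.
have Qb' a : Q (pbasis F a) by have := Qb (enum_rank a); rewrite /pbas enum_rankK.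
have QS (c : F) : Q (c *: (delta_mx (up m 0) (up m 0) + delta_mx (up m 1) (up m 1))).
  by apply: Qs; apply: stabilizer_up.
have Qd i j : Q (delta_mx i j).
  case: (split_ordP i) => {}i ->; case: (split_ordP j) => {}j ->.
  - rewrite -!/(up m _); case: (ord2_cases i) => ->; case: (ord2_cases j) => ->.
    + have -> : delta_mx (up m 0) (up m 0) = 2^-1 *: pbasis F (inl ord0)
          + 2^-1 *: (delta_mx (up m 0) (up m 0) + delta_mx (up m 1) (up m 1)) :> M.
        rewrite /= -scalerDr addrACA addNr addr0 -mulr2n -scaler_nat scalerA.
        by rewrite mulVf ?pnatr_eq0 // scale1r.
      exact: QL.
    + exact: (Qb' (inl (Ordinal (isT : (1 < 3)%N)))).
    + exact: (Qb' (inl (Ordinal (isT : (2 < 3)%N)))).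
    + have -> : delta_mx (up m 1) (up m 1) = (- 2^-1) *: pbasis F (inl ord0)
          + 2^-1 *: (delta_mx (up m 0) (up m 0) + delta_mx (up m 1) (up m 1)) :> M.
        rewrite /= scaleNr -scalerN opprB -scalerDr addrA subrK -mulr2n.
        by rewrite -scaler_nat scalerA mulVf ?pnatr_eq0 // scale1r.
      exact: QL.
  - exact: (Qb' (inr (inl (i, j)))).
  - exact: (Qb' (inr (inr (i, j)))).
  - by apply: Qs; apply: stabilizer_lo.
move=> x; rewrite (matrix_sum_delta x).
have QD u v : Q u -> Q v -> Q (u + v) by rewrite -[u in u + v]scale1r; apply: QL.
elim/big_ind: _ => // i _; elim/big_ind: _ => // j _.
by rewrite -[_ *: _]addr0; apply: QL.
Qed.

Definition ordered (p : {mpoly F[r]}) : U :=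
  \sum_(al <- msupp p) p@_al *: word [seq pbas i | i <- mword al].

Lemma ordered_wide (p : {mpoly F[r]}) (s : seq 'X_{1..r}) : uniq s ->
  {subset msupp p <= s} ->
  ordered p = \sum_(al <- s) p@_al *: word [seq pbas i | i <- mword al].
Proof.
move=> us ps; rewrite /ordered [RHS](bigID (mem (msupp p))) /=.
rewrite [X in _ + X]big1 ?addr0 => [|al /memN_msupp_eq0 ->]; last by rewrite scale0r.
rewrite -[RHS]big_filter; apply: perm_big; apply: uniq_perm.
- exact: msupp_uniq.
- exact: filter_uniq.
by move=> al; rewrite mem_filter andb_idr //; apply: ps.
Qed.

Lemma orderedL a p q : ordered (a *: p + q) = a *: ordered p + ordered q.
Proof.
pose s := undup (msupp p ++ msupp q ++ msupp (a *: p + q)).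
rewrite !(@ordered_wide _ s) ?undup_uniq //.
- rewrite scaler_sumr -big_split; apply: eq_bigr => al _ /=.
  by rewrite mcoeffD mcoeffZ scalerDl scalerA.
- by move=> al H; rewrite mem_undup !mem_cat H !orbT.
- by move=> al H; rewrite mem_undup !mem_cat H.
- by move=> al H; rewrite mem_undup !mem_cat H !orbT.
Qed.

Lemma orderedX al : ordered 'X_[al] = word [seq pbas i | i <- mword al].
Proof. by rewrite /ordered msuppX big_seq1 mcoeffX eqxx scale1r. Qed.

Definition of_degree (d : nat) (p : {mpoly F[r]}) := {in msupp p, forall al, mdeg al = d}.

Lemma homogL d a p q : of_degree d p -> of_degree d q -> of_degree d (a *: p + q).
Proof.
move=> hp hq al /msuppD_le; rewrite mem_cat => /orP[/msuppZ_le|]; first exact: hp.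
exact: hq.
Qed.

(** Modulo U k0 and shorter products, the commutative polynomials of degree d in
    the basis of p exhaust the products of d elements. *)
Lemma word_ordered s : exists2 p, of_degree (size s) p &
  FilJ (size s) (word s - ordered p).
Proof.
suff H (t : seq 'I_r) : exists2 p, of_degree (size t + size s) p &
    FilJ (size t + size s) (word ([seq pbas i | i <- t] ++ s) - ordered p).
  exact: (H [::]).
elim: s t => [|x s IH] t.
  exists 'X_[word_mnm t].
    move=> al; rewrite msuppX inE => /eqP->; rewrite addn0 mdegE.
    under eq_bigr do rewrite mnmE.
    rewrite -[RHS](count_predT t) (permP (perm_mword t)) count_mword /=.
    by apply: eq_bigr => i _; rewrite mnmE.
  rewrite addn0 cats0 orderedX -(size_map pbas); apply/FilJ_of/word_perm.
  exact/perm_map/perm_mword.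
elim/pbas_ind: x => [a x y|i|x xs] /=.
- move=> [p hp Ep] [q hq Eq]; exists (a *: p + q); first exact: homogL.
  have -> : word ([seq pbas i | i <- t] ++ (a *: x + y) :: s)
      = a *: word ([seq pbas i | i <- t] ++ x :: s)
        + word ([seq pbas i | i <- t] ++ y :: s).
    rewrite !word_cat /word !big_cons e_linear mulrDl mulrDr.
    by rewrite -scalerAl -scalerAr.
  by rewrite orderedL opprD addrACA -scalerBr; apply: FilJL.
- have [p hp Ep] := IH (rcons t i).
  by exists p; move: hp Ep; rewrite size_rcons addSnnS // map_rcons cat_rcons.
exists 0; first by move=> al; rewrite msupp0.
have -> : ordered 0 = 0 by rewrite /ordered msupp0 big_nil.
rewrite subr0 addnS -addSn.
have -> : ((size t).+1 + size s = size ([seq pbas i | i <- t] ++ x :: s))%N.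
  by rewrite size_cat size_map /= addSnnS.
by apply: (@word_stabilizer _ x) => //; rewrite mem_cat mem_head orbT.
Qed.

Lemma Fil_ordered d u : Fil d.+1 u ->
  exists2 p, of_degree d p & FilJ d (u - ordered p).
Proof.
have o0 : ordered 0 = 0 by rewrite /ordered msupp0 big_nil.
have h0 : of_degree d 0 by move=> al; rewrite msupp0.
elim=> [|s|a x y _ [p hp Ep] _ [q hq Eq]].
- by exists 0 => //; rewrite o0 subrr; apply: FilJ0.
- rewrite ltnS leq_eqVlt => /orP[/eqP <-|sd]; first exact: word_ordered.
  by exists 0 => //; rewrite o0 subr0; apply/FilJ_of/FilW.
- exists (a *: p + q); first exact: homogL.
  by rewrite orderedL opprD addrACA -scalerBr; apply: FilJL.
Qed.

Lemma FilJ_ordered d u : FilJ d.+1 u ->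
  exists2 p, of_degree d p & FilJ d (u - ordered p).
Proof.
move=> [v /Fil_ordered[p hp Ep] Jv]; exists p => //.
by rewrite -[u](subrK v) -addrA; apply: FilJD => //; apply: FilJ_Jk.
Qed.

Definition symb q d (u : U) : F := chi q d (Theta u).

Lemma symbL q d a u v : symb q d (a *: u + v) = a * symb q d u + symb q d v.
Proof. by rewrite /symb Theta_linear chi_linear. Qed.

Lemma symb0 q d : symb q d 0 = 0.
Proof. by have := symbL q d (-1) 0 0; rewrite scaler0 addr0 mulN1r addNr. Qed.

Lemma symbD q d u v : symb q d (u + v) = symb q d u + symb q d v.
Proof. by rewrite -[u in LHS]scale1r symbL mul1r. Qed.

Lemma symbZ q d a u : symb q d (a *: u) = a * symb q d u.
Proof. by rewrite -[a *: u]addr0 symbL symb0 addr0. Qed.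

Lemma symbB q d u v : symb q d (u - v) = symb q d u - symb q d v.
Proof. by rewrite addrC -scaleN1r symbL mulN1r addrC. Qed.

Lemma symb_sum q d (T : Type) (s : seq T) (h : T -> U) :
  symb q d (\sum_(t <- s) h t) = \sum_(t <- s) symb q d (h t).
Proof. by elim: s => [|t s IH]; rewrite ?big_nil ?symb0 // !big_cons symbD IH. Qed.

Lemma symb_word q d s : (size s <= d)%N ->
  symb q d (word s) = if size s == d then \prod_(x <- s) lam q x else 0.
Proof.
move=> sd; rewrite -chi_word // /symb; congr chi; rewrite /word.
by elim: s {sd} => [|x s IH]; rewrite ?big_nil ?uact1 // !big_cons ThetaM Theta_e IH.
Qed.

Lemma symb_Jk q d u : Jk u -> symb q d u = 0.
Proof.
move=> [s [sP ->]]; rewrite symb_sum big_seq big1 // => p /sP ps.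
by rewrite /symb ThetaM Theta_e chi_stabilizer.
Qed.

Lemma symb_Fil q d u : Fil d u -> symb q d u = 0.
Proof.
elim=> [|s sd|a x y _ IHx _ IHy]; first exact: symb0.
  by rewrite symb_word ?(ltnW sd) // ltn_eqF.
by rewrite symbL IHx IHy mulr0 addr0.
Qed.

Lemma symb_FilJ q d u : FilJ d u -> symb q d u = 0.
Proof.
by move=> [v Fv Jv]; rewrite -[u](subrK v) symbD symb_Jk // symb_Fil // addr0.
Qed.

Lemma symbM q d d' u v : Fil d.+1 u -> Fil d'.+1 v ->
  symb q (d + d') (u * v) = symb q d u * symb q d' v.
Proof.
move=> Fu Fv; elim: Fu => [|s|a x y _ IHx _ IHy].
- by rewrite mul0r !symb0 mul0r.
- rewrite ltnS => sd; elim: Fv => [|t|a x y _ IHx _ IHy].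
  + by rewrite mulr0 !symb0 mulr0.
  + rewrite ltnS => td; rewrite -word_cat !symb_word ?size_cat ?leq_add //.
    case: (ltngtP (size s) d) sd => // [sd _|-> _].
      by rewrite mul0r ltn_eqF // -addSn leq_add.
    rewrite eqn_add2l; case: eqP => _; last by rewrite mulr0.
    by rewrite big_cat.
  + by rewrite mulrDr -scalerAr !symbL IHx IHy; ring.
by rewrite mulrDl -scalerAl !symbL IHx IHy; ring.
Qed.

Lemma symb_ordered q d p : of_degree d p ->
  symb q d (ordered p) = p.@[fun i => lam q (pbas i)].
Proof.
move=> hp; rewrite symb_sum mevalE !big_seq; apply: eq_bigr => al alp.
rewrite symbZ symb_word ?size_map; last by rewrite -count_predT count_mword -mdegE hp.
rewrite -count_predT count_mword -mdegE hp // eqxx big_map; congr (_ * _).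
exact: (prod_mword (fun i => lam q (pbas i))).
Qed.

(** This replaces the Poincare-Birkhoff-Witt theorem for U(g) / U(g) k0: the symbol
    is that of the operator by which u acts on polynomials, and the linear forms
    lam q exhaust the dual of g / k0. *)
Lemma FilJ_symb_eq0 d u : FilJ d.+1 u -> (forall q, symb q d u = 0) -> FilJ d u.
Proof.
move=> /FilJ_ordered[p hp Ep] u0.
suff p0 : p = 0 by move: Ep; rewrite p0 /ordered msupp0 big_nil subr0.
apply: meval_eq0 => v; have [t [x [y Ev]]] := peval_surj v.
have [q qE] := lam_surj t x y.
rewrite (@meval_eq _ _ v (fun i => lam q (pbas i))) => [|i]; last by rewrite Ev qE.
rewrite -(symb_ordered q hp) -(u0 q) -[u](subrK (ordered p)) symbD.
by rewrite (symb_FilJ _ Ep) add0r.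
Qed.

Lemma FilJ_symb_poly d u : FilJ d.+1 u -> exists2 p, of_degree d p &
  forall q, symb q d u = p.@[fun i => lam q (pbas i)].
Proof.
move=> /FilJ_ordered[p hp Ep]; exists p => // q.
by rewrite -(symb_ordered q hp) -[u in LHS](subrK (ordered p)) symbD (symb_FilJ _ Ep) add0r.
Qed.
End Filtration.

(** * Words in free algebras and in enveloping algebras *)

(* The module confines the notations of the monoid algebras. *)
Module FreeAlgebraWords.
From mathcomp Require Import finmap monalg.
Section FreeAlgebraWords.
Variables (F : comNzRingType) (X : choiceType).

Lemma freealg_ind (Q : freealg F X -> Prop) : Q 0 ->
  (forall a f g, Q f -> Q g -> Q (a *: f + g)) ->
  (forall s : seq X, Q (\prod_(x <- s) fvar F x)) -> forall f, Q f.
Proof.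
move=> Q0 QL Qw [g].
have wordE (s : seq X) : FreeAlg (mkmalgU (FMonom s) 1)
    = \prod_(x <- s) fvar F x :> freealg F X.
  elim: s => [|x s IH].
    rewrite big_nil; apply: val_inj => /=; rewrite -[RHS]/(1 : malg (fmonom X) F).
    by rewrite -fmoneE.
  rewrite big_cons -IH fvarE; apply: val_inj => /=.
  rewrite malg_of_freealgM /= malgM_def fgmulUU mul1r; congr mkmalgU.
  by rewrite -[RHS]/(fmmul (fmu x) (FMonom s)) fmuE fmmulE.
rewrite (monalgE g); elim/big_rec: _ => [//|k g' _ Qg'].
have -> : FreeAlg (mkmalgU k (mcoeff k g) + g')
    = mcoeff k g *: FreeAlg (mkmalgU k 1) + FreeAlg g'.
  apply: val_inj; rewrite /= malg_of_freealgD malg_of_freealgZ /=; congr (_ + _).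
  apply/malgP => k'.
  by rewrite mcoeffZ !mcoeffU mulrnAr mulr1.
by apply: QL => //; rewrite -(fmK k) wordE.
Qed.
End FreeAlgebraWords.
End FreeAlgebraWords.
Export FreeAlgebraWords.

Section EnvelopingWords.
Variables (R : nzRingType) (C : comNzRingType) (phi : {rmorphism R -> C}).
Variables (L : lmodType R) (br : L -> L -> L).
Local Notation U := (uea phi br).

Lemma uea_pi0 : uea_pi phi br 0 = 0.
Proof. by rewrite -[0 in LHS](subrr 0) uea_piB subrr. Qed.

Lemma uea_words_ind (Q : U -> Prop) : Q 0 ->
  (forall a u v, Q u -> Q v -> Q (a *: u + v)) ->
  (forall s : seq L, Q (\prod_(x <- s) uea_in phi br x)) -> forall u, Q u.
Proof.
move=> Q0 QL Qw; apply: uea_ind; apply: freealg_ind => [|a f g Qf Qg|s].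
- by rewrite uea_pi0.
- by rewrite uea_piD uea_piZ; apply: QL.
suff -> : uea_pi phi br (\prod_(x <- s) fvar C x) = \prod_(x <- s) uea_in phi br x.
  exact: Qw.
elim: s => [|x s IH]; first by rewrite !big_nil.
by rewrite !big_cons uea_piM IH.
Qed.

Section LiftMorphism.
Variables (A : algType C) (v : L -> A).
Hypothesis v_linear : forall (a : R) x y, v (a *: x + y) = phi a *: v x + v y.
Hypothesis v_bracket : forall x y, v (br x y) = v x * v y - v y * v x.
Local Notation lift := (@uea_lift R C phi L br A v).
Let lift_pi := uea_lift_pi v_linear v_bracket.

Lemma uea_lift_linear a u w : lift (a *: u + w) = a *: lift u + lift w.
Proof.
elim/uea_ind: u => f; elim/uea_ind: w => g.
by rewrite -uea_piZ -uea_piD !lift_pi fevalD fevalZ.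
Qed.

Lemma uea_liftM u w : lift (u * w) = lift u * lift w.
Proof.
elim/uea_ind: u => f; elim/uea_ind: w => g.
by rewrite -uea_piM !lift_pi fevalM.
Qed.

Lemma uea_lift1 : lift 1 = 1.
Proof. by rewrite -[1 in LHS]/(uea_pi phi br 1) lift_pi feval1. Qed.

Lemma uea_lift_in x : lift (uea_in phi br x) = v x.
Proof. by rewrite lift_pi feval_var. Qed.
End LiftMorphism.
End EnvelopingWords.

(** * Seven generators: straightening, generation and relations *)

(* The orders of D0, ..., D5 and of the square operator. *)
Definition wt7 (j : 'I_7) : nat := nth 0%N [:: 1; 2; 2; 2; 1; 1; 2]%N j.

Definition mnm_wt (al : 'X_{1..7}) : nat := (\sum_(i <- mword al) wt7 i)%N.

Section Straightening.
Variable F : numClosedFieldType.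
Local Notation A := (freealg F 'I_7).
Variable Id : A -> Prop.
Hypothesis Id_ideal : two_sided_ideal Id.

Definition wordX (s : seq 'I_7) : A := \prod_(i <- s) fvar F i.

(* Combinations of words of weight less than d. *)
Inductive Wt (d : nat) : A -> Prop :=
| Wt0 : Wt d 0
| WtW s : (\sum_(i <- s) wt7 i < d)%N -> Wt d (wordX s)
| WtL a f g : Wt d f -> Wt d g -> Wt d (a *: f + g).

Definition WtI d f := exists2 g, Wt d g & Id (f - g).

Hypothesis rel : forall i j,
  WtI (wt7 i + wt7 j) (fvar F i * fvar F j - fvar F j * fvar F i).

Lemma Wt_le d d' f : (d <= d')%N -> Wt d f -> Wt d' f.
Proof.
move=> dd'; elim=> [|s sd|a x y _ IHx _ IHy]; first exact: Wt0.
  by apply: WtW; apply: leq_trans sd dd'.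
exact: WtL.
Qed.

Lemma WtD d u v : Wt d u -> Wt d v -> Wt d (u + v).
Proof. by rewrite -[u in u + v]scale1r; apply: WtL. Qed.

Lemma Wt_zero f : Wt 0 f -> f = 0.
Proof. by elim=> // a x y _ -> _ ->; rewrite scaler0 addr0. Qed.

Lemma wordX_cat s t : wordX (s ++ t) = wordX s * wordX t.
Proof. by rewrite /wordX big_cat. Qed.

Lemma Wt_mull t d f : Wt d f -> Wt (\sum_(i <- t) wt7 i + d) (wordX t * f).
Proof.
elim=> [|s sd|a x y _ IHx _ IHy]; first by rewrite mulr0; exact: Wt0.
  by rewrite -wordX_cat; apply: WtW; rewrite big_cat /= ltn_add2l.
by rewrite mulrDr -scalerAr; apply: WtL.
Qed.

Lemma Wt_mulr t d f : Wt d f -> Wt (d + \sum_(i <- t) wt7 i) (f * wordX t).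
Proof.
elim=> [|s sd|a x y _ IHx _ IHy]; first by rewrite mul0r; exact: Wt0.
  by rewrite -wordX_cat; apply: WtW; rewrite big_cat /= ltn_add2r.
by rewrite mulrDl -scalerAl; apply: WtL.
Qed.

Lemma Id0 : Id 0. Proof. by case: Id_ideal. Qed.

Lemma IdB f g : Id f -> Id g -> Id (f - g).
Proof. by case: Id_ideal => _ + _; apply. Qed.

Lemma IdM a f b : Id f -> Id (a * f * b).
Proof. by case: Id_ideal => _ _; apply. Qed.

Lemma IdD f g : Id f -> Id g -> Id (f + g).
Proof.
by move=> If Ig; rewrite -[g]opprK -[- g]sub0r; do 2!apply: IdB => //; exact: Id0.
Qed.

Lemma IdZ a f : Id f -> Id (a *: f).
Proof. by move=> If; rewrite -[f]mul1r scalerAl -[_ * f]mulr1; apply: IdM. Qed.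

Lemma WtI_of d f : Wt d f -> WtI d f.
Proof. by move=> Wf; exists f => //; rewrite subrr; exact: Id0. Qed.

Lemma WtI_Id d f : Id f -> WtI d f.
Proof. by move=> If; exists 0; [exact: Wt0 | rewrite subr0]. Qed.

Lemma WtI0 d : WtI d 0. Proof. exact/WtI_of/Wt0. Qed.

Lemma WtIL d a f g : WtI d f -> WtI d g -> WtI d (a *: f + g).
Proof.
move=> [f' Wf If] [g' Wg Ig]; exists (a *: f' + g'); first exact: WtL.
by rewrite opprD addrACA -scalerBr; apply: IdD => //; apply: IdZ.
Qed.

Lemma WtID d u v : WtI d u -> WtI d v -> WtI d (u + v).
Proof. by rewrite -[u in u + v]scale1r; apply: WtIL. Qed.

Lemma WtIZ d a u : WtI d u -> WtI d (a *: u).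
Proof. by move=> Wu; rewrite -[a *: u]addr0; apply: WtIL => //; exact: WtI0. Qed.

Lemma WtIB d u v : WtI d u -> WtI d v -> WtI d (u - v).
Proof. by move=> Wu Wv; rewrite -scaleN1r addrC; apply: WtIL. Qed.

Lemma WtI_mull t d f : WtI d f -> WtI (\sum_(i <- t) wt7 i + d) (wordX t * f).
Proof.
move=> [g Wg Ig]; exists (wordX t * g); first exact: Wt_mull.
by rewrite -mulrBr -[_ * _]mulr1; apply: IdM.
Qed.

Lemma WtI_mulr t d f : WtI d f -> WtI (d + \sum_(i <- t) wt7 i) (f * wordX t).
Proof.
move=> [g Wg Ig]; exists (g * wordX t); first exact: Wt_mulr.
by rewrite -mulrBl -[_ - _]mul1r; apply: IdM.
Qed.

Lemma wordX_perm s t : perm_eq s t ->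
  WtI (\sum_(i <- s) wt7 i) (wordX s - wordX t).
Proof.
apply: (Phi_perm (Phi := WtI)) => [d|d u v|d x u|x y {}s].
- exact: WtI0.
- exact: WtID.
- by move=> /(@WtI_mull [:: x]); rewrite /wordX !big_seq1.
- by rewrite addnA; apply: (@WtI_mulr s); apply: rel.
Qed.

Definition polyX (Q : {mpoly F[7]}) : A :=
  \sum_(al <- msupp Q) Q@_al *: wordX (mword al).

Lemma polyX_wide (Q : {mpoly F[7]}) (s : seq 'X_{1..7}) : uniq s ->
  {subset msupp Q <= s} -> polyX Q = \sum_(al <- s) Q@_al *: wordX (mword al).
Proof.
move=> us ps; rewrite /polyX [RHS](bigID (mem (msupp Q))) /=.
rewrite [X in _ + X]big1 ?addr0 => [|al /memN_msupp_eq0 ->]; last by rewrite scale0r.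
rewrite -[RHS]big_filter; apply: perm_big; apply: uniq_perm.
- exact: msupp_uniq.
- exact: filter_uniq.
by move=> al; rewrite mem_filter andb_idr //; apply: ps.
Qed.

Lemma polyXL a p q : polyX (a *: p + q) = a *: polyX p + polyX q.
Proof.
pose s := undup (msupp p ++ msupp q ++ msupp (a *: p + q)).
rewrite !(@polyX_wide _ s) ?undup_uniq //.
- rewrite scaler_sumr -big_split; apply: eq_bigr => al _ /=.
  by rewrite mcoeffD mcoeffZ scalerDl scalerA.
- by move=> al H; rewrite mem_undup !mem_cat H !orbT.
- by move=> al H; rewrite mem_undup !mem_cat H.
- by move=> al H; rewrite mem_undup !mem_cat H !orbT.
Qed.

Lemma polyX0 : polyX 0 = 0.
Proof. by rewrite /polyX msupp0 big_nil. Qed.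

Definition supported (good : pred 'X_{1..7}) d (Q : {mpoly F[7]}) :=
  {in msupp Q, forall al, mnm_wt al = d /\ good al}.

Lemma supportedL good d a p q :
  supported good d p -> supported good d q -> supported good d (a *: p + q).
Proof.
move=> hp hq al /msuppD_le; rewrite mem_cat => /orP[/msuppZ_le|]; first exact: hp.
exact: hq.
Qed.

Lemma supported0 good d : supported good d 0.
Proof. by move=> al; rewrite msupp0. Qed.

Lemma Wt_polyX good d Q : supported good d Q -> Wt d.+1 (polyX Q).
Proof.
move=> dQ; rewrite /polyX big_seq; elim/big_ind: _ => [|x y|al /dQ[alw _]].
- exact: Wt0.
- exact: WtD.
rewrite -[_ *: _]addr0; apply: WtL; last exact: Wt0.
by apply: WtW; rewrite -/(mnm_wt al) alw.
Qed.

(* The monomials satisfying [good] suffice modulo Id and terms of lower weight. *)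
Definition straightens (good : pred 'X_{1..7}) := forall s,
  exists2 Q, supported good (\sum_(i <- s) wt7 i) Q &
    WtI (\sum_(i <- s) wt7 i) (wordX s - polyX Q).

Lemma wordX_ordered s :
  WtI (\sum_(i <- s) wt7 i) (wordX s - polyX 'X_[word_mnm s]).
Proof.
rewrite /polyX msuppX big_seq1 mcoeffX eqxx scale1r; apply: wordX_perm.
exact: perm_mword.
Qed.

Lemma supportedX s (good : pred 'X_{1..7}) : good (word_mnm s) ->
  supported good (\sum_(i <- s) wt7 i) 'X_[word_mnm s].
Proof.
move=> gs al; rewrite msuppX inE => /eqP->; split=> //.
by rewrite /mnm_wt; apply: perm_big; rewrite perm_sym perm_mword.
Qed.

Lemma straightens_all : straightens predT.
Proof.
by move=> s; exists 'X_[word_mnm s]; [exact: supportedX | exact: wordX_ordered].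
Qed.

(** If D1 D2 is a combination of D3^2, of the square of the last generator and of
    terms of lower weight, then monomials containing both D1 and D2 are not
    needed. *)
Definition no_D1D2 : pred 'X_{1..7} :=
  fun al => (al (inord 1) == 0%N) || (al (inord 2) == 0%N).

Lemma straightens_no_D1D2 :
  WtI 4 (fvar F (inord 1) * fvar F (inord 2)
         - fvar F (inord 3) ^+ 2 - fvar F (inord 6) ^+ 2) ->
  straightens no_D1D2.
Proof.
move=> quad s; have [n] := ubnP (count_mem (inord 1) s).
elim: n s => // n IH s; rewrite ltnS => sn.
have [n1|/negPn s1] := boolP (inord 1 \notin s).
  exists 'X_[word_mnm s]; last exact: wordX_ordered.
  by apply: supportedX; rewrite /no_D1D2 mnmE; rewrite (count_memPn n1).
have [n2|/negPn s2] := boolP (inord 2 \notin s).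
  exists 'X_[word_mnm s]; last exact: wordX_ordered.
  by apply: supportedX; rewrite /no_D1D2 orbC mnmE; rewrite (count_memPn n2).
have ne i j : (i < 7)%N -> (j < 7)%N -> i != j -> (inord i == inord j :> 'I_7) = false.
  by move=> i7 j7 /negPf ij; rewrite -val_eqE /= !inordK.
pose t := rem (inord 2) (rem (inord 1) s).
have st : perm_eq s [:: inord 1, inord 2 & t].
  rewrite (permPl (perm_to_rem s1)) perm_cons perm_to_rem //.
  by apply: rem_mem s2; rewrite ne.
have wE : (\sum_(i <- s) wt7 i = 4 + \sum_(i <- t) wt7 i)%N.
  by rewrite (perm_big _ st) /= !big_cons /wt7 !inordK.
have ct : (count_mem (inord 1) t < n)%N.
  by move: sn; rewrite (permP st) /= eqxx ne.
have wE' j : (j == inord 3) || (j == inord 6) ->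
    (\sum_(i <- [:: j, j & t]) wt7 i = \sum_(i <- s) wt7 i)%N.
  by rewrite wE !big_cons => /orP[] /eqP->; rewrite /wt7 !inordK.
have cE j : (j == inord 3) || (j == inord 6) ->
    (count_mem (inord 1) [:: j, j & t] < n)%N.
  by case/orP => /eqP-> /=; rewrite !ne // !add0n.
have p3 : (inord 3 == inord 3 :> 'I_7) || (inord 3 == inord 6 :> 'I_7) by rewrite eqxx.
have p6 : (inord 6 == inord 3 :> 'I_7) || (inord 6 == inord 6 :> 'I_7) by rewrite eqxx orbT.
have [Q3 Q3s Q3E] := IH _ (cE _ p3); have [Q6 Q6s Q6E] := IH _ (cE _ p6).
rewrite wE' // in Q3s Q3E; rewrite wE' // in Q6s Q6E.
exists (Q3 + Q6); first by rewrite -[Q3]scale1r; apply: supportedL.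
have -> : wordX s - polyX (Q3 + Q6)
    = (wordX s - wordX [:: inord 1, inord 2 & t])
      + ((fvar F (inord 1) * fvar F (inord 2)
          - fvar F (inord 3) ^+ 2 - fvar F (inord 6) ^+ 2) * wordX t
      + ((wordX [:: inord 3, inord 3 & t] - polyX Q3)
      + (wordX [:: inord 6, inord 6 & t] - polyX Q6))).
  have -> : polyX (Q3 + Q6) = polyX Q3 + polyX Q6 by rewrite -[Q3]scale1r polyXL !scale1r.
  have -> : (fvar F (inord 1) * fvar F (inord 2)
       - fvar F (inord 3) ^+ 2 - fvar F (inord 6) ^+ 2) * wordX t
      = wordX [:: inord 1, inord 2 & t] - wordX [:: inord 3, inord 3 & t]
        - wordX [:: inord 6, inord 6 & t].
    by rewrite !mulrBl !expr2 /wordX !big_cons !mulrA.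
  by nc_coefs F (freealg F 'I_7); ring.
apply: WtID; first exact: wordX_perm.
apply: WtID; first by rewrite wE; apply: WtI_mulr.
by apply: WtID.
Qed.

Lemma Wt_straight good d f : straightens good -> Wt d.+1 f ->
  exists2 Q, supported good d Q & WtI d (f - polyX Q).
Proof.
move=> str; elim=> [|s|a x y _ [p hp Ep] _ [q hq Eq]].
- by exists 0; [exact: supported0 | rewrite polyX0 subr0; exact: WtI0].
- rewrite ltnS leq_eqVlt => /orP[/eqP <-|sd]; first exact: str.
  by exists 0; [exact: supported0 | rewrite polyX0 subr0; apply/WtI_of/WtW].
- exists (a *: p + q); first exact: supportedL.
  by rewrite polyXL opprD addrACA -scalerBr; apply: WtIL.
Qed.

Lemma Wt_exists f : exists d, Wt d f.
Proof.
elim/freealg_ind: f => [|a f g [d Wf] [d' Wg]|s].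
- by exists 0%N; exact: Wt0.
- exists (maxn d d'); apply: WtL; [apply: Wt_le Wf | apply: Wt_le Wg].
    exact: leq_maxl.
  exact: leq_maxr.
- by exists (\sum_(i <- s) wt7 i).+1; apply: WtW.
Qed.
End Straightening.

Section Generators.
Variables (F : numClosedFieldType) (m : nat) (I : F).
Hypothesis II : I * I = -1.
Variable V : enveloping F m.
Local Notation U := (ualg V).
Local Notation e := (@uin F m V).
Variable D : 'I_7 -> U.

Definition block_of q (j : 'I_3) : F := lam q (pbasis F (inl j : pindex m)).
Definition right_of q : 'M[F]_(2, m) :=
  \matrix_(i, k) lam q (pbasis F (inr (inl (i, k)) : pindex m)).
Definition left_of q : 'M[F]_(m, 2) :=
  \matrix_(k, j) lam q (pbasis F (inr (inr (k, j)) : pindex m)).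

Definition symv q : 'I_7 -> F := symbols I (block_of q) (right_of q *m left_of q).

Hypothesis D_fil : forall j, Fil (wt7 j).+1 (D j).
Hypothesis D_symb : forall q j, symb q (wt7 j) (D j) = symv q j.
Hypothesis D_comm : forall x j, stabilizer x -> e x * D j = D j * e x.

Lemma peval_of q (i : 'I_#|pindex m|) :
  lam q (pbas F i) = peval (block_of q) (right_of q) (left_of q) i.
Proof.
by rewrite /pbas /peval; case: (enum_val i) => [j|[[k j]|[k j]]]; rewrite /= ?mxE.
Qed.

Lemma symbols_of_surj t x y : exists q,
  [/\ block_of q =1 t, right_of q = x & left_of q = y].
Proof.
have [q qE] := lam_surj t x y; exists q; split=> [j||].
- exact: (qE (inl j)).
- by apply/matrixP => i k; rewrite mxE (qE (inr (inl (i, k)))).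
- by apply/matrixP => k j; rewrite mxE (qE (inr (inr (k, j)))).
Qed.

Lemma feval_word s : feval D (wordX F s) = \prod_(i <- s) D i.
Proof.
rewrite /wordX; elim: s => [|i s IH]; first by rewrite !big_nil feval1.
by rewrite !big_cons fevalM feval_var IH.
Qed.

Lemma wordD_fil s : Fil (\sum_(i <- s) wt7 i).+1 (\prod_(i <- s) D i).
Proof.
elim: s => [|i s IH]; last by rewrite !big_cons; apply: FilM.
by rewrite !big_nil -(word_nil V); exact: FilW.
Qed.

Lemma wordD_symb q s :
  symb q (\sum_(i <- s) wt7 i) (\prod_(i <- s) D i) = \prod_(i <- s) symv q i.
Proof.
elim: s => [|i s IH].
  by rewrite !big_nil -(word_nil V) symb_word // big_nil.
by rewrite !big_cons symbM ?D_symb ?IH //; apply: wordD_fil.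
Qed.

Lemma feval_Wt d f : Wt d f -> Fil d (feval D f).
Proof.
elim=> [|s sd|a x y _ IHx _ IHy].
- by rewrite raddf0; exact: Fil0.
- by rewrite feval_word; apply: Fil_le (wordD_fil s).
- by rewrite fevalD fevalZ; apply: FilL.
Qed.

Lemma feval_polyX q good d Q : supported good d Q ->
  symb q d (feval D (polyX Q)) = Q.@[symv q].
Proof.
move=> dQ; rewrite mevalE /polyX raddf_sum symb_sum !big_seq.
apply: eq_bigr => al /dQ[<- _]; rewrite /= fevalZ symbZ feval_word wordD_symb.
by rewrite (prod_mword (symv q)).
Qed.

(** The generators commute with k0, which makes U k0 a two-sided ideal of the
    algebra that they generate. *)
Lemma Jk_mulr u f : Jk u -> Jk (u * feval D f).
Proof.
elim/freealg_ind: f => [|a f g IHf IHg|s] Ju.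
- by rewrite raddf0 mulr0; exact: Jk0.
- by rewrite fevalD fevalZ mulrDr -scalerAr; apply: JkL; [apply: IHf | apply: IHg].
rewrite -/(wordX F s) feval_word; elim: s u Ju => [|j s IH] u Ju.
  by rewrite big_nil mulr1.
rewrite big_cons mulrA; apply: IH; case: Ju => [t [tP ->]].
rewrite mulr_suml big_seq; elim/big_ind: _ => [|x y Jx Jy|p /tP ps].
- exact: Jk0.
- by rewrite -[x]scale1r; apply: JkL.
by rewrite -mulrA D_comm // mulrA; apply: Jk_e.
Qed.

Section Relations.
Variable S : freealg F 'I_7 -> Prop.
Hypothesis S_rel : forall f, S f -> Jk (feval D f).

Lemma ideal_Jk f : ideal_gen S f -> Jk (feval D f).
Proof.
move=> /(_ (fun f => Jk (feval D f))); apply=> //; split=> [|x y Jx Jy|a b x Jx].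
- by rewrite raddf0; exact: Jk0.
- by rewrite fevalB addrC -scaleN1r; apply: JkL.
- by rewrite !fevalM; apply/Jk_mulr/JkM.
Qed.

(** A combination of ordered words vanishing modulo U k0 has vanishing symbol, so
    no ordered word of top weight occurs in it. *)
Theorem relations_in_ideal good : straightens (ideal_gen S) good ->
    (forall d Q, supported good d Q -> (forall q, Q.@[symv q] = 0) -> Q = 0) ->
  forall f, Jk (feval D f) -> ideal_gen S f.
Proof.
move=> str indep f; have [d Wf] := Wt_exists f; elim: d f Wf => [|d IH] f Wf Jf.
  by rewrite (Wt_zero Wf); apply: Id0; exact: ideal_gen_ideal.
have [Q QS [g Wg Ig]] := Wt_straight (ideal_gen_ideal S) str Wf.
have Q0 : Q = 0.
  apply: (indep _ _ QS) => q; rewrite -(feval_polyX _ QS).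
  have -> : feval D (polyX Q) = feval D f - (feval D g + feval D (f - polyX Q - g)).
    by rewrite -!fevalD -fevalB [g + _]addrC subrK subKr.
  rewrite symbB symbD (symb_Jk _ _ Jf) (symb_Fil _ (feval_Wt Wg)).
  by rewrite (symb_Jk _ _ (ideal_Jk Ig)) addr0 subrr.
move: Ig; rewrite Q0 polyX0 subr0 => Ig.
rewrite -[f](subrK g); apply: (IdD (ideal_gen_ideal S)) => //.
apply: IH => //; rewrite -[g](subKr f) fevalB.
by rewrite addrC -scaleN1r; apply: JkL => //; apply: ideal_Jk.
Qed.
End Relations.

(** For m >= 2 every 2 x 2 matrix is a product x y, so the seven symbols are
    algebraically independent. *)
Lemma symv_surj : (2 <= m)%N -> forall v, exists q, symv q =1 v.
Proof.
move=> m2 v; pose J : 'M[F]_(2, m) := pid_mx 2.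
have JJ : J *m J^T = 1%:M.
  by rewrite /J tr_pid_mx mul_pid_mx minnn (minn_idPr m2) pid_mx_1.
have [q [qt qx qy]] := symbols_of_surj (block_of_symbols I v) J
  (J^T *m quad_of_symbols I v).
exists q => j; rewrite /symv qx qy mulmxA JJ mul1mx (symbols_ext I _ qt).
exact: (symbols_surj II).
Qed.

(** For m = 1 the quadratic symbols are those of the matrices x y of rank at most
    one, that is the zeros of d1 d2 - d3^2 - d6^2. *)
Lemma symv_surj_cone : (0 < m)%N -> forall v,
  v (inord 1) * v (inord 2) = v (inord 3) ^+ 2 + v (inord 6) ^+ 2 ->
  v (inord 1) != 0 \/ v (inord 2) != 0 ->
  exists q, symv q =1 v.
Proof.
move=> m0 v cone nz; pose k0 := Ordinal m0; pose Z := quad_of_symbols I v.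
pose dx (a b : F) : 'M[F]_(2, m) :=
  \matrix_(i, k) if k == k0 then if i == 0 then a else b else 0.
pose dy (a b : F) : 'M[F]_(m, 2) :=
  \matrix_(k, j) if k == k0 then if j == 0 then a else b else 0.
have dxyE a b c d i j : (dx a b *m dy c d) i j
    = (if i == 0 then a else b) * (if j == 0 then c else d).
  rewrite mxE (bigD1 k0) //= big1 ?addr0 => [|k /negPf kk0].
    by rewrite !mxE eqxx.
  by rewrite !mxE kk0 mulr0.
suff [x [y xyE]] : exists (x : 'M[F]_(2, m)) (y : 'M[F]_(m, 2)), x *m y = Z.
  have [q [qt qx qy]] := symbols_of_surj (block_of_symbols I v) x y.
  exists q => j; rewrite /symv qx qy (symbols_ext I _ qt) xyE.
  exact: (symbols_surj II).
have ZE : [/\ Z 0 0 = - v (inord 1), Z 0 1 = v (inord 3) + I * v (inord 6),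
    Z 1 0 = v (inord 3) - I * v (inord 6) & Z 1 1 = - v (inord 2)].
  by rewrite /Z !mxE.
case: ZE => Z00 Z01 Z10 Z11.
have detZ : Z 0 0 * Z 1 1 = Z 0 1 * Z 1 0.
  by rewrite Z00 Z01 Z10 Z11 mulrNN cone; ring: II.
have eq2 (A B : 'M[F]_2) : A 0 0 = B 0 0 -> A 0 1 = B 0 1 ->
    A 1 0 = B 1 0 -> A 1 1 = B 1 1 -> A = B.
  move=> E00 E01 E10 E11; apply/matrixP.
  by move=> i j; case: (ord2_cases i) => ->; case: (ord2_cases j) => ->.
case: nz => nz.
  have z0 : Z 0 0 != 0 by rewrite Z00 oppr_eq0.
  exists (dx 1 (Z 1 0 / Z 0 0)), (dy (Z 0 0) (Z 0 1)).
  apply: eq2; rewrite dxyE /= ?mul1r ?divfK //.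
  by apply: (mulfI z0); rewrite detZ; field.
have z1 : Z 1 1 != 0 by rewrite Z11 oppr_eq0.
exists (dx (Z 0 1 / Z 1 1) 1), (dy (Z 1 0) (Z 1 1)).
apply: eq2; rewrite dxyE /= ?mul1r ?divfK //.
by apply: (mulfI z1); rewrite [RHS]mulrC detZ; field.
Qed.

Lemma symv_indep_large : (2 <= m)%N -> forall good d Q, supported good d Q ->
  (forall q, Q.@[symv q] = 0) -> Q = 0.
Proof.
move=> m2 good d Q _ Q0; apply: meval_eq0 => v.
by have [q qE] := symv_surj m2 v; rewrite -(Q0 q); apply: meval_eq => j; rewrite qE.
Qed.

Lemma symv_indep_small : (0 < m)%N -> forall d Q, supported no_D1D2 d Q ->
  (forall q, Q.@[symv q] = 0) -> Q = 0.
Proof.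
move=> m0 d Q dQ Q0.
have cone v : v (inord 1) * v (inord 2) = v (inord 3) ^+ 2 + v (inord 6) ^+ 2 ->
    v (inord 1) != 0 \/ v (inord 2) != 0 -> Q.@[v] = 0.
  move=> cv nzv; have [q qE] := symv_surj_cone m0 cv nzv.
  by rewrite -(Q0 q); apply: meval_eq => j; rewrite qE.
have ne i j : (i < 7)%N -> (j < 7)%N -> i != j -> (inord i == inord j :> 'I_7) = false.
  by move=> i7 j7 /negPf ij; rewrite -val_eqE /= !inordK.
have n12 := ne 1%N 2%N isT isT isT; have n21 := ne 2%N 1%N isT isT isT.
have n31 := ne 3%N 1%N isT isT isT; have n32 := ne 3%N 2%N isT isT isT.
have n61 := ne 6%N 1%N isT isT isT; have n62 := ne 6%N 2%N isT isT isT.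
(* The torus (s, 1/s) acts on the cone by rescaling d1 and d2; the parts of Q of
   weight a for it vanish separately. *)
pose tw (al : 'X_{1..7}) := (d + al (inord 1) - al (inord 2))%N.
have al2d al : al \in msupp Q -> (al (inord 2) <= d)%N.
  move=> /dQ[<- _]; rewrite /mnm_wt sum_mword (bigD1 (inord 2)) //=.
  by rewrite {1}/wt7 inordK // mul2n -addnn -addnA leq_addr.
pose part k : {mpoly F[7]} := \sum_(al <- msupp Q | tw al == k) Q@_al *: 'X_[al].
pose pt (v : 'I_7 -> F) (a b : F) j := if j == inord 1 then a else
  if j == inord 2 then b else v j.
have ptE v a b : [/\ pt v a b (inord 1) = a, pt v a b (inord 2) = b,
    pt v a b (inord 3) = v (inord 3) & pt v a b (inord 6) = v (inord 6)].
  by rewrite /pt !eqxx n21 n31 n32 n61 n62.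
have mon_pt (v : 'I_7 -> F) a b (al : 'X_{1..7}) : \prod_j pt v a b j ^+ al j
    = a ^+ al (inord 1) * b ^+ al (inord 2)
      * \prod_(j | (j != inord 1) && (j != inord 2)) v j ^+ al j.
  rewrite (bigD1 (inord 1)) //= (bigD1 (inord 2)) /= ?n21 //.
  rewrite mulrA /pt !eqxx n21; congr (_ * _); apply: eq_bigr => j.
  by move=> /andP[/negPf-> /negPf->].
have part0 k v a b : a * b = v (inord 3) ^+ 2 + v (inord 6) ^+ 2 ->
    a != 0 \/ b != 0 -> (part k).@[pt v a b] = 0.
  move=> ab nz.
  have -> : (part k).@[pt v a b] = \sum_(al <- msupp Q | tw al == k)
      (Q@_al * \prod_j pt v a b j ^+ al j).
    rewrite /part meval_sum; apply: eq_bigr => al _.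
    by rewrite mevalZ mevalX.
  apply: sum_powers_eq0 => s s0.
  have [E1 E2 E3 E6] := ptE v (a * s) (b / s).
  have := cone (pt v (a * s) (b / s)); rewrite E1 E2 E3 E6.
  rewrite mulrACA divff // mulr1 => /(_ ab) H0.
  have {}H0 : Q.@[pt v (a * s) (b / s)] = 0.
    by apply: H0; case: nz => nz; [left|right]; rewrite mulf_neq0 ?invr_eq0.
  transitivity (s ^+ d * Q.@[pt v (a * s) (b / s)]); last by rewrite H0 mulr0.
  rewrite mevalE mulr_sumr !big_seq.
  apply: eq_bigr => al alQ; rewrite [RHS]mulrCA -mulrA; congr (_ * _).
  rewrite !mon_pt !exprMn exprVn /tw exprB ?unitfE //; last first.
    by apply: leq_trans (al2d _ alQ) (leq_addr _ _).
  by rewrite exprD; ring.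
have part_eq0 k : part k = 0.
  apply: meval_eq0 => v; pose w := v (inord 3) ^+ 2 + v (inord 6) ^+ 2.
  have vpt (p : {mpoly F[7]}) : p.@[v] = p.@[pt v (v (inord 1)) (v (inord 2))].
    apply: meval_eq => j; rewrite /pt.
    by case: eqP => [->//|_]; case: eqP => [->|].
  have good_al al : al \in msupp Q -> tw al = k ->
      al (inord 1) = (k - d)%N /\ al (inord 2) = (d - k)%N.
    move=> alQ; have := al2d _ alQ; have [_] := dQ _ alQ.
    rewrite /tw => /orP[] /eqP-> ad <-.
      by rewrite addn0 subKn // (eqP (leq_subr _ _)).
    by rewrite subn0 addKn (eqP (leq_addr _ _)).
  have scale a b : (part k).@[pt v a b]
      = a ^+ (k - d) * b ^+ (d - k) * (part k).@[pt v 1 1].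
    rewrite /part !meval_sum mulr_sumr [LHS]big_seq_cond [RHS]big_seq_cond.
    apply: eq_bigr => al /andP[alQ /eqP/(good_al _ alQ)[E1 E2]].
    by rewrite !mevalZ !mevalX !mon_pt E1 E2 !expr1n; ring.
  rewrite vpt scale; have [kd|/ltnW dk] := leqP k d.
    have := part0 k v w 1; rewrite mulr1 => /(_ erefl (or_intror (oner_neq0 F))).
    by rewrite scale (eqP kd) expr0 mul1r expr1n mul1r => ->; rewrite mulr0.
  have := part0 k v 1 w; rewrite mul1r => /(_ erefl (or_introl (oner_neq0 F))).
  by rewrite scale (eqP dk) expr0 mulr1 expr1n mul1r => ->; rewrite mulr0.
apply/mpolyP => al; rewrite mcoeff0.
have [alQ|/memN_msupp_eq0 //] := boolP (al \in msupp Q).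
have := congr1 (mcoeff al) (part_eq0 (tw al)); rewrite mcoeff0 raddf_sum /=.
move=> H; apply: etrans H; rewrite big_mkcond (bigD1_seq al) ?msupp_uniq //=.
rewrite eqxx big1 => [|be /negPf ne']; last first.
  by case: ifP => // _; rewrite mcoeffZ mcoeffX ne' mulr0.
by rewrite addr0 mcoeffZ mcoeffX eqxx mulr1.
Qed.

Section Generation.
Variable Inv : U -> Prop.
Hypothesis InvL : forall a u v, Inv u -> Inv v -> Inv (a *: u + v).
Hypothesis Inv_feval : forall f, Inv (feval D f).
Hypothesis Inv_symbol : forall u d p, Inv u -> FilJ d.+1 u ->
  (forall q, symb q d u = p.@[fun i => lam q (pbas F i)]) -> block_invariant p.
Hypothesis U_fil : forall u : U, exists d, Fil d u.

Lemma meval_of_degree d (p : {mpoly F[#|pindex m|]}) s v :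
  of_degree d p -> p.@[fun i => s * v i] = s ^+ d * p.@[v].
Proof.
move=> dp; rewrite !mevalE mulr_sumr !big_seq; apply: eq_bigr => al alp.
rewrite mulrCA; congr (_ * _); rewrite -(dp _ alp) mdegE -prodrXr -big_split.
by apply: eq_bigr => i _; rewrite exprMn.
Qed.

(** The symbol of an invariant element is an invariant polynomial on p, hence a
    polynomial in the symbols of D0, ..., D5 and the square operator; the same
    polynomial in these operators has this symbol. *)
Theorem generation u : (0 < m)%N -> Inv u -> exists f, Jk (u - feval D f).
Proof.
move=> m0 Iu; have [d /FilJ_of Fu] := U_fil u.
elim: d u Iu Fu => [|d IH] u Iu Fu.
  exists 0; rewrite raddf0 subr0; case: Fu => v /Fil_zero->.
  by rewrite subr0.
have [p dp pE] := FilJ_symb_poly Fu.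
have [Q QE] := first_fundamental_theorem II m0 (Inv_symbol Iu Fu pE).
(* Only the part of Q of weight d matters. *)
have Qd t x y : p.@[peval t x y] = \sum_(al <- msupp Q | mnm_wt al == d)
    Q@_al * \prod_j symbols I t (x *m y) j ^+ al j.
  pose c (o : option 'X_{1..7}) : F := if o is Some al
    then Q@_al * \prod_j symbols I t (x *m y) j ^+ al j else - p.@[peval t x y].
  pose w o : nat := if o is Some al then mnm_wt al else d.
  have := @sum_powers_eq0 _ _ (None :: map Some (msupp Q)) c w _ d.
  rewrite !big_cons /= eqxx big_map => H; apply/eqP; rewrite eq_sym -subr_eq0 addrC.
  apply/eqP/H => {H} s s0; rewrite !big_cons big_map /=.
  have := QE (fun j => s * t j) (s *: x) (s *: y).
  rewrite -scalemxAl -scalemxAr scalerA -expr2.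
  have -> : p.@[peval (fun j => s * t j) (s *: x) (s *: y)] = s ^+ d * p.@[peval t x y].
    rewrite -meval_of_degree //; apply: meval_eq => i.
    by rewrite /peval; case: (enum_val i) => [j|[[k j]|[k j]]]; rewrite /= ?mxE.
  rewrite mevalE mulNr mulrC => ->; rewrite addrC; apply/eqP; rewrite subr_eq0; apply/eqP.
  apply: eq_bigr => al _; rewrite -mulrA; congr (_ * _).
  rewrite /mnm_wt sum_mword -prodrXr -big_split; apply: eq_bigr => j _ /=.
  rewrite symbols_scale // exprMn -exprM mulrC; congr (_ * _).
pose Q' : {mpoly F[7]} := \sum_(al <- msupp Q | mnm_wt al == d) Q@_al *: 'X_[al].
have Q'd : supported predT d Q'.
  rewrite /Q'; elim/big_ind: _ => [|x y sx sy|al /eqP alw]; first exact: supported0.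
    by rewrite -[x]scale1r; apply: supportedL.
  by move=> be /msuppZ_le; rewrite msuppX inE => /eqP->.
have u'E : FilJ d (u - feval D (polyX Q')).
  apply: FilJ_symb_eq0 => [|q].
    by apply: FilJB => //; apply/FilJ_of/feval_Wt/(Wt_polyX Q'd).
  rewrite symbB (feval_polyX _ Q'd) pE (meval_eq _ (peval_of q)) Qd.
  rewrite /Q' meval_sum; apply/eqP; rewrite subr_eq0; apply/eqP.
  by apply: eq_bigr => al _; rewrite mevalZ mevalX.
have [|f fE] := IH _ _ u'E.
  by rewrite addrC -scaleN1r; apply: InvL.
by exists (polyX Q' + f); rewrite fevalD opprD addrA.
Qed.
End Generation.
End Generators.

(** * The commutation relations *)

Section Commutators.
Variables (F : fieldType) (A : algType F).
Implicit Types x y z : A.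

Lemma commL a x y z : comm (a *: x + y) z = a *: comm x z + comm y z.
Proof. by rewrite /comm; nc_coefs F A; ring. Qed.

Lemma commR a x y z : comm z (a *: x + y) = a *: comm z x + comm z y.
Proof. by rewrite /comm; nc_coefs F A; ring. Qed.

Lemma commD x y z : comm (x + y) z = comm x z + comm y z.
Proof. by rewrite -[x]scale1r commL !scale1r. Qed.

Lemma commC x y : comm x y = - comm y x.
Proof. by rewrite /comm opprB. Qed.

Lemma commDr x y z : comm z (x + y) = comm z x + comm z y.
Proof. by rewrite -[x]scale1r commR !scale1r. Qed.

Lemma commZ a x z : comm (a *: x) z = a *: comm x z.
Proof. by rewrite /comm; nc_coefs F A; ring. Qed.

Lemma commZr a x z : comm z (a *: x) = a *: comm z x.
Proof. by rewrite /comm; nc_coefs F A; ring. Qed.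

Lemma commMr x y z : comm z (x * y) = comm z x * y + x * comm z y.
Proof. by rewrite /comm; nc_coefs F A; ring. Qed.

(* Replaces u by an element f congruent to it modulo a left ideal. *)
Lemma comm_shift z u f :
  comm z u = comm z f + ((-1) *: ((u - f) * z) + z * (u - f)).
Proof. by rewrite /comm; nc_coefs F A; ring. Qed.

Lemma comm_suml (T : Type) (s : seq T) (P : pred T) (h : T -> A) z :
  comm (\sum_(i <- s | P i) h i) z = \sum_(i <- s | P i) comm (h i) z.
Proof. by rewrite /comm mulr_suml mulr_sumr -sumrB. Qed.

Lemma comm_sumr (T : Type) (s : seq T) (P : pred T) (h : T -> A) z :
  comm z (\sum_(i <- s | P i) h i) = \sum_(i <- s | P i) comm z (h i).
Proof. by rewrite /comm mulr_suml mulr_sumr -sumrB. Qed.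
End Commutators.

(** ** From the relations between K_ij and Z_ij to those between D0, ..., D5 *)

Section RelationsFromBlocks.
Variables (F : numFieldType) (I c : F) (A : algType F).
Hypothesis II : I * I = -1.
Variable Jp : A -> Prop.
Hypothesis JpL : forall a u v, Jp u -> Jp v -> Jp (a *: u + v).
Hypothesis Jp0 : Jp 0.
Variables K Z : 'I_2 -> 'I_2 -> A.
Hypothesis K11 : K 1 1 = - K 0 0.

Definition dlt (i j : 'I_2) : F := (i == j)%:R.

Hypothesis KK : forall i j p q,
  Jp (comm (K i j) (K p q) - (dlt j p *: K i q - dlt i q *: K p j)).
Hypothesis KZ : forall i j p q,
  Jp (comm (K i j) (Z p q) - (dlt j p *: Z i q - dlt i q *: Z p j)).
Hypothesis ZZ : forall i j p q, Jp (comm (Z i j) (Z p q)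
  - (2^-1 *: acomm (K i q) (Z p j) - 2^-1 *: acomm (K p j) (Z i q)
     + c *: (dlt j p *: K i q - dlt i q *: K p j))).

(* The solution of K12 = - D0 - i D4, K21 = D0 - i D4, K11 = - i D5, Z11 = - D1,
   Z22 = - D2, Z12 = D3 + i Dsq, Z21 = D3 - i Dsq. *)
Definition blockD (j : 'I_7) : A := nth 0
  [:: (- 2^-1) *: K 0 1 + 2^-1 *: K 1 0;
      (-1) *: Z 0 0 + 0 *: Z 0 0;
      (-1) *: Z 1 1 + 0 *: Z 1 1;
      2^-1 *: Z 0 1 + 2^-1 *: Z 1 0;
      (I / 2) *: K 0 1 + (I / 2) *: K 1 0;
      I *: K 0 0 + 0 *: K 0 0;
      (- (I / 2)) *: Z 0 1 + (I / 2) *: Z 1 0] j.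

Let Jc x y v := Jp (comm x y - v).

Let JcC x y v : Jc x y v -> Jc y x (- v).
Proof.
by move=> Jv; rewrite /Jc commC -opprD -scaleN1r -[_ *: _]addr0; apply: JpL.
Qed.

Let JcL a b x y z v w : Jc x z v -> Jc y z w ->
  Jc (a *: x + b *: y) z (a *: v + b *: w).
Proof.
move=> Jv Jw; rewrite /Jc commL commZ opprD addrACA -!scalerBr.
by apply: JpL => //; rewrite -[_ *: _]addr0; apply: JpL.
Qed.

Let JcR a b x y z v w : Jc z x v -> Jc z y w ->
  Jc z (a *: x + b *: y) (a *: v + b *: w).
Proof.
move=> Jv Jw; rewrite /Jc commR commZr opprD addrACA -!scalerBr.
by apply: JpL => //; rewrite -[_ *: _]addr0; apply: JpL.
Qed.

Let JcE x y v w : Jc x y v -> v = w -> Jc x y w.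
Proof. by move=> Jv <-. Qed.

Let ZK i j p q : Jc (Z p q) (K i j) (- (dlt j p *: Z i q - dlt i q *: Z p j)).
Proof. by apply: JcC; apply: KZ. Qed.

Ltac block_rel := rewrite /blockD !inordK //=;
  eapply JcE; first (apply: JcL; apply: JcR;
    solve [exact: KK | exact: KZ | exact: ZK | exact: ZZ]);
  rewrite /dlt /= /acomm ?K11; nc_coefs F A; field: II.

Theorem blocks_projective r :
  r \in projective_relations c blockD -> Jp (r.1 - r.2).
Proof.
rewrite /projective_relations !inE.
do 20![case/orP=> [/eqP->|]; first by block_rel].
by move/eqP->; block_rel.
Qed.

(** The hypothesis on det Z is what remains of its vanishing when Z has rank one;
    symmetrizing the products gives the terms in D0^2 + D4^2 + D5^2. *)
Theorem blocks_extra : c = 4^-1 ->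
  Jp (Z 0 0 * Z 1 1 - Z 0 1 * Z 1 0
      - (2^-1 *: (K 0 1 * Z 1 0) - 2^-1 *: (K 1 0 * Z 0 1)
         + 2^-1 *: (Z 1 1 - Z 0 0) - 2^-1 *: (K 0 0 * (Z 0 0 + Z 1 1))
         - 4^-1 *: (K 0 0 * K 0 0) - 4^-1 *: (K 0 1 * K 1 0))) ->
  Jp (projective_extra blockD).
Proof.
move=> c4; set det := _ - _; move=> Jdet.
have lin a u v : Jp u -> Jp v -> Jp (a *: u + v) := @JpL a u v.
have := lin 1 _ _ Jdet (lin (- 2^-1) _ _ (ZZ 0 0 1 1) (lin 2^-1 _ _ (ZZ 0 1 1 0)
  (lin 4^-1 _ _ (KZ 0 1 1 0) (lin (- 4^-1) _ _ (KZ 1 0 0 1)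
  (lin (- 4^-1) _ _ (KZ 0 0 0 0) (lin (- 4^-1) _ _ (KZ 0 0 1 1)
  (lin (- 8^-1) _ _ (KK 0 1 1 0) Jp0))))))).
congr Jp; rewrite /projective_extra /blockD !inordK //= /det /dlt /acomm /comm /=.
by rewrite c4 ?K11 !expr2; nc_coefs F A; field: II.
Qed.
End RelationsFromBlocks.

(** ** The central element, from the relations alone *)

Definition pairs7 : seq (nat * nat) :=
  [:: (0, 1); (0, 2); (0, 3); (0, 4); (0, 5); (0, 6); (1, 2); (1, 3); (1, 4);
      (1, 5); (1, 6); (2, 3); (2, 4); (2, 5); (2, 6); (3, 4); (3, 5); (3, 6);
      (4, 5); (4, 6); (5, 6)]%N.

Lemma pairs7_ind (P : 'I_7 -> 'I_7 -> Prop) :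
  (forall i, P i i) -> (forall i j, P i j -> P j i) ->
  (forall p, p \in pairs7 -> P (inord p.1) (inord p.2)) -> forall i j, P i j.
Proof.
move=> Pd Ps Pp i j; wlog ij : i j / (i < j)%N => [W|].
  have [ij|ji|/val_inj->//] := ltngtP i j; [exact: W | exact/Ps/W].
rewrite -(inord_val i) -(inord_val j); apply: (Pp (i : nat, j : nat)).
case: i j ij => [i i7] [j j7] /=.
case: j j7 => [|[|[|[|[|[|[|//]]]]]]] _;
  by case: i i7 => [|[|[|[|[|[|[|//]]]]]]].
Qed.

Ltac find_relation R := first [ exact: (R 0%N isT) | exact: (R 1%N isT)
  | exact: (R 2%N isT) | exact: (R 3%N isT) | exact: (R 4%N isT) | exact: (R 5%N isT)
  | exact: (R 6%N isT) | exact: (R 7%N isT) | exact: (R 8%N isT) | exact: (R 9%N isT)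
  | exact: (R 10%N isT) | exact: (R 11%N isT) | exact: (R 12%N isT)
  | exact: (R 13%N isT) | exact: (R 14%N isT) | exact: (R 15%N isT)
  | exact: (R 16%N isT) | exact: (R 17%N isT) | exact: (R 18%N isT)
  | exact: (R 19%N isT) | exact: (R 20%N isT) ].

Section CentralFromRelations.
Variables (F : numFieldType) (c : F) (A : algType F) (Id : A -> Prop) (d : 'I_7 -> A).
Hypothesis Id_ideal : two_sided_ideal Id.
Hypothesis d_rel : forall r, r \in projective_relations c d -> Id (r.1 - r.2).

Let Jc x y v := Id (comm x y - v).

Let IdB f g : Id f -> Id g -> Id (f - g).
Proof. by case: Id_ideal => _ + _; apply. Qed.
Let Id_0 : Id 0. Proof. by case: Id_ideal. Qed.
Let IdN f : Id f -> Id (- f).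
Proof. by move=> If; rewrite -sub0r; apply: IdB. Qed.
Let IdD f g : Id f -> Id g -> Id (f + g).
Proof. by move=> If Ig; rewrite -[g]opprK; apply: IdB => //; apply: IdN. Qed.

Let JcC x y v : Jc x y v -> Jc y x (- v).
Proof.
by move=> /IdN; rewrite /Jc opprK [comm y x]commC; congr Id; rewrite opprB addrC.
Qed.

Let Jcc x : Jc x x 0.
Proof. by rewrite /Jc /comm subrr subr0. Qed.

Let JcX x y v : Jc x y v -> Jc (x ^+ 2) y (x * v + v * x).
Proof.
move=> Jv; rewrite /Jc.
have -> : comm (x ^+ 2) y - (x * v + v * x)
    = x * (comm x y - v) * 1 + 1 * (comm x y - v) * x.
  by rewrite /comm expr2; nc_coefs F A; ring.
by case: Id_ideal => _ _ IM; apply: IdD; apply: IM.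
Qed.

(** By the Leibniz rule, from the values of the commutators with the terms. *)
Lemma projective_central_comm j : Id (comm (projective_central d) (d j)).
Proof.
suff H v0 v1 v2 v4 v5 : Jc (d (inord 0)) (d j) v0 -> Jc (d (inord 1)) (d j) v1 ->
    Jc (d (inord 2)) (d j) v2 -> Jc (d (inord 4)) (d j) v4 ->
    Jc (d (inord 5)) (d j) v5 ->
    (d (inord 0) * v0 + v0 * d (inord 0)) + v1 + v2
      + (d (inord 4) * v4 + v4 * d (inord 4))
      + (d (inord 5) * v5 + v5 * d (inord 5)) = 0 ->
    Id (comm (projective_central d) (d j)).
  have R k : (k < 21)%N -> Id ((nth (0, 0) (projective_relations c d) k).1
      - (nth (0, 0) (projective_relations c d) k).2).
    by move=> k21; apply/d_rel/mem_nth.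
  rewrite -[j]inord_val in H *.
  case: j H => -[|[|[|[|[|[|[|//]]]]]]] j7 H; eapply H;
    try solve [exact: Jcc | find_relation R | apply: JcC; find_relation R];
  by rewrite /= /acomm; nc_coefs F A; field.
move=> J0 J1 J2 J4 J5 v0E.
have -> : comm (projective_central d) (d j)
    = (comm (d (inord 0) ^+ 2) (d j) - (d (inord 0) * v0 + v0 * d (inord 0)))
      + (comm (d (inord 1)) (d j) - v1) + (comm (d (inord 2)) (d j) - v2)
      + (comm (d (inord 4) ^+ 2) (d j) - (d (inord 4) * v4 + v4 * d (inord 4)))
      + (comm (d (inord 5) ^+ 2) (d j) - (d (inord 5) * v5 + v5 * d (inord 5))).
  apply/eqP; rewrite -subr_eq0 -v0E; apply/eqP.
  by rewrite /projective_central /comm !expr2; nc_coefs F A; ring.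
exact: (IdD (IdD (IdD (IdD (JcX J0) J1) J2) (JcX J4)) (JcX J5)).
Qed.
End CentralFromRelations.


(** ** The relations between K_ij and Z_ij *)

Section Blocks.
Variables (F : numClosedFieldType) (m : nat) (V : enveloping F m).
Local Notation A := (ualg V).
Local Notation e := (@uin F m V).

(* The images of the matrix units in the four blocks. *)
Definition kap (i j : 'I_2) : A := e (delta_mx (up m i) (up m j)).
Definition ar (i : 'I_2) (k : 'I_m) : A := e (delta_mx (up m i) (lo k)).
Definition al (k : 'I_m) (j : 'I_2) : A := e (delta_mx (lo k) (up m j)).
Definition ell (k l : 'I_m) : A := e (delta_mx (lo k) (lo l)).

(* tau and Lam belong to k0; subtracting the half trace makes Kmx an element
   of sl_2. *)
Definition tau : A := kap 0 0 + kap 1 1.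
Definition Lam : A := \sum_k ell k k.
Definition Kmx (i j : 'I_2) : A := kap i j - (dlt F i j / 2) *: tau.
Definition Zmx (i j : 'I_2) : A := 2^-1 *: \sum_k acomm (ar i k) (al k j).

(* The products in Zmx in one order only. *)
Definition Zord (i j : 'I_2) : A := \sum_k ar i k * al k j.

Let e_linear := @uin_linear F m V.
Let e0 : e 0 = 0.
Proof. by have := e_linear (-1) 0 0; rewrite scaler0 addr0 scaleN1r addNr. Qed.
Let eZ a x : e (a *: x) = a *: e x.
Proof. by rewrite -[a *: x]addr0 e_linear e0 addr0. Qed.
Let eD x y : e (x + y) = e x + e y.
Proof. by rewrite -[x]scale1r e_linear !scale1r. Qed.
Let eB x y : e (x - y) = e x - e y.
Proof. by rewrite addrC -scaleN1r e_linear scaleN1r addrC. Qed.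

Lemma comm_delta a b c d : comm (e (delta_mx a b)) (e (delta_mx c d))
  = (b == c)%:R *: e (delta_mx a d) - (d == a)%:R *: e (delta_mx c b).
Proof.
rewrite /comm -uin_bracket !mul_delta_mx_cond eB; congr (_ - _).
  by case: eqP; rewrite ?scale1r ?scale0r ?mulr1n ?mulr0n ?e0.
by case: eqP; rewrite ?scale1r ?scale0r ?mulr1n ?mulr0n ?e0.
Qed.

Let EE := (comm_delta, up_inj, lo_inj, up_lo, lo_up, scale0r, sub0r, subr0, oppr0).

Lemma comm_kap_kap i j p q :
  comm (kap i j) (kap p q) = dlt F j p *: kap i q - dlt F q i *: kap p j.
Proof. by rewrite /kap !EE. Qed.
Lemma comm_kap_ar p q i k : comm (kap p q) (ar i k) = dlt F q i *: ar p k.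
Proof. by rewrite /kap /ar !EE. Qed.
Lemma comm_kap_al p q k j : comm (kap p q) (al k j) = - (dlt F j p *: al k q).
Proof. by rewrite /kap /al !EE. Qed.
Lemma comm_ar_al i k l j :
  comm (ar i k) (al l j) = (k == l)%:R *: kap i j - dlt F j i *: ell l k.
Proof. by rewrite /ar /al !EE. Qed.
Lemma comm_ar_ar i k j l : comm (ar i k) (ar j l) = 0.
Proof. by rewrite /ar !EE. Qed.
Lemma comm_al_al i k j l : comm (al k i) (al l j) = 0.
Proof. by rewrite /al !EE. Qed.
Lemma comm_ell_ar k l i j : comm (ell k l) (ar i j) = - ((j == k)%:R *: ar i l).
Proof. by rewrite /ell /ar !EE. Qed.
Lemma comm_ell_al k l j q : comm (ell k l) (al j q) = (l == j)%:R *: al k q.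
Proof. by rewrite /ell /al !EE. Qed.
Lemma comm_ell_kap k l i j : comm (ell k l) (kap i j) = 0.
Proof. by rewrite /ell /kap !EE. Qed.

Let sum_one (k : 'I_m) (h : 'I_m -> A) : \sum_l (l == k)%:R *: h l = h k.
Proof.
rewrite (bigD1 k) //= eqxx scale1r big1 ?addr0 // => l /negPf->.
by rewrite scale0r.
Qed.
Let sum_one' (k : 'I_m) (h : 'I_m -> A) : \sum_l (k == l)%:R *: h l = h k.
Proof. by rewrite -[RHS](sum_one k h); apply: eq_bigr => l _; rewrite eq_sym. Qed.

Lemma comm_kap_Zord p q i j :
  comm (kap p q) (Zord i j) = dlt F q i *: Zord p j - dlt F j p *: Zord i q.
Proof.
rewrite /Zord comm_sumr !scaler_sumr -sumrB; apply: eq_bigr => k _.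
by rewrite commMr comm_kap_ar comm_kap_al mulrN -scalerAl -scalerAr.
Qed.

Lemma comm_ell_Zord k l i j : comm (ell k l) (Zord i j) = 0.
Proof.
rewrite /Zord comm_sumr.
under eq_bigr => h _ do rewrite commMr comm_ell_ar comm_ell_al mulNr
  -scalerAl -scalerAr addrC.
by rewrite sumrB (sum_one' l (fun h => ar i h * al k j))
  (sum_one k (fun h => ar i l * al h j)) subrr.
Qed.

Lemma ZmxE i j : Zmx i j
  = Zord i j - (m%:R / 2) *: kap i j + (dlt F i j / 2) *: Lam.
Proof.
have E k : acomm (ar i k) (al k j)
    = 2 *: (ar i k * al k j) - kap i j + dlt F i j *: ell k k.
  have := comm_ar_al i k k j; rewrite eqxx scale1r /comm /acomm /dlt [j == i]eq_sym => E.
  have -> : 2 *: (ar i k * al k j) - kap i j + (i == j)%:R *: ell k k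
      = 2 *: (ar i k * al k j) - (kap i j - (i == j)%:R *: ell k k).
    by nc_coefs F (ualg V); ring.
  by rewrite -E; nc_coefs F (ualg V); ring.
have -> : Zmx i j = 2^-1 *: (2 *: Zord i j - m%:R *: kap i j + dlt F i j *: Lam).
  rewrite /Zmx /Zord /Lam; congr (_ *: _).
  have -> : m%:R *: kap i j = \sum_(k < m) kap i j.
    by rewrite sumr_const card_ord scaler_nat.
  by rewrite !scaler_sumr -sumrB -big_split; apply: eq_bigr => k _; rewrite E.
by nc_coefs F (ualg V); field.
Qed.

Definition block_relation (c : F) i j p q : A :=
  2^-1 *: acomm (Kmx i q) (Zmx p j) - 2^-1 *: acomm (Kmx p j) (Zmx i q)
    + c *: (dlt F j p *: Kmx i q - dlt F i q *: Kmx p j).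

Let comm_tau_kap i j : comm tau (kap i j) = 0.
Proof.
rewrite /tau commD !comm_kap_kap /dlt.
by case: (ord2_cases i) => ->; case: (ord2_cases j) => -> /=; nc_coefs F (ualg V); ring.
Qed.

Let comm_tau_Zord i j : comm tau (Zord i j) = 0.
Proof.
rewrite /tau commD !comm_kap_Zord /dlt.
by case: (ord2_cases i) => ->; case: (ord2_cases j) => -> /=; nc_coefs F (ualg V); ring.
Qed.

Let comm_Lam_kap i j : comm Lam (kap i j) = 0.
Proof. by rewrite /Lam comm_suml big1 // => k _; apply: comm_ell_kap. Qed.

Let comm_Lam_Zord i j : comm Lam (Zord i j) = 0.
Proof. by rewrite /Lam comm_suml big1 // => k _; apply: comm_ell_Zord. Qed.

Let comm_tau_ell k l : comm tau (ell k l) = 0.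
Proof. by rewrite /tau commC commDr !comm_ell_kap addr0 oppr0. Qed.

Let comm_tau_Lam : comm tau Lam = 0.
Proof. by rewrite /Lam comm_sumr big1 // => k _; apply: comm_tau_ell. Qed.

Let Jk_ell (u : A) k l : Jk (u * ell k l).
Proof. by apply: Jk_e; apply: stabilizer_lo. Qed.

Let Jk_tau (u : A) : Jk (u * tau).
Proof.
rewrite /tau /kap -eD; apply: Jk_e; exists 1, 0.
by rewrite -up_block scale1r.
Qed.

Let JkD (u v : A) : Jk u -> Jk v -> Jk (u + v).
Proof. by rewrite -[u in u + v]scale1r => Ju Jv; apply: JkL. Qed.
Let JkZ a (u : A) : Jk u -> Jk (a *: u).
Proof. by rewrite -[a *: u]addr0 => Ju; exact: (JkL a Ju (Jk0 V)). Qed.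
Let Jk_sum (T : Type) (s : seq T) (h : T -> A) :
  (forall t, Jk (h t)) -> Jk (\sum_(t <- s) h t).
Proof. by move=> H; elim/big_ind: _ => //; exact: Jk0. Qed.

Let Jk_Lam (u : A) : Jk (u * Lam).
Proof. by rewrite /Lam mulr_sumr; apply: Jk_sum => k; apply: Jk_ell. Qed.

Let ar_kap_al i p j q :
  \sum_k ar i k * kap p j * al k q = kap p j * Zord i q - dlt F j i *: Zord p q.
Proof.
rewrite /Zord mulr_sumr scaler_sumr -sumrB; apply: eq_bigr => k _.
have := comm_kap_ar p j i k; rewrite /comm => E.
by rewrite mulrA scalerAl -E -mulrBl subKr.
Qed.

Let ar_ell_al i q :
  Jk (\sum_k \sum_l ar i k * ell k l * al l q - m%:R *: Zord i q).
Proof.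
have -> : \sum_k \sum_l ar i k * ell k l * al l q - m%:R *: Zord i q
    = \sum_k \sum_l ar i k * al l q * ell k l.
  rewrite /Zord scaler_sumr -sumrB; apply: eq_bigr => k _.
  have -> : m%:R *: (ar i k * al k q) = \sum_(l < m) ar i k * al k q.
    by rewrite sumr_const card_ord scaler_nat.
  rewrite -sumrB; apply: eq_bigr => l _.
  have := comm_ell_al k l l q; rewrite eqxx scale1r /comm => E.
  by rewrite -E mulrBr !mulrA opprB addrC subrK.
by apply: Jk_sum => k; apply: Jk_sum => l; apply: Jk_ell.
Qed.

(* The commutator of two quadratic elements is cubic; moving the factors in k0 to
   the right leaves products of the blocks and the linear terms. *)
Let comm_Zord i j p q : Jk (comm (Zord i j) (Zord p q)
  - (kap i q * Zord p j - kap p j * Zord i q + dlt F i j *: Zord p q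
     - dlt F p q *: Zord i j
     + m%:R *: (dlt F j p *: Zord i q - dlt F i q *: Zord p j))).
Proof.
have E : comm (Zord i j) (Zord p q)
    = - (\sum_k ar i k * kap p j * al k q)
      + dlt F j p *: (\sum_k \sum_l ar i k * ell k l * al l q)
      + \sum_k ar p k * kap i q * al k j
      - dlt F q i *: (\sum_k \sum_l ar p k * ell k l * al l j).
  have E4 (x1 y1 x2 y2 : A) : comm x1 x2 = 0 -> comm y1 y2 = 0 ->
      comm (x1 * y1) (x2 * y2) = - (x1 * comm x2 y1 * y2) + x2 * comm x1 y2 * y1.
    rewrite /comm => /eqP; rewrite subr_eq0 => /eqP x12 /eqP; rewrite subr_eq0 => /eqP y12.
    have -> : x2 * y2 * (x1 * y1) = x2 * (y2 * x1) * y1 by rewrite !mulrA.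
    have -> : x1 * y1 * (x2 * y2) = x1 * (y1 * x2) * y2 by rewrite !mulrA.
    have E1 : x1 * x2 * y1 * y2 = x2 * x1 * y2 * y1 by rewrite x12 -!mulrA y12.
    apply/eqP; rewrite -subr_eq0; apply/eqP.
    transitivity (x1 * x2 * y1 * y2 - x2 * x1 * y2 * y1); last by rewrite E1 subrr.
    by nc_coefs F (ualg V); ring.
  rewrite {1}/Zord comm_suml.
  have Ek k : comm (ar i k * al k j) (Zord p q)
      = - (ar i k * kap p j * al k q)
        + dlt F j p *: (\sum_l ar i k * ell k l * al l q)
        + ar p k * kap i q * al k j
        - dlt F q i *: (\sum_l ar p l * ell l k * al k j).
    rewrite /Zord comm_sumr (eq_bigr (fun l =>
        - ((l == k)%:R *: (ar i k * kap p j * al l q))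
        + dlt F j p *: (ar i k * ell k l * al l q)
        + (k == l)%:R *: (ar p l * kap i q * al k j)
        - dlt F q i *: (ar p l * ell l k * al k j))) => [|l _]; last first.
      rewrite E4 ?comm_ar_ar ?comm_al_al // !comm_ar_al.
      by nc_coefs F (ualg V); ring.
    rewrite sumrB !big_split /= sumrN -!scaler_sumr.
    by rewrite (sum_one k (fun l => ar i k * kap p j * al l q))
      (sum_one' k (fun l => ar p l * kap i q * al k j)).
  rewrite (eq_bigr _ (fun k _ => Ek k)) sumrB !big_split /= sumrN -!scaler_sumr.
  by congr (_ - _ *: _); rewrite exchange_big.
have J1 := ar_ell_al i q; have J2 := ar_ell_al p j.
have := JkL (dlt F j p) J1 (JkZ (- dlt F q i) J2); congr Jk.
rewrite E !ar_kap_al /dlt [i == q]eq_sym [i == j]eq_sym [p == q]eq_sym.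
by nc_coefs F (ualg V); ring.
Qed.

(** In terms of the symmetrized products the linear terms in Z cancel, and linear
    terms in K with the coefficient m^2 / 4 remain. *)
Theorem comm_Zmx i j p q :
  Jk (comm (Zmx i j) (Zmx p q) - block_relation ((m%:R) ^+ 2 / 4) i j p q).
Proof.
have expandL (x y z x' y' : A) a b b' :
    comm (x - a *: y + b *: z) (x' - a *: y' + b' *: z)
    = comm x x' + a *: (comm y' x - comm y x') + (a * a) *: comm y y'
      + b' *: (a *: comm z y - comm z x) + b *: (comm z x' - a *: comm z y').
  by rewrite /comm; nc_coefs F (ualg V); ring.
have expandR (k t x y z : A) a b b' :
    acomm (k - b *: t) (x - a *: y + b' *: z)
    = 2 *: (k * x) - comm k x - a *: (2 *: (k * y) - comm k y)
      + b' *: (2 *: (k * z) + comm z k) - b *: (2 *: (x * t) + comm t x)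
      + (a * b) *: (2 *: (y * t) + comm t y)
      - (b * b') *: (2 *: (z * t) + comm t z).
  by rewrite /comm /acomm; nc_coefs F (ualg V); ring.
have J0 := comm_Zord i j p q.
have J1 : Jk ((2^-1 * dlt F i q) *: (kap p j * Lam)
              - (2^-1 * dlt F p j) *: (kap i q * Lam)
              + (2^-1 * dlt F i q) *: (Zord p j * tau)
              - (2^-1 * dlt F p j) *: (Zord i q * tau)
              + (m%:R / 4 * dlt F p j) *: (kap i q * tau)
              - (m%:R / 4 * dlt F i q) *: (kap p j * tau)).
  by rewrite -!scaleNr; do !apply: JkD; apply: JkZ.
have := JkD J0 J1; congr Jk; apply/eqP; rewrite -subr_eq0; apply/eqP.
rewrite /block_relation !ZmxE /Kmx expandL !expandR.
rewrite !comm_Lam_kap !comm_Lam_Zord !comm_tau_kap !comm_tau_Zord !comm_tau_Lam.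
have Ek : kap i q * kap p j
    = kap p j * kap i q + (dlt F q p *: kap i j - dlt F j i *: kap p q).
  by rewrite -comm_kap_kap /comm addrC subrK.
rewrite !comm_kap_Zord !comm_kap_kap Ek /dlt.
rewrite (eq_sym q i) (eq_sym j p) (eq_sym j i) (eq_sym q p).
by nc_coefs F (ualg V); field.
Qed.

Lemma comm_Kmx i j p q :
  comm (Kmx i j) (Kmx p q) = dlt F j p *: Kmx i q - dlt F i q *: Kmx p j.
Proof.
have expand (k k' t : A) a a' : comm (k - a *: t) (k' - a' *: t)
    = comm k k' + a' *: comm t k - a *: comm t k'.
  by rewrite /comm; nc_coefs F (ualg V); ring.
rewrite /Kmx expand !comm_tau_kap comm_kap_kap /dlt (eq_sym q i) (eq_sym j p).
by nc_coefs F (ualg V); field.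
Qed.

Lemma comm_Kmx_Zmx i j p q :
  comm (Kmx i j) (Zmx p q) = dlt F j p *: Zmx i q - dlt F i q *: Zmx p j.
Proof.
have expand (k k' t x z : A) a b b' : comm (k - b *: t) (x - a *: k' + b' *: z)
    = comm k x - a *: comm k k' - b' *: comm z k - b *: comm t x
      + (a * b) *: comm t k' - (b * b') *: comm t z.
  by rewrite /comm; nc_coefs F (ualg V); ring.
rewrite !ZmxE /Kmx expand comm_tau_Zord comm_tau_kap comm_tau_Lam comm_Lam_kap.
rewrite comm_kap_kap comm_kap_Zord /dlt (eq_sym q i) (eq_sym p j).
by nc_coefs F (ualg V); field.
Qed.

Lemma Kmx11 : Kmx 1 1 = - Kmx 0 0.
Proof. by rewrite /Kmx /dlt /tau /=; nc_coefs F (ualg V); field. Qed.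

(* The value of det Z modulo U k0 when m = 1. *)
Definition det_lower_order : A :=
  2^-1 *: (Kmx 0 1 * Zmx 1 0) - 2^-1 *: (Kmx 1 0 * Zmx 0 1)
  + 2^-1 *: (Zmx 1 1 - Zmx 0 0) - 2^-1 *: (Kmx 0 0 * (Zmx 0 0 + Zmx 1 1))
  - 4^-1 *: (Kmx 0 0 * Kmx 0 0) - 4^-1 *: (Kmx 0 1 * Kmx 1 0).

Let Zord_det : m = 1%N ->
  Zord 0 0 * Zord 1 1 - Zord 0 1 * Zord 1 0
    = - (kap 1 0 * Zord 0 1) + Zord 1 1 + kap 1 1 * Zord 0 0 - Zord 0 0
      - Zord 0 0 * Lam.
Proof.
move=> m1; have [k kE] : exists k : 'I_m, forall l, l = k.
  have m0 : (0 < m)%N by rewrite m1.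
  exists (Ordinal m0) => l; apply/val_inj/eqP; rewrite -leqn0 -ltnS -[in X in (_ < X)%N]m1.
  exact: ltn_ord.
have sumk (h : 'I_m -> A) : \sum_l h l = h k.
  by rewrite (bigD1 k) //= big1 ?addr0 // => l; rewrite (kE l) eqxx.
rewrite /Zord /Lam !sumk.
have := comm_ar_al 1 k k 0; have := comm_ar_al 1 k k 1; have := comm_al_al 0 k 1 k.
have := comm_kap_ar 1 0 0 k; have := comm_kap_ar 1 1 0 k; have := comm_ell_al k k k 0.
rewrite /comm /dlt eqxx /= !scale1r !scale0r subr0.
set a0 := ar 0 k; set a1 := ar 1 k; set b0 := al k 0; set b1 := al k 1.
set x := kap 1 0; set y := kap 1 1; set l := ell k k => E1 E2 E3 E4 E5 E6.
have Z0 (u v : A) : u = v -> u - v = 0 by move=> ->; rewrite subrr.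
apply/eqP; rewrite -subr_eq0; apply/eqP.
transitivity (a0 * a1 * (b0 * b1 - b1 * b0 - 0)
  - a0 * (a1 * b0 - b0 * a1 - x) * b1
  + a0 * (a1 * b1 - b1 * a1 - (y - l)) * b0
  + (x * a0 - a0 * x - a1) * b1 - (y * a0 - a0 * y - 0) * b0
  - a0 * (l * b0 - b0 * l - b0)).
  by nc_coefs F (ualg V); ring.
by rewrite E1 E2 E3 E4 E5 E6 !subrr !mulr0 !mul0r !subr0 !addr0.
Qed.

(** For m = 1 every Z_ij is a product of two Lie algebra elements, and the
    determinant of Z vanishes in the symmetric algebra. *)
Theorem Zmx_det : m = 1%N ->
  Jk (Zmx 0 0 * Zmx 1 1 - Zmx 0 1 * Zmx 1 0 - det_lower_order).
Proof.
move=> m1; have base := Zord_det m1.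
have mF : m%:R = 1 :> F := congr1 (fun k => k%:R) m1.
pose s : A := 4^-1 *: tau - 2^-1 *: Lam.
have Js (u : A) : Jk (u * s).
  by rewrite mulrBr -!scalerAr -scaleNr; apply: JkD; apply: JkZ.
have ZE i j : Zord i j = Zmx i j + 2^-1 *: Kmx i j + dlt F i j *: s.
  by rewrite ZmxE /Kmx /s mF; nc_coefs F (ualg V); field.
have kE i j : kap i j = Kmx i j + (dlt F i j / 2) *: tau by rewrite /Kmx subrK.
have comm_s_K i j : comm s (Kmx i j) = 0.
  have expand (t l k : A) a b d : comm (a *: t - b *: l) (k - d *: t)
      = a *: comm t k - b *: comm l k - (b * d) *: comm t l.
    by rewrite /comm; nc_coefs F (ualg V); ring.
  by rewrite /s /Kmx expand comm_tau_kap comm_Lam_kap comm_tau_Lam !scaler0 !subr0.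
have comm_t_K i j : comm tau (Kmx i j) = 0.
  by rewrite /Kmx -scaleNr commDr commZr comm_tau_kap /comm subrr scaler0 addr0.
have comm_s_Z i j : comm s (Zmx i j) = 0.
  have expand (t l z k : A) a b d d' : comm (a *: t - b *: l) (z - d *: k + d' *: l)
      = a *: comm t z - (a * d) *: comm t k + (a * d') *: comm t l
        - b *: comm l z + (b * d) *: comm l k.
    by rewrite /comm; nc_coefs F (ualg V); ring.
  rewrite /s ZmxE expand comm_tau_Zord comm_tau_kap comm_tau_Lam.
  by rewrite comm_Lam_Zord comm_Lam_kap !scaler0 !subr0 !addr0.
have comm_t_Z i j : comm tau (Zmx i j) = 0.
  rewrite ZmxE -scaleNr !commDr !commZr comm_tau_Zord comm_tau_kap comm_tau_Lam.
  by rewrite !scaler0 !addr0.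
have comm_t_s : comm tau s = 0.
  by rewrite /s -scaleNr commDr !commZr comm_tau_Lam /comm subrr !scaler0 addr0.
set X := Zmx 0 0 + 2^-1 *: Kmx 0 0; set Y := Zmx 1 1 + 2^-1 *: Kmx 1 1.
have JT : Jk (- 1 *: (X * s + (Y * s + (s * s + ((- Kmx 1 1) * s
    + (((- 2^-1) *: X) * tau + (((- 2^-1) *: s) * tau + (X * Lam + s * Lam)))))))).
  by apply: JkZ; do !apply: JkD.
move: JT; congr Jk; apply/eqP; rewrite -subr_eq0; apply/eqP.
move/eqP: base; rewrite -subr_eq0 => /eqP base.
rewrite !ZE !kE in base; rewrite /X /Y.
have comms : [/\ comm s (Zmx 1 1) = 0, comm s (Kmx 1 1) = 0,
   comm tau (Zmx 0 0) = 0, comm tau (Kmx 0 0) = 0 & comm tau s = 0] by split.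
case: comms => c1 c2 c3 c4 c5.
have := comm_Kmx_Zmx 0 0 0 0; have := comm_Kmx_Zmx 1 0 0 1; have := comm_Kmx 0 1 1 0.
move: base c1 c2 c3 c4 c5; rewrite /det_lower_order Kmx11 /dlt /=.
set t := tau; set L := Lam; set k := Kmx 0 0; set k01 := Kmx 0 1; set k10 := Kmx 1 0.
set z00 := Zmx 0 0; set z01 := Zmx 0 1; set z10 := Zmx 1 0; set z11 := Zmx 1 1.
set b := (X in X = 0 -> _) => base0 c1 c2 c3 c4 c5 h1 h2 h3.
transitivity (- (b - 2^-1 *: (comm k10 z01 - (1 *: z11 - 1 *: z00))
    + 2^-1 *: (comm k01 k10 - (1 *: k - 1 *: - k)) 
    - 2^-1 *: (comm k z00 - (1 *: z00 - 1 *: z00))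
    - comm s z11 - 2^-1 *: comm s (- k) + 2^-1 *: comm t z00 + 4^-1 *: comm t k
    + 2^-1 *: comm t s)).
  by rewrite /b /comm /=; nc_coefs F (ualg V); field.
rewrite base0 c1 c2 c3 c4 c5 h1 h2 h3 !subrr !scaler0.
by rewrite !subr0 !addr0 oppr0.
Qed.

(** Elements of the stabilizer are combinations of tau and of the lower right
    matrix units, which commute with the blocks. *)
Lemma stabilizer_comm x i j : stabilizer x ->
  comm (e x) (Kmx i j) = 0 /\ comm (e x) (Zmx i j) = 0.
Proof.
move=> [a [u ->]].
have -> : block_mx a%:M 0 0 u = block_mx a%:M 0 0 0 + block_mx 0 0 0 u :> 'M_(2 + m).
  by rewrite add_block_mx !addr0 add0r.
rewrite eD -up_block eZ eD -/(kap _ _) -/(kap _ _) -/tau.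
have [tK tZ] : comm tau (Kmx i j) = 0 /\ comm tau (Zmx i j) = 0.
  split.
    by rewrite /Kmx -scaleNr commDr commZr comm_tau_kap /comm subrr scaler0 addr0.
  rewrite ZmxE -scaleNr !commDr !commZr comm_tau_Zord comm_tau_kap comm_tau_Lam.
  by rewrite !scaler0 !addr0.
have [uK uZ] : comm (e (block_mx 0 0 0 u)) (Kmx i j) = 0
    /\ comm (e (block_mx 0 0 0 u)) (Zmx i j) = 0.
  rewrite (matrix_sum_delta u).
  have Q0 : comm (e (block_mx 0 0 0 0)) (Kmx i j) = 0
      /\ comm (e (block_mx 0 0 0 0)) (Zmx i j) = 0.
    by rewrite block_mx0 e0 /comm !mul0r !mulr0 subrr.
  have QD u1 u2 : comm (e (block_mx 0 0 0 u1)) (Kmx i j) = 0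
        /\ comm (e (block_mx 0 0 0 u1)) (Zmx i j) = 0 ->
      comm (e (block_mx 0 0 0 u2)) (Kmx i j) = 0
        /\ comm (e (block_mx 0 0 0 u2)) (Zmx i j) = 0 ->
      comm (e (block_mx 0 0 0 (u1 + u2))) (Kmx i j) = 0
        /\ comm (e (block_mx 0 0 0 (u1 + u2))) (Zmx i j) = 0.
    move=> [K1 Z1] [K2 Z2].
    have -> : block_mx 0 0 0 (u1 + u2)
        = block_mx 0 0 0 u1 + block_mx 0 0 0 u2 :> 'M[F]_(2 + m).
      by rewrite add_block_mx !addr0.
    by rewrite eD !commD K1 K2 Z1 Z2 addr0.
  elim/big_ind: _ => [//|u1 u2|k _]; first exact: QD.
  elim/big_ind: _ => [//|u1 u2|l _]; first exact: QD.
  have -> : block_mx 0 0 0 (u k l *: delta_mx k l)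
      = u k l *: delta_mx (lo k) (lo l) :> 'M[F]_(2 + m).
    by rewrite delta_lo_lo scale_block_mx !scaler0.
  have tE : comm (ell k l) tau = 0 by rewrite commC comm_tau_ell oppr0.
  have LE : comm (ell k l) Lam = 0.
    rewrite commC /Lam comm_suml.
    under eq_bigr => h _ do rewrite /ell comm_delta !lo_inj.
    rewrite sumrB (sum_one k (fun h => ell h l)) (sum_one' l (fun h => ell k h)).
    by rewrite subrr oppr0.
  have KE : comm (ell k l) (Kmx i j) = 0.
    by rewrite /Kmx -scaleNr commDr commZr comm_ell_kap tE scaler0 addr0.
  have ZE : comm (ell k l) (Zmx i j) = 0.
    by rewrite ZmxE -scaleNr !commDr !commZr comm_ell_Zord comm_ell_kap LE !scaler0 !addr0.
  by rewrite eZ !commZ KE ZE !scaler0.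
by rewrite !commD !commZ tK tZ uK uZ !scaler0 !addr0.
Qed.
End Blocks.

(** * The enveloping algebra of su(m + 2) *)

Local Open Scope complex_scope.
Local Open Scope sesquilinear_scope.

Section ComplexifiedUnitary.
Variables (R : realType) (m : nat).
Local Notation C := R[i].
Local Notation M := 'M[C]_m.+2.
Local Notation g := (su R m.+2).
Local Notation Ug :=
  (uea (real_complex R : {rmorphism R -> C}) (@su_bracket R m.+2)).
Local Notation env := (@env R m.+1).

Lemma imul2 : 'i%C * 'i%C = -1 :> C.
Proof. by rewrite -expr2 sqr_i. Qed.

Lemma adj_i (x : M) : (- 'i%C *: x) ^t* = 'i%C *: x ^t*.
Proof.
apply/matrixP => i j; rewrite !mxE rmorphM; congr (_ * _).
by apply/eqP; rewrite eq_complex /= oppr0 opprK !eqxx.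
Qed.

Definition traceless (x : M) : M := x - (\tr x / m.+2%:R)%:M.

Lemma traceless_linear a x y :
  traceless (a *: x + y) = a *: traceless x + traceless y.
Proof.
rewrite /traceless mxtraceD mxtraceZ mulrDl -mulrA raddfD /= scalerBr.
by rewrite scale_scalar_mx opprD addrACA.
Qed.

Lemma tr_traceless x : \tr (traceless x) = 0.
Proof.
have n0 : m.+2%:R != 0 :> C by rewrite pnatr_eq0.
by rewrite /traceless raddfB /= mxtrace_scalar -[X in _ - X]mulr_natr mulfVK ?subrr.
Qed.

Lemma su_part_subproof x :
  2^-1 *: (traceless x - (traceless x) ^t*) \in @su_pred R m.+2.
Proof.
have := tr_traceless x; move: (traceless x) => y y0.
apply/su_predP; split.
  rewrite linearZ /= map_mxZ raddfB /= map_mxB trmxCK fmorphV rmorph_nat.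
  by rewrite -scalerN opprB.
rewrite mxtraceZ raddfB /= trace_map_mx mxtrace_tr y0.
by rewrite rmorph0 subrr mulr0.
Qed.

Definition su_part x : g := Su (su_part_subproof x).

Lemma su_partE x : su_part x = 2^-1 *: (traceless x - (traceless x) ^t*) :> M.
Proof. by []. Qed.

Lemma su_part_linear (a : R) x y :
  su_part (a%:C *: x + y) = a *: su_part x + su_part y.
Proof.
apply: val_inj; rewrite /= [RHS]/(a%:C *: su_mx (su_part x) + su_mx (su_part y)).
rewrite !su_partE traceless_linear.
have -> (u v : M) : (a%:C *: u + v) ^t* = a%:C *: u ^t* + v ^t*.
  apply/matrixP => i j; rewrite !mxE rmorphD rmorphM; congr (_ * _ + _).
  exact: conjc_real.
by rewrite opprD addrACA -scalerBr scalerDr !scalerA [2^-1 * _]mulrC.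
Qed.

Fact gl_in_key : unit. Proof. by []. Qed.

(* The C-linear extension of the inclusion of su(m + 2), extended by 0 to the
   scalar matrices. *)
Definition gl_in : M -> Ug := locked_with gl_in_key (fun x =>
  env (su_part x) + 'i%C *: env (su_part (- 'i%C *: x))).

Lemma gl_inE x : gl_in x
  = env (su_part x) + 'i%C *: env (su_part (- 'i%C *: x)).
Proof. by rewrite /gl_in locked_withE. Qed.

Lemma envL (a : R) x y : env (a *: x + y) = a%:C *: env x + env y.
Proof. exact: uea_in_linear. Qed.

Lemma env_bracket x y : env (su_bracket x y) = env x * env y - env y * env x.
Proof. exact: uea_in_bracket. Qed.

Lemma env0 : env 0 = 0.
Proof. by have := envL (-1) 0 0; rewrite scaler0 addr0 rmorphN1 scaleN1r addNr. Qed.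

Lemma envN x : env (- x) = - env x.
Proof. by have := envL (-1) x 0; rewrite scaleN1r !addr0 rmorphN1 scaleN1r env0 addr0. Qed.

Lemma gl_in_linear a x y : gl_in (a *: x + y) = a *: gl_in x + gl_in y.
Proof.
have realL (b : R) u v : gl_in (b%:C *: u + v) = b%:C *: gl_in u + gl_in v.
  have E : - 'i%C *: (b%:C *: u + v) = b%:C *: (- 'i%C *: u) + - 'i%C *: v :> M.
    by rewrite scalerDr scalerA mulrC -scalerA.
  rewrite !gl_inE E !su_part_linear !envL !scalerDr addrACA.
  by rewrite !scalerA [_ * b%:C]mulrC.
have iE u : gl_in ('i%C *: u) = 'i%C *: gl_in u.
  have nn : su_part ('i%C *: u) = - su_part (- 'i%C *: u).
    have z : su_part 0 = 0.
      by have := su_part_linear (-1) 0 0; rewrite scaler0 addr0 scaleN1r addNr.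
    have := su_part_linear (-1) (- 'i%C *: u) 0.
    by rewrite z !addr0 rmorphN1 !scaleN1r scaleNr opprK.
  rewrite !gl_inE scalerA mulNr imul2 opprK scale1r nn envN.
  by rewrite scalerDr scalerA imul2 scaleN1r addrC.
have rL (b : R) u : gl_in (b%:C *: u) = b%:C *: gl_in u.
  have z : gl_in 0 = 0.
    by have := realL (-1) 0 0; rewrite scaler0 addr0 rmorphN1 scaleN1r addNr.
  by have := realL b u 0; rewrite z !addr0.
have -> : a *: x + y = (complex.Re a)%:C *: x + ('i%C *: ((complex.Im a)%:C *: x) + y).
  by rewrite {1}[a]complexE scalerDl scalerA addrA.
rewrite realL -['i%C *: _ in LHS]scale1r -(rmorph1 (real_complex R)) realL.
by rewrite rmorph1 scale1r iE rL scalerA addrA -scalerDl -complexE.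
Qed.

Lemma gl_in0 : gl_in 0 = 0.
Proof. by have := gl_in_linear (-1) 0 0; rewrite scaler0 addr0 scaleN1r addNr. Qed.

Lemma su_part_su (x : g) : su_part x = x.
Proof.
have /su_predP[xH x0] := su_mxP x; apply: val_inj; rewrite /= /traceless x0.
rewrite mul0r raddf0 subr0 xH opprK -mulr2n -[X in _ *: X]scaler_nat.
by rewrite scalerA mulVf ?scale1r // pnatr_eq0.
Qed.

Lemma su_part_isu (x : g) : su_part (- 'i%C *: su_mx x) = 0.
Proof.
have /su_predP[xH x0] := su_mxP x; apply: val_inj => /=.
rewrite /traceless mxtraceZ x0 mulr0 mul0r raddf0 subr0 adj_i xH.
by rewrite scaleNr scalerN opprK addNr scaler0.
Qed.

Lemma gl_in_su (x : g) : gl_in x = env x.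
Proof. by rewrite gl_inE su_part_su su_part_isu env0 scaler0 addr0. Qed.

Lemma gl_in1 : gl_in 1%:M = 0.
Proof.
have t1 a : traceless (a *: 1%:M) = 0.
  rewrite /traceless mxtraceZ mxtrace1 mulfK ?pnatr_eq0 // scale_scalar_mx mulr1.
  exact: subrr.
have p1 a : su_part (a *: 1%:M) = 0.
  by apply: val_inj; rewrite /= t1 trmx0 map_mx0 subrr scaler0.
by rewrite gl_inE -{1}[1%:M]scale1r !p1 env0 scaler0 addr0.
Qed.

Lemma su_decomposition (x : M) :
  x = su_mx (su_part x) + 'i%C *: su_mx (su_part (- 'i%C *: x))
      + (\tr x / m.+2%:R) *: 1%:M.
Proof.
rewrite !su_partE.
have -> : traceless (- 'i%C *: x) = - 'i%C *: traceless x.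
  have t0 : traceless 0 = 0 by rewrite /traceless mxtrace0 mul0r raddf0 subrr.
  by rewrite -[_ *: x]addr0 traceless_linear t0 addr0.
set y := traceless x; have E : x = y + (\tr x / m.+2%:R) *: 1%:M.
  by rewrite /y /traceless scale_scalar_mx mulr1 subrK.
rewrite {1}E; congr (_ + _).
rewrite adj_i.
have II := imul2; apply/matrixP => i j; rewrite !mxE; field: II.
by rewrite -natrD pnatr_eq0.
Qed.

Lemma su_ind (Q : M -> Prop) :
  (forall a x y, Q x -> Q y -> Q (a *: x + y)) ->
  (forall x : g, Q x) -> Q 1%:M -> forall x, Q x.
Proof.
move=> QL Qg Q1 x; rewrite (su_decomposition x) addrC; apply: (QL) => //.
by rewrite addrC; apply: QL.
Qed.

Lemma gl_in_bracket x y :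
  gl_in (x *m y - y *m x) = gl_in x * gl_in y - gl_in y * gl_in x.
Proof.
elim/su_ind: x => [a x x' IHx IHx'|x|].
- have -> : (a *: x + x') *m y - y *m (a *: x + x')
      = a *: (x *m y - y *m x) + (x' *m y - y *m x').
    by rewrite mulmxDl mulmxDr -scalemxAl -scalemxAr opprD addrACA -scalerBr.
  rewrite !gl_in_linear IHx IHx'; exact/esym/commL.
- elim/su_ind: y => [a y y' IHy IHy'|y|].
  + have -> : su_mx x *m (a *: y + y') - (a *: y + y') *m x
        = a *: (su_mx x *m y - y *m x) + (su_mx x *m y' - y' *m x).
      by rewrite mulmxDl mulmxDr -scalemxAl -scalemxAr opprD addrACA -scalerBr.
    rewrite !gl_in_linear IHy IHy'; exact/esym/commR.
  + by rewrite -[_ - _]/(su_mx (su_bracket x y)) !gl_in_su env_bracket.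
  + by rewrite mulmx1 mul1mx subrr gl_in1 mulr0 mul0r subrr gl_in0.
by rewrite mulmx1 mul1mx subrr gl_in1 mulr0 mul0r subrr gl_in0.
Qed.

Local Notation P := {mpoly C[#|{: bool * 'I_(2 + m) * 'I_(2 + m)}|]}.

Definition su_act : Ug -> lendo P := uea_lift (fun x : g => dop (x : 'M[C]_(2 + m))).

Let act_linear (a : R) (x y : g) : dop (su_mx (a *: x + y) : 'M[C]_(2 + m))
  = a%:C *: dop (x : 'M[C]_(2 + m)) + dop (y : 'M[C]_(2 + m)).
Proof. exact: dop_linear. Qed.

Let act_bracket (x y : g) : dop (su_mx (su_bracket x y) : 'M[C]_(2 + m))
  = dop (x : 'M[C]_(2 + m)) * dop (y : 'M[C]_(2 + m))
    - dop (y : 'M[C]_(2 + m)) * dop (x : 'M[C]_(2 + m)).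
Proof. exact: dop_bracket. Qed.

Lemma su_act_gl x : su_act (gl_in x) = dop (x : 'M[C]_(2 + m)).
Proof.
have actL a u v : su_act (a *: u + v) = a *: su_act u + su_act v.
  exact: (uea_lift_linear act_linear act_bracket).
elim/su_ind: x => [a x y IHx IHy|x|].
- by rewrite gl_in_linear actL dop_linear; congr (_ *: _ + _).
- by rewrite gl_in_su; apply: (uea_lift_in act_linear act_bracket).
- rewrite gl_in1 [RHS]dop_scalar.
  by have := actL (-1) 0 0; rewrite scaler0 addr0 scaleN1r addNr.
Qed.

Definition su_enveloping : enveloping C m :=
  @Enveloping C m Ug gl_in gl_in_linear gl_in_bracket su_act
    (uea_lift_linear act_linear act_bracket) (uea_liftM act_linear act_bracket)
    (uea_lift1 act_linear act_bracket) su_act_gl.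

Lemma su_fil (u : ualg su_enveloping) : exists d, Fil d u.
Proof.
elim/uea_words_ind: u => [|a u v [d Fu] [d' Fv]|s].
- by exists 0%N; exact: Fil0.
- exists (maxn d d'); apply: FilL.
    by apply: Fil_le Fu; apply: leq_maxl.
  by apply: Fil_le Fv; apply: leq_maxr.
exists (size s).+1.
have -> : \prod_(x <- s) uea_in (real_complex R : {rmorphism R -> C}) (@su_bracket R m.+2) x
    = word su_enveloping [seq su_mx x | x <- s].
  by rewrite /word big_map; apply: eq_bigr => x _; rewrite /= gl_in_su.
by apply: FilW; rewrite size_map.
Qed.
End ComplexifiedUnitary.

(** * The adjoint action of K0 *)

Local Open Scope complex_scope.
Local Open Scope sesquilinear_scope.

Lemma up_inord m (i : 'I_2) : inord i = up m i :> 'I_m.+2.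
Proof. by apply: val_inj; rewrite /= inordK // (leq_trans (ltn_ord i)). Qed.
Section Stabilizer.
Variables (R : realType) (m : nat).
Local Notation C := R[i].

Lemma diag_stabilizer (x : 'M[C]_m.+2) :
  @diag_aaU R m.+1 x <-> stabilizer (x : 'M[C]_(2 + m)).
Proof.
have E0 := up_inord m 0; have E1 := up_inord m 1.
split=> [[x01 x0]|[a [u xE]]].
  exists (x (up m 0) (up m 0)), (drsubmx (x : 'M[C]_(2 + m))).
  apply/matrixP => i j.
  case: (split_ordP i) => {}i ->; case: (split_ordP j) => {}j ->.
  - rewrite block_mxEul -!/(up m _) mxE.
    have [->|ij] := eqVneq i j; last by apply: x0; rewrite ?up_inj //= ltn_ord.
    by case: (ord2_cases j) => -> //; rewrite -E0 -E1.
  - rewrite block_mxEur -!/(up m _) -!/(lo _) mxE.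
    by apply: x0; rewrite ?up_lo //= ltn_ord.
  - rewrite block_mxEdl -!/(up m _) -!/(lo _) mxE.
    by apply: x0; rewrite ?lo_up //= ltn_ord orbT.
  - by rewrite block_mxEdr mxE [in RHS]mxE.
have {}xE (i j : 'I_(2 + m)) : x i j = (block_mx a%:M 0 0 u : 'M[C]_(2 + m)) i j.
  by rewrite xE.
have xu i j : x (up m i) (up m j) = a *+ (i == j).
  by rewrite xE /up block_mxEul mxE.
have xul i k : x (up m i) (lo k) = 0 by rewrite xE /up /lo block_mxEur mxE.
have xlu i k : x (lo k) (up m i) = 0 by rewrite xE /up /lo block_mxEdl mxE.
split; first by rewrite E0 E1 !xu.
move=> i j; case: (@split_ordP 2 m i) => {}i ->; case: (@split_ordP 2 m j) => {}j ->.
- by rewrite -!/(up m _) up_inj xu => /negPf->.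
- by rewrite -!/(up m _) -!/(lo _) xul.
- by rewrite -!/(up m _) -!/(lo _) xlu.
- by [].
Qed.

Lemma stabilizer_su_part (x : 'M[C]_m.+2) :
  stabilizer (x : 'M[C]_(2 + m)) -> k0 (su_part x).
Proof.
move=> /diag_stabilizer[x01 x0].
have E i j : su_part x i j = 2^-1 * ((x i j - (\tr x / m.+2%:R) *+ (i == j))
    - Num.conj (x j i - (\tr x / m.+2%:R) *+ (j == i))).
  by rewrite su_partE !mxE.
split; first by rewrite !E !eqxx x01.
move=> i j ij ij2; rewrite E x0 // x0 1?orbC //; last by rewrite eq_sym.
by rewrite [j == i]eq_sym (negPf ij) !subr0 rmorph0 subr0 mulr0.
Qed.

Local Notation V := (su_enveloping R m).

(** The complex left ideal is generated by the real Lie algebra k0, because the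
    anti-Hermitian parts of a stabilizing matrix stabilize. *)
Lemma left_ideal_Jk (u : ualg V) : Jk u <-> @left_ideal_k0 R m.+1 u.
Proof.
split=> [[s [sP ->]]|[s [sP ->]]].
  rewrite big_seq; elim/big_ind: _ => [|x y [s1 [P1 ->]] [s2 [P2 ->]]|[v x] ps].
  - by exists [::]; rewrite big_nil.
  - exists (s1 ++ s2); rewrite big_cat; split=> // p.
    by rewrite mem_cat => /orP[/P1|/P2].
  have xs := sP _ ps; rewrite /= in xs *.
  exists [:: (v, su_part x); ('i%C *: v, su_part (- 'i%C *: x))].
  split=> [p|]; last by rewrite big_cons big_seq1 /= gl_inE mulrDr -scalerAl -scalerAr.
  rewrite !inE => /orP[] /eqP-> /=; apply: stabilizer_su_part => //.
  case: xs => a [w ->]; exists (- 'i%C * a), (- 'i%C *: w).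
  by rewrite scale_block_mx !scaler0 scale_scalar_mx.
exists [seq (p.1, su_mx p.2 : 'M[C]_(2 + m)) | p <- s]; split=> [p|].
  by move=> /mapP[q /sP qs ->]; apply/diag_stabilizer.
by rewrite big_map; apply: eq_bigr => p _; rewrite /= gl_in_su.
Qed.
End Stabilizer.

Section AdjointAction.
Variables (R : realType) (m : nat).
Local Notation C := R[i].
Local Notation G := 'M[C]_m.+2.
Local Notation V := (su_enveloping R m).
Local Notation Ad := (@Ad R m.+1).
Local Notation K0 := (@K0 R m.+1).

Section OneElement.
Variable k : G.
Hypothesis kU : k \is unitarymx.

Let v_linear (a : R) x y : env (su_conj k (a *: x + y))
  = a%:C *: env (su_conj k x) + env (su_conj k y).
Proof. by rewrite su_conj_linear // envL. Qed.

Let v_bracket x y : env (su_conj k (su_bracket x y))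
  = env (su_conj k x) * env (su_conj k y) - env (su_conj k y) * env (su_conj k x).
Proof. by rewrite su_conj_bracket // env_bracket. Qed.

Lemma AdL a u v : Ad k (a *: u + v) = a *: Ad k u + Ad k v.
Proof. exact: (uea_lift_linear v_linear v_bracket). Qed.

Lemma AdM u v : Ad k (u * v) = Ad k u * Ad k v.
Proof. exact: (uea_liftM v_linear v_bracket). Qed.

Lemma Ad1 : Ad k 1 = 1.
Proof. exact: (uea_lift1 v_linear v_bracket). Qed.

Lemma Ad0 : Ad k 0 = 0.
Proof. by have := AdL (-1) 0 0; rewrite scaler0 addr0 scaleN1r addNr. Qed.

Lemma AdZ a u : Ad k (a *: u) = a *: Ad k u.
Proof. by have := AdL a u 0; rewrite Ad0 !addr0. Qed.

Lemma AdD u v : Ad k (u + v) = Ad k u + Ad k v.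
Proof. by have := AdL 1 u v; rewrite !scale1r. Qed.

Lemma AdB u v : Ad k (u - v) = Ad k u - Ad k v.
Proof. by rewrite addrC -scaleN1r AdL scaleN1r addrC. Qed.

Lemma Ad_sum (T : Type) (s : seq T) h :
  Ad k (\sum_(t <- s) h t) = \sum_(t <- s) Ad k (h t).
Proof. exact: (big_morph _ AdD Ad0). Qed.

Lemma Ad_gl x : Ad k (gl_in x) = gl_in (k *m x *m invmx k).
Proof.
elim/su_ind: x => [a x y IHx IHy|x|].
- rewrite gl_in_linear AdL IHx IHy mulmxDr mulmxDl -scalemxAr -scalemxAl.
  by rewrite gl_in_linear.
- rewrite gl_in_su -su_conjE // gl_in_su.
  exact: (uea_lift_in v_linear v_bracket).
- by rewrite mulmx1 mulmxV ?unitarymx_unit // gl_in1 Ad0.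
Qed.

Lemma Ad_word (s : seq 'M[C]_(2 + m)) :
  Ad k (word V s) = word V [seq k *m x *m invmx k | x <- s].
Proof.
elim: s => [|x s IH]; first by rewrite !word_nil Ad1.
by rewrite /word big_cons AdM -/(word V s) IH Ad_gl /word big_cons.
Qed.
End OneElement.

Lemma K0_block k : K0 k -> exists a U,
  [/\ a != 0, U \in unitmx, k = block_mx a%:M 0 0 U :> 'M[C]_(2 + m)
    & invmx k = block_mx a^-1%:M 0 0 (invmx U) :> 'M[C]_(2 + m)].
Proof.
move=> [kU dk /diag_stabilizer[a [U kE]]]; exists a, U.
have d1 : a ^+ 2 * \det U = 1.
  by rewrite -dk kE (det_lblock (a%:M : 'M[C]_2) 0 U) det_scalar.
have a0 : a != 0.
  by apply: contra_eqN d1 => /eqP->; rewrite expr0n mul0r eq_sym oner_neq0.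
have U1 : U \in unitmx.
  rewrite unitmxE unitfE; apply: contra_eqN d1 => /eqP->.
  by rewrite mulr0 eq_sym oner_neq0.
pose l : 'M[C]_(2 + m) := block_mx a^-1%:M 0 0 (invmx U).
have kk : (k : 'M[C]_(2 + m)) *m l = 1%:M.
  rewrite {1}kE mulmx_block !mul0mx !mulmx0 !addr0 !add0r mulmxV //.
  by rewrite -scalar_mxM mulfV // -scalar_mx_block.
have {}kk : k *m (l : G) = 1%:M := kk.
have lE : invmx (k : G) = l.
  by rewrite -[invmx _]mulmx1 -kk mulmxA mulVmx ?mul1mx ?unitarymx_unit.
by split.
Qed.

Section BlockForm.
Variables (k l : 'M[C]_(2 + m)) (a : C) (U U' : 'M[C]_m).
Hypotheses (a0 : a != 0) (UU : U *m U' = 1%:M).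
Hypotheses (kE : k = block_mx a%:M 0 0 U) (lE : l = block_mx a^-1%:M 0 0 U').

Let mulk (p q s t : 'I_(2 + m)) : (k *m delta_mx p q) s t = k s p *+ (t == q).
Proof.
rewrite mxE (bigD1 p) //= big1 => [|i /negPf ip]; last by rewrite mxE ip mulr0.
by rewrite mxE eqxx addr0 mulr_natr.
Qed.

Let mull (p q s t : 'I_(2 + m)) : (delta_mx p q *m l) s t = l q t *+ (s == p).
Proof.
rewrite mxE (bigD1 q) //= big1 => [|i /negPf iq].
  by rewrite mxE eqxx andbT addr0 mulr_natl.
by rewrite mxE iq andbF mul0r.
Qed.

Lemma block_delta_up i (q : 'I_(2 + m)) :
  k *m delta_mx (up m i) q = a *: delta_mx (up m i) q.
Proof.
apply/matrixP => s t; rewrite mulk !mxE kE.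
case: (split_ordP s) => {}s ->.
  rewrite block_mxEul mxE -!/(up m _) up_inj.
  by case: eqP; case: eqP; rewrite ?mulr1n ?mulr0n ?mulr1 ?mulr0.
by rewrite block_mxEdl mxE -!/(up m _) -!/(lo _) lo_up mul0rn mulr0.
Qed.

Lemma delta_block_up (p : 'I_(2 + m)) j :
  delta_mx p (up m j) *m l = a^-1 *: delta_mx p (up m j).
Proof.
apply/matrixP => s t; rewrite mull !mxE lE.
case: (split_ordP t) => {}t ->.
  rewrite block_mxEul mxE -!/(up m _) up_inj eq_sym andbC.
  by case: (s =P p); case: eqP; rewrite ?mulr1n ?mulr0n ?mulr1 ?mulr0.
by rewrite block_mxEur mxE -!/(up m _) -!/(lo _) lo_up andbF mul0rn mulr0.
Qed.

Lemma block_delta_lo h (q : 'I_(2 + m)) :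
  k *m delta_mx (lo h) q = \sum_g U g h *: delta_mx (lo g) q.
Proof.
apply/matrixP => s t; rewrite mulk kE summxE.
case: (split_ordP s) => {}s ->.
  rewrite block_mxEur mxE -!/(up m _) mul0rn big1 // => g _.
  by rewrite !mxE up_lo mulr0.
rewrite block_mxEdr -!/(lo _) (bigD1 s) //= big1 => [|g gs].
  by rewrite !mxE eqxx addr0 mulr_natr.
by rewrite !mxE lo_inj eq_sym (negPf gs) mulr0.
Qed.

Lemma delta_block_lo (p : 'I_(2 + m)) h :
  delta_mx p (lo h) *m l = \sum_g U' h g *: delta_mx p (lo g).
Proof.
apply/matrixP => s t; rewrite mull lE summxE.
case: (split_ordP t) => {}t ->.
  rewrite block_mxEdl mxE -!/(up m _) mul0rn big1 // => g _.
  by rewrite !mxE up_lo andbF mulr0.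
rewrite block_mxEdr -!/(lo _) (bigD1 t) //= big1 => [|g gt].
  by rewrite !mxE eqxx andbT addr0 mulr_natr.
by rewrite !mxE lo_inj [t == g]eq_sym (negPf gt) andbF mulr0.
Qed.

Lemma conj_up_up i j :
  k *m delta_mx (up m i) (up m j) *m l = delta_mx (up m i) (up m j).
Proof. by rewrite block_delta_up -scalemxAl delta_block_up scalerA mulfV ?scale1r. Qed.

Lemma conj_up_lo i h : k *m delta_mx (up m i) (lo h) *m l
  = \sum_g (a * U' h g) *: delta_mx (up m i) (lo g).
Proof.
rewrite block_delta_up -scalemxAl delta_block_lo scaler_sumr.
by apply: eq_bigr => g _; rewrite scalerA.
Qed.

Lemma conj_lo_up h j : k *m delta_mx (lo h) (up m j) *m l
  = \sum_g (U g h / a) *: delta_mx (lo g) (up m j).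
Proof.
rewrite block_delta_lo mulmx_suml; apply: eq_bigr => g _.
by rewrite -scalemxAl delta_block_up scalerA.
Qed.

Lemma conj_block_up (M : 'M[C]_(2 + m)) i j :
  (k *m M *m l) (up m i) (up m j) = M (up m i) (up m j).
Proof.
rewrite (matrix_sum_delta M) mulmx_sumr mulmx_suml !summxE; apply: eq_bigr => s _.
rewrite mulmx_sumr mulmx_suml !summxE; apply: eq_bigr => t _.
rewrite -scalemxAr -scalemxAl [LHS]mxE [RHS]mxE; congr (_ * _); rewrite [RHS]mxE.
case: (split_ordP s) => {}s ->; case: (split_ordP t) => {}t ->.
- by rewrite -!/(up m _) conj_up_up !mxE.
- rewrite -!/(up m _) -!/(lo _) conj_up_lo summxE up_lo andbF big1 // => g _.
  by rewrite !mxE up_lo andbF mulr0.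
- rewrite -!/(up m _) -!/(lo _) conj_lo_up summxE up_lo big1 // => g _.
  by rewrite !mxE up_lo mulr0.
- rewrite -!/(up m _) -!/(lo _) block_delta_lo mulmx_suml summxE up_lo big1 // => g _.
  rewrite -scalemxAl delta_block_lo mxE summxE big1 ?mulr0 // => h _.
  by rewrite !mxE up_lo mulr0.
Qed.
End BlockForm.
End AdjointAction.

Local Open Scope complex_scope.
Local Open Scope sesquilinear_scope.

(** ** The invariants *)

(** The canonical element of a space and its dual is invariant. *)
Lemma dual_sum (F : fieldType) (A : algType F) m (f g : 'I_m -> A) (X Y : 'M[F]_m) :
  Y *m X = 1%:M ->
  \sum_k (\sum_h X k h *: f h) * (\sum_h Y h k *: g h) = \sum_h f h * g h.
Proof.
move=> YX.
have YXE h h' : \sum_k Y h' k * X k h = (h' == h)%:R.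
  by have := congr1 (fun M : 'M_m => M h' h) YX; rewrite !mxE.
transitivity (\sum_h \sum_h' (h' == h)%:R *: (f h * g h')).
  under eq_bigr => k _ do rewrite mulr_suml.
  rewrite exchange_big; apply: eq_bigr => h _ /=.
  under eq_bigr => k _ do rewrite mulr_sumr.
  rewrite exchange_big; apply: eq_bigr => h' _ /=.
  rewrite -YXE scaler_suml; apply: eq_bigr => k _.
  by rewrite -scalerAl -scalerAr scalerA mulrC.
apply: eq_bigr => h _; rewrite (bigD1 h) //= eqxx scale1r big1 ?addr0 // => h' /negPf->.
by rewrite scale0r.
Qed.

Section Invariants.
Variables (R : realType) (m : nat).
Local Notation C := R[i].
Local Notation G := 'M[C]_m.+2.
Local Notation V := (su_enveloping R m).
Local Notation Ad := (@Ad R m.+1).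
Local Notation K0 := (@K0 R m.+1).
Local Notation invariant := (@K0_invariant R m.+1).

Lemma gl_in_sum (c : 'I_m -> C) (h : 'I_m -> G) :
  gl_in (\sum_k c k *: h k) = \sum_k c k *: gl_in (h k).
Proof.
elim/big_rec2: _ => [|k u v _ <-]; first exact: gl_in0.
by rewrite gl_in_linear.
Qed.

Section FixedElement.
Variables (k : G) (Kk : K0 k).
Let kU : k \is unitarymx. Proof. by case: Kk. Qed.

Lemma Ad_kap i j : Ad k (kap V i j) = kap V i j.
Proof.
have [a [U [a0 UU kE lE]]] := K0_block Kk.
by rewrite /kap Ad_gl //; congr gl_in; apply: (conj_up_up a0 kE lE).
Qed.

Lemma Ad_ar_al : exists X Y : 'M[C]_m, [/\ Y *m X = 1%:M,
  forall i h, Ad k (ar V i h) = \sum_g X h g *: ar V i g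
  & forall h j, Ad k (al V h j) = \sum_g Y g h *: al V g j].
Proof.
have [a [U [a0 UU kE lE]]] := K0_block Kk.
exists (a *: invmx U), (a^-1 *: U); split=> [|i h|h j].
- by rewrite -scalemxAl -scalemxAr scalerA mulVf // scale1r mulmxV.
- rewrite /ar Ad_gl // -gl_in_sum; congr gl_in.
  rewrite [LHS](conj_up_lo kE lE); apply: eq_bigr => g _.
  by rewrite mxE.
- rewrite /al Ad_gl // -gl_in_sum; congr gl_in.
  rewrite [LHS](conj_lo_up kE lE); apply: eq_bigr => g _.
  by rewrite mxE mulrC.
Qed.

Lemma Ad_Kmx i j : Ad k (Kmx V i j) = Kmx V i j.
Proof. by rewrite /Kmx /tau AdB // AdZ // AdD // !Ad_kap. Qed.

Lemma Ad_Zmx i j : Ad k (Zmx V i j) = Zmx V i j.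
Proof.
have [X [Y [YX Ar Al]]] := Ad_ar_al.
rewrite /Zmx AdZ //; congr (_ *: _); rewrite Ad_sum //.
transitivity (\sum_h Ad k (ar V i h) * Ad k (al V h j)
    + \sum_h Ad k (al V h j) * Ad k (ar V i h)).
  by rewrite -big_split; apply: eq_bigr => h _; rewrite /acomm AdD // !AdM.
rewrite /acomm big_split /=; congr (_ + _).
  rewrite -(dual_sum (ar V i) (fun h => al V h j) YX).
  by apply: eq_bigr => h _; rewrite Ar Al.
have XY : X^T *m Y^T = 1%:M by rewrite -trmx_mul YX trmx1.
rewrite -(dual_sum (fun h => al V h j) (ar V i) XY).
apply: eq_bigr => h _; rewrite Ar Al.
by congr (_ * _); apply: eq_bigr => g _; rewrite mxE.
Qed.

Lemma stabilizer_conj (x : G) : stabilizer (x : 'M[C]_(2 + m)) ->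
  stabilizer (k *m x *m invmx k : 'M[C]_(2 + m)).
Proof.
move=> [b [w xE]]; have [a [U [a0 UU kE lE]]] := K0_block Kk.
exists b, (U *m w *m invmx U).
have E : (block_mx a%:M 0 0 U : 'M[C]_(2 + m)) *m block_mx b%:M 0 0 w
    *m block_mx a^-1%:M 0 0 (invmx U) = block_mx b%:M 0 0 (U *m w *m invmx U).
  rewrite 2!mulmx_block !(mul0mx, mulmx0, addr0, add0r).
  by rewrite -!scalar_mxM mulrAC mulfV // mul1r.
by rewrite -E -xE -kE -lE.
Qed.

Lemma Ad_Jk (u : ualg V) : Jk u -> Jk (Ad k u : ualg V).
Proof.
move=> [s [sP ->]]; rewrite Ad_sum // big_seq.
elim/big_ind: _ => [|x y|p /sP ps]; first exact: Jk0.
  by move=> Jx; rewrite -[x]scale1r; apply: JkL.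
by rewrite AdM // Ad_gl //; apply: Jk_e; apply: stabilizer_conj.
Qed.

Lemma lam_conj (q : bool -> 'M[C]_(2 + m)) (x : 'M[C]_(2 + m)) :
  lam q (k *m x *m invmx k) = lam (fun b => invmx k *m q b *m k) x.
Proof.
have [a [U [a0 UU kE lE]]] := K0_block Kk.
have lk : invmx k *m k = 1%:M by rewrite mulVmx ?unitarymx_unit.
have kl : k *m invmx k = 1%:M by rewrite mulmxV ?unitarymx_unit.
have E b : q b *m (k *m x *m invmx k) - k *m x *m invmx k *m q b
    = k *m (invmx k *m q b *m k *m x - x *m (invmx k *m q b *m k)) *m invmx k.
  rewrite mulmxBr mulmxBl; congr (_ - _).
    by rewrite !mulmxA kl mul1mx.
  by rewrite !mulmxA -[RHS]mulmxA kl mulmx1.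
by rewrite /lam (E true) (E false); congr (_ + _); apply: (conj_block_up a0 kE lE).
Qed.

(** The symbol is equivariant: K0 fixes gen0, and so moves only the point q. *)
Lemma symb_Ad q d (u : ualg V) : FilJ d.+1 u ->
  symb q d (Ad k u : ualg V) = symb (fun b => invmx k *m q b *m k) d u.
Proof.
move=> [v Fv Jv]; set q' := fun b => _.
have -> : symb q' d u = symb q' d v.
  by rewrite -(subrK v u) (@symbD C m V q' d (u - v) v) (symb_Jk q' d Jv) add0r.
have -> : symb q d (Ad k u : ualg V) = symb q d (Ad k v : ualg V).
  rewrite -[in LHS](subrK v u) (AdD kU (u - v) v).
  by rewrite (@symbD C m V q d (Ad k (u - v)) (Ad k v)) (symb_Jk q d (Ad_Jk Jv)) add0r.
elim: Fv => [|s sd|a x y _ IHx _ IHy].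
- by rewrite (Ad0 kU) (symb0 V q) (symb0 V q').
- have sz : (size [seq k *m x *m invmx k | x <- s] <= d)%N by rewrite size_map.
  rewrite [Ad k _](Ad_word kU s) [LHS](@symb_word C m V q d _ sz).
  rewrite [RHS](@symb_word C m V q' d s sd) size_map.
  case: eqP => [_|//]; rewrite big_map; apply: eq_bigr => x _.
  exact: lam_conj.
- rewrite (AdL kU) (@symbL C m V q d a (Ad k x) (Ad k y)).
  by rewrite (@symbL C m V q' d a x y) IHx IHy.
Qed.
End FixedElement.

Lemma K0_invariantL a u v : invariant u -> invariant v -> invariant (a *: u + v).
Proof. by move=> Iu Iv k Kk; have [kU _ _] := Kk; rewrite AdL // Iu // Iv. Qed.

Lemma K0_invariantM u v : invariant u -> invariant v -> invariant (u * v).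
Proof. by move=> Iu Iv k Kk; have [kU _ _] := Kk; rewrite AdM // Iu // Iv. Qed.

Lemma K0_invariant_feval (d : 'I_7 -> ualg V) : (forall j, invariant (d j)) ->
  forall f, invariant (feval d f).
Proof.
move=> dI; elim/freealg_ind=> [|a f g If Ig|s].
- by rewrite raddf0 => k [kU _ _]; rewrite Ad0.
- by rewrite fevalD fevalZ; apply: K0_invariantL.
elim: s => [|j s IH]; first by rewrite big_nil feval1 => k [kU _ _]; rewrite Ad1.
by rewrite big_cons fevalM feval_var; apply: K0_invariantM.
Qed.

(** The scalar a is chosen to make the determinant of k equal to 1. *)
Lemma K0_of_unitary (W : 'M[C]_m) : W \is unitarymx -> exists k a,
  [/\ K0 k, a != 0, k = block_mx a%:M 0 0 (a *: W^T) :> 'M[C]_(2 + m)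
    & invmx k = block_mx a^-1%:M 0 0 (a^-1 *: (invmx W)^T) :> 'M[C]_(2 + m)].
Proof.
move=> WU; have Wu := unitarymx_unit WU; have /unitarymxP WW := WU.
have dW : `|\det W| = 1.
  have := congr1 determinant WW.
  rewrite det_mulmx det_map_mx det_tr det1 -normCK => /eqP.
  by rewrite sqrp_eq1 ?normr_ge0 // => /eqP.
pose a := m.+2.-root (\det W)^-1.
have an : a ^+ m.+2 = (\det W)^-1 by rewrite rootCK.
have a1 : `|a| = 1.
  apply/eqP; rewrite -(@pexpr_eq1 _ _ m.+2) // -normrX an normfV dW invr1 //.
have a0 : a != 0 by rewrite -normr_eq0 a1 oner_neq0.
have aa : a * Num.conj a = 1 by rewrite -normCK a1 expr1n.
pose k : 'M[C]_(2 + m) := block_mx a%:M 0 0 (a *: W^T).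
pose l : 'M[C]_(2 + m) := block_mx a^-1%:M 0 0 (a^-1 *: (invmx W)^T).
have kl : k *m l = 1%:M.
  rewrite mulmx_block !mul0mx !mulmx0 !addr0 !add0r -scalar_mxM mulfV //.
  rewrite -scalemxAl -scalemxAr scalerA mulfV // scale1r -trmx_mul mulVmx //.
  by rewrite trmx1 -scalar_mx_block.
have kU : k \is unitarymx.
  apply/unitarymxP; rewrite /k tr_block_mx map_block_mx mulmx_block.
  rewrite !trmx0 !map_mx0 !mul0mx !mulmx0 !addr0 !add0r.
  rewrite tr_scalar_mx map_scalar_mx -scalar_mxM aa linearZ /= trmxK map_mxZ.
  rewrite -scalemxAl -scalemxAr scalerA aa scale1r.
  have -> : W^T *m map_mx Num.conj W = (map_mx Num.conj W^T *m W)^T.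
    by rewrite trmx_mul map_trmx trmxK.
  by rewrite (mulmx1C WW) trmx1 -scalar_mx_block.
have kK : K0 (k : G).
  split=> //; last by apply/diag_stabilizer; exists a, (a *: W^T).
  rewrite [LHS](det_lblock (a%:M : 'M[C]_2) 0 (a *: W^T)) det_scalar detZ det_tr.
  by rewrite mulrA -exprD an mulVf // -normr_eq0 dW oner_neq0.
exists k, a; split=> //.
have {}kl : (k : G) *m (l : G) = 1%:M := kl.
have -> : invmx (k : G) = l.
  by rewrite -[invmx _]mulmx1 -kl mulmxA mulVmx ?mul1mx ?unitarymx_unit.
by [].
Qed.

Theorem invariant_symbol (u : ualg V) d p : invariant u -> FilJ d.+1 u ->
  (forall q, symb q d u = p.@[fun i => lam q (pbas C i)]) -> block_invariant p.
Proof.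
move=> Iu Fu pE t x y W WU.
have [q [qt qx qy]] := symbols_of_surj t (x *m W) y.
have [k [a [Kk a0 kE lE]]] := K0_of_unitary WU.
have Wu := unitarymx_unit WU.
transitivity (symb q d u).
  rewrite pE; apply: meval_eq => i; rewrite peval_of /peval.
  by case: (enum_val i) => [j|[[i' h]|[h j]]] /=; rewrite ?qt ?qx ?qy.
rewrite -{1}(Iu _ Kk) (symb_Ad Kk) // pE; apply: meval_eq => i.
rewrite -(lam_conj Kk) /pbas /peval.
have lam_sum (c : 'I_m -> C) (h : 'I_m -> 'M[C]_(2 + m)) :
    lam q (\sum_g c g *: h g) = \sum_g c g * lam q (h g).
  have l0 : lam q 0 = 0.
    by have := lam_linear q (-1) 0 0; rewrite scaler0 addr0 mulN1r addNr.
  by elim/big_rec2: _ => // g s s' _ <-; rewrite lam_linear.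
case: (enum_val i) => [j|[[i' h]|[h j]]] /=.
- rewrite -(qt j) /block_of; congr lam.
  have cD (M M' : 'M[C]_(2 + m)) : k *m (M - M') *m invmx k
      = k *m M *m invmx k - k *m M' *m invmx k by rewrite mulmxBr mulmxBl.
  case: j => -[|[|[|//]]] lt /=.
  + by rewrite [LHS]cD !(conj_up_up a0 kE lE).
  + exact: (conj_up_up a0 kE lE).
  + exact: (conj_up_up a0 kE lE).
- rewrite (congr1 (lam q) (conj_up_lo kE lE i' h)) lam_sum.
  have -> : x i' h = ((x *m W) *m invmx W) i' h by rewrite mulmxK.
  rewrite -qx mxE; apply: eq_bigr => g _.
  by rewrite !mxE (mulVKf a0) mulrC.
- rewrite (congr1 (lam q) (conj_lo_up kE lE h j)) lam_sum -qy mxE; apply: eq_bigr => g _.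
  by rewrite !mxE [a * _]mulrC (mulfK a0).
Qed.
End Invariants.

Local Open Scope complex_scope.
Local Open Scope sesquilinear_scope.

(** ** The operators in terms of the blocks *)

Section RootVectors.
Variables (F : numFieldType) (A : algType F) (I : F).
Hypothesis II : I * I = -1.
Implicit Types r l : A.

Lemma root_square r l : (2^-1 *: (r - l)) ^+ 2 + ((I / 2) *: (r + l)) ^+ 2
  = (-1) *: (2^-1 *: acomm r l).
Proof. by rewrite /acomm !expr2; nc_coefs F A; field: II. Qed.

Lemma root_product r l r' l' :
  - 2^-1 *: (acomm (2^-1 *: (r - l)) (2^-1 *: (r' - l'))
             + acomm ((I / 2) *: (r + l)) ((I / 2) *: (r' + l')))
  = 2^-1 *: (2^-1 *: acomm r l') + 2^-1 *: (2^-1 *: acomm r' l).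
Proof. by rewrite /acomm; nc_coefs F A; field: II. Qed.

Lemma root_twisted_product r l r' l' :
  2^-1 *: (- acomm (2^-1 *: (r - l)) ((I / 2) *: (r' + l'))
           + acomm (2^-1 *: (r' - l')) ((I / 2) *: (r + l)))
  = - (I / 2) *: (2^-1 *: acomm r l') + (I / 2) *: (2^-1 *: acomm r' l).
Proof. by rewrite /acomm; nc_coefs F A; field: II. Qed.

Lemma half_difference x y : (I / 2) *: (x - y)
  = I *: (x - (1 / 2) *: (x + y)) + 0 *: (x - (1 / 2) *: (x + y)) :> A.
Proof. by nc_coefs F A; field: II. Qed.
End RootVectors.

Section Operators.
Variables (R : realType) (m : nat).
Local Notation C := R[i].
Local Notation V := (su_enveloping R m).
Local Notation I := ('i%C : C).
Local Notation Psi := (@Psi R m.+1).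
Local Notation Upsilon := (@Upsilon R m.+1).
Local Notation bD := (blockD I (Kmx V) (Zmx V)).

Lemma of_mx_gl x : x \in @su_pred R m.+2 -> @of_mx R m.+1 x = gl_in x.
Proof. by move=> xs; rewrite /of_mx -gl_in_su insubdK. Qed.

Lemma E_up_up (i j : 'I_2) : @E R m.+1 i.+1 j.+1 = delta_mx (up m i) (up m j).
Proof. by rewrite /E !up_inord. Qed.

Lemma lo_inord (l : 'I_m) : inord l.+2 = lo l :> 'I_m.+2.
Proof. by apply: val_inj; rewrite /= inordK // !ltnS. Qed.

Lemma E_up_lo (i : 'I_2) (l : 'I_m) : @E R m.+1 i.+1 l.+3 = delta_mx (up m i) (lo l).
Proof. by rewrite /E up_inord lo_inord. Qed.

Lemma E_lo_up (i : 'I_2) (l : 'I_m) : @E R m.+1 l.+3 i.+1 = delta_mx (lo l) (up m i).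
Proof. by rewrite /E up_inord lo_inord. Qed.

Lemma gl_inZ a x : gl_in (a *: x) = a *: gl_in x :> ualg V.
Proof. by rewrite -[a *: x]addr0 gl_in_linear gl_in0 addr0. Qed.

Lemma gl_inD x y : gl_in (x + y) = gl_in x + gl_in y :> ualg V.
Proof. by rewrite -[x]scale1r gl_in_linear !scale1r. Qed.

Lemma gl_inB x y : gl_in (x - y) = gl_in x - gl_in y :> ualg V.
Proof. by rewrite addrC -scaleN1r gl_in_linear scaleN1r addrC. Qed.

Lemma Psi12 : Psi 1 2 = 2^-1 *: (kap V 0 1 - kap V 1 0) :> ualg V.
Proof.
rewrite /Defs.Psi of_mx_gl ?Psi_su // /Psi_mx gl_inZ gl_inB.
by rewrite (E_up_up 0 1) (E_up_up 1 0).
Qed.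

Lemma Upsilon12 : Upsilon 1 2 = (I / 2) *: (kap V 0 1 + kap V 1 0) :> ualg V.
Proof.
rewrite /Defs.Upsilon of_mx_gl ?Upsilon_su // /Upsilon_mx gl_inZ gl_inD.
by rewrite (E_up_up 0 1) (E_up_up 1 0).
Qed.

Lemma Upsilon_star_kap :
  @Upsilon_star R m.+1 = (I / 2) *: (kap V 0 0 - kap V 1 1) :> ualg V.
Proof.
rewrite /Upsilon_star of_mx_gl ?Upsilon_star_su // /Upsilon_star_mx gl_inZ gl_inB.
by rewrite (E_up_up 0 0) (E_up_up 1 1).
Qed.

Lemma Psi_up_lo (i : 'I_2) (l : 'I_m) :
  Psi i.+1 l.+3 = 2^-1 *: (ar V i l - al V l i) :> ualg V.
Proof.
rewrite /Defs.Psi of_mx_gl ?Psi_su // /Psi_mx gl_inZ gl_inB.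
by rewrite E_up_lo E_lo_up.
Qed.

Lemma Upsilon_up_lo (i : 'I_2) (l : 'I_m) :
  Upsilon i.+1 l.+3 = (I / 2) *: (ar V i l + al V l i) :> ualg V.
Proof.
rewrite /Defs.Upsilon of_mx_gl.
  by rewrite /Upsilon_mx gl_inZ gl_inD E_up_lo E_lo_up.
have i2 := ltn_ord i; have lm := ltn_ord l.
apply: Upsilon_su; [exact: leq_trans i2 _ | exact: lm |].
by rewrite eqSS neq_ltn (leq_trans (ltn_ord i)).
Qed.

Lemma sum_lo (A : nmodType) (h : nat -> A) :
  \sum_(3 <= k < m.+3) h k = \sum_(l < m) h l.+3.
Proof.
rewrite -{1}[3%N]add0n big_addn -[(m.+3 - 3)%N]/(m - 0)%N subn0 big_mkord.
by apply: eq_bigr => l _; rewrite addn3.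
Qed.

Theorem D_blocks j : @D R m.+1 j = bD j :> ualg V.
Proof.
have II : I * I = -1 := imul2 R.
rewrite /D /blockD (tnth_nth 0).
case: j => -[|[|[|[|[|[|[|//]]]]]]] lt /=.
- by rewrite /D0 Psi12 /Kmx /dlt /= !mul0r !scale0r !subr0 scalerBr scaleNr opprB addrC.
- rewrite /D1 sum_lo scale0r addr0 /Zmx scalerA scaler_sumr; apply: eq_bigr => l _.
  by rewrite (Psi_up_lo 0) (Upsilon_up_lo 0) root_square // scalerA.
- rewrite /D2 sum_lo scale0r addr0 /Zmx scalerA scaler_sumr; apply: eq_bigr => l _.
  by rewrite (Psi_up_lo 1) (Upsilon_up_lo 1) root_square // scalerA.
- rewrite /D3 sum_lo /Zmx !scalerA !scaler_sumr -big_split; apply: eq_bigr => l _ /=.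
  rewrite (Psi_up_lo 0) (Upsilon_up_lo 0) (Psi_up_lo 1) (Upsilon_up_lo 1).
  by rewrite root_product // !scalerA.
- by rewrite /D4 Upsilon12 /Kmx /dlt /= !mul0r !scale0r !subr0 scalerDr.
- rewrite /D5 Upsilon_star_kap /Kmx /tau /dlt /=.
  exact: half_difference.
- rewrite /Dsq sum_lo /Zmx !scalerA !scaler_sumr -big_split; apply: eq_bigr => l _ /=.
  rewrite (Psi_up_lo 0) (Upsilon_up_lo 0) (Psi_up_lo 1) (Upsilon_up_lo 1).
  by rewrite root_twisted_product // !scalerA.
Qed.
Lemma Fil_kap i j : Fil 2 (kap V i j). Proof. exact: Fil_e. Qed.
Lemma Fil_Kmx i j : Fil 2 (Kmx V i j).
Proof.
apply: FilB; first exact: Fil_kap.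
by apply: FilZ; apply: FilD; apply: Fil_kap.
Qed.
Lemma Fil_Zmx i j : Fil 3 (Zmx V i j).
Proof.
apply: FilZ; apply: Fil_sum => h _; apply: FilD.
  by apply: (@FilM _ _ _ 1 1); apply: Fil_e.
by apply: (@FilM _ _ _ 1 1); apply: Fil_e.
Qed.

Lemma D_fil j : Fil (wt7 j).+1 (@D R m.+1 j : ualg V).
Proof.
rewrite D_blocks /blockD /wt7.
by case: j => -[|[|[|[|[|[|[|//]]]]]]] lt /=; apply: FilD; apply: FilZ;
  try exact: Fil_Kmx; exact: Fil_Zmx.
Qed.

Lemma symb_e q x : symb q 1 (gl_in x : ualg V) = lam q x.
Proof.
by have := @symb_word C m V q 1 [:: x] isT; rewrite /word !big_seq1.
Qed.

Lemma symb_Zmx q i j : symb q 2 (Zmx V i j) = (right_of q *m left_of q) i j.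
Proof.
rewrite /Zmx symbZ symb_sum mxE.
have s2 (x y : 'M[C]_(2 + m)) :
    symb q 2 ((gl_in x : ualg V) * (gl_in y : ualg V)) = lam q x * lam q y.
  by rewrite (@symbM _ _ V q 1 1); [rewrite !symb_e | exact: Fil_e..].
rewrite mulr_sumr; apply: eq_bigr => h _.
have -> : right_of q i h = lam q (delta_mx (up m i) (lo h)) by rewrite mxE.
have -> : left_of q h j = lam q (delta_mx (lo h) (up m j)) by rewrite mxE.
rewrite [symb _ _ _](symbD q 2 (ar V i h * al V h j) (al V h j * ar V i h)).
rewrite [symb q 2 (ar V i h * _)]s2 [symb q 2 (al V h j * _)]s2.
by move: (lam _ _) (lam _ _) => a b; field.
Qed.

Lemma symb_Kmx q i j : symb q 1 (Kmx V i j)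
  = lam q (delta_mx (up m i) (up m j)) - (dlt C i j / 2)
    * (lam q (delta_mx (up m 0) (up m 0)) + lam q (delta_mx (up m 1) (up m 1))).
Proof.
have lk i' j' : symb q 1 (kap V i' j') = lam q (delta_mx (up m i') (up m j')).
  exact: symb_e.
rewrite /Kmx /tau (@symbB C m V q 1 (kap V i j)) lk.
by rewrite (@symbZ C m V q 1 _ (kap V 0 0 + kap V 1 1)) (@symbD C m V q 1 (kap V 0 0)) !lk.
Qed.

Lemma D_symb q j : symb q (wt7 j) (@D R m.+1 j : ualg V) = symv I q j.
Proof.
have lamB x y : lam q (x - y) = lam q x - lam q y.
  by rewrite addrC -scaleN1r lam_linear mulN1r addrC.
have bE k : (k < 3)%N -> block_of q (inord k) = lam q (nth 0
    [:: delta_mx (up m 0) (up m 0) - delta_mx (up m 1) (up m 1);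
        delta_mx (up m 0) (up m 1); delta_mx (up m 1) (up m 0)] k).
  by move=> k3; rewrite /block_of /pbasis inordK.
have o0 : block_of q (inord 0)
    = lam q (delta_mx (up m 0) (up m 0)) - lam q (delta_mx (up m 1) (up m 1)).
  by rewrite (bE 0%N isT) /= lamB.
have o1 : block_of q (inord 1) = lam q (delta_mx (up m 0) (up m 1)) := bE 1%N isT.
have o2 : block_of q (inord 2) = lam q (delta_mx (up m 1) (up m 0)) := bE 2%N isT.
have i0 : inord 0 = 0 :> 'I_2 by apply: val_inj; rewrite /= inordK.
have i1 : inord 1 = 1 :> 'I_2 by apply: val_inj; rewrite /= inordK.
have K00 := symb_Kmx q 0 0; have K01 := symb_Kmx q 0 1; have K10 := symb_Kmx q 1 0.
have Z00 := symb_Zmx q 0 0; have Z01 := symb_Zmx q 0 1.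
have Z10 := symb_Zmx q 1 0; have Z11 := symb_Zmx q 1 1.
have symb2 d a u b v :
    symb q d (a *: u + b *: v : ualg V) = a * symb q d u + b * symb q d v.
  by rewrite symbD !symbZ.
rewrite D_blocks /blockD /wt7 /symv /symbols o0 o1 o2 i0 i1.
move: K00 K01 K10 Z00 Z01 Z10 Z11; rewrite /dlt /=.
move: (lam q _) (lam q _) (lam q _) (lam q _) (right_of q *m left_of q).
move=> a00 a11 a01 a10 Z K00 K01 K10 Z00 Z01 Z10 Z11.
case: j => -[|[|[|[|[|[|[|//]]]]]]] lt /=; rewrite symb2 ?K00 ?K01 ?K10 ?Z00 ?Z01 ?Z10 ?Z11;
  by field.
Qed.

Lemma D_comm x j : stabilizer x ->
  (gl_in x : ualg V) * (@D R m.+1 j : ualg V) = (@D R m.+1 j : ualg V) * (gl_in x : ualg V).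
Proof.
move=> xs; apply/eqP; rewrite -subr_eq0 -/(comm _ _) D_blocks /blockD.
have K0 i k : comm (gl_in x : ualg V) (Kmx V i k) = 0 by case: (stabilizer_comm V i k xs).
have Z0 i k : comm (gl_in x : ualg V) (Zmx V i k) = 0 by case: (stabilizer_comm V i k xs).
have lin (a b : C) (u v : ualg V) : comm (gl_in x : ualg V) u = 0 ->
    comm (gl_in x : ualg V) v = 0 -> comm (gl_in x : ualg V) (a *: u + b *: v) = 0.
  by move=> u0 v0; rewrite commR commZr u0 v0 !scaler0 addr0.
by apply/eqP; case: j => -[|[|[|[|[|[|[|//]]]]]]] lt /=; apply: lin.
Qed.

Lemma D_invariant j : @K0_invariant R m.+1 (@D R m.+1 j).
Proof.
have -> : @D R m.+1 j = bD j := D_blocks j.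
move=> k Kk; have [kU _ _] := Kk.
have lin (a b : C) (u v : ualg V) : @Ad R m.+1 k u = u -> @Ad R m.+1 k v = v ->
    @Ad R m.+1 k (a *: u + b *: v) = a *: u + b *: v.
  by move=> uE vE; rewrite (AdL kU a u (b *: v)) (AdZ kU b v) uE vE.
by case: j => -[|[|[|[|[|[|[|//]]]]]]] lt; apply: lin;
  by [apply: (Ad_Kmx Kk) | apply: (Ad_Zmx Kk)].
Qed.
End Operators.

(** * Relations in the free algebra *)

Section EvalCommutators.
Variables (F : numClosedFieldType) (A : algType F) (d : 'I_7 -> A).

Lemma feval_comm f g : feval d (comm f g) = comm (feval d f) (feval d g).
Proof. by rewrite /comm fevalB !fevalM. Qed.
Lemma feval_acomm f g : feval d (acomm f g) = acomm (feval d f) (feval d g).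
Proof. by rewrite /acomm fevalD !fevalM. Qed.
Lemma feval_opp f : feval d (- f) = - feval d f. Proof. exact: raddfN. Qed.
Lemma feval_zero : feval d 0 = 0. Proof. exact: raddf0. Qed.
End EvalCommutators.

Section FreeRelations.
Variables (F : numClosedFieldType) (c : F).
Local Notation X := (@fvar F 'I_7).
Local Notation proj := (differences (projective_relations c X)).

Lemma feval_projective (A : algType F) (d : 'I_7 -> A) :
  projective_relations c d
  = [seq (feval d r.1, feval d r.2) | r <- projective_relations c X].
Proof.
do 21 (congr cons; first by congr pair; rewrite /= ?(feval_comm, feval_acomm, feval_opp,
  feval_zero, fevalB, fevalD, fevalZ, feval_var)).
Qed.

Lemma feval_projective_extra (A : algType F) (d : 'I_7 -> A) :
  feval d (projective_extra X) = projective_extra d.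
Proof.
by rewrite /projective_extra /acomm !expr2
  !(fevalB, fevalD, fevalM, fevalZ, feval_var).
Qed.

Lemma feval_projective_central (A : algType F) (d : 'I_7 -> A) :
  feval d (projective_central X) = projective_central d.
Proof.
by rewrite /projective_central !expr2 !(fevalB, fevalD, fevalM, fevalZ, feval_var).
Qed.

(** The character with D1, D2 |-> 1 and all other generators |-> 0 satisfies the
    commutation relations. *)
Lemma extra_independent : ~ ideal_gen proj (projective_extra X).
Proof.
pose h (j : 'I_7) : F^o := if (j == inord 1) || (j == inord 2) then 1 else 0.
have hE : [/\ h (inord 0) = 0, h (inord 3) = 0, h (inord 4) = 0, h (inord 5) = 0
    & h (inord 6) = 0] /\ h (inord 1) = 1 /\ h (inord 2) = 1.
  by rewrite /h -!val_eqE /= !inordK.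
case: hE => -[h0 h3 h4 h5 h6] [h1 h2].
have comm0 (x y : F^o) : comm x y = 0 by rewrite /comm mulrC subrr.
move=> /(_ (fun f => feval h f = 0)) H.
suff : feval h (projective_extra X) = 0.
  rewrite feval_projective_extra /projective_extra /acomm h0 h1 h2 h3 h4 h5 h6.
  rewrite !expr2 !mulr0 !addr0 scaler0 !subr0 mulr1 => /eqP.
  by rewrite scaler_eq0 invr_eq0 -[1 + 1]/(2%:R : F) !pnatr_eq0.
apply: H => [|f [r rp ->]].
  split=> [|x y x0 y0|a b x x0]; first exact: raddf0.
    by rewrite fevalB x0 y0 subrr.
  by rewrite !fevalM x0 mulr0 mul0r.
rewrite fevalB.
have : (feval h r.1, feval h r.2) \in projective_relations c h.
  by rewrite feval_projective; apply: map_f.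
rewrite /projective_relations /acomm h0 h1 h2 h3 h4 h5 h6 !comm0 subrr.
rewrite !(mulr0, mul0r, addr0, scaler0, subr0, oppr0, sub0r) !inE.
by rewrite !orbb => /eqP[-> ->]; rewrite subr0.
Qed.

Section Straight.
Variable Id : freealg F 'I_7 -> Prop.
Hypothesis Id_ideal : two_sided_ideal Id.
Hypothesis proj_Id : forall f, proj f -> Id f.
Local Notation WtI := (WtI Id).

Let WtIN d f : WtI d f -> WtI d (- f).
Proof. by move=> Wf; rewrite -scaleN1r; apply: WtIZ. Qed.

Let WtI_var d j : (wt7 j < d)%N -> WtI d (X j).
Proof.
move=> jd; apply: WtI_of => //; rewrite -[X j](big_seq1 *%R j X).
by apply: (@WtW F d [:: j]); rewrite big_seq1.
Qed.

Let WtI_mul d i j : (wt7 i + wt7 j < d)%N -> WtI d (X i * X j).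
Proof.
move=> ijd; apply: WtI_of => //.
have -> : X i * X j = wordX F [:: i; j] by rewrite /wordX big_cons big_seq1.
by apply: WtW; rewrite big_cons big_seq1.
Qed.

Let acommD (x y z : freealg F 'I_7) : acomm (x + y) z = acomm x z + acomm y z.
Proof. by rewrite /acomm mulrDl mulrDr addrACA. Qed.

(** Each commutation relation expresses a commutator by terms of lower weight. *)
Lemma projective_rel i j : WtI (wt7 i + wt7 j) (X i * X j - X j * X i).
Proof.
pattern i, j; apply: pairs7_ind => {i j} [i|i j Wij|p].
- by rewrite subrr; apply: WtI0.
- by rewrite addnC -opprB; apply: WtIN.
rewrite -/(comm (X (inord p.1)) (X (inord p.2))) => p7.
have rel k : (k < 21)%N -> Id ((nth (0, 0) (projective_relations c X) k).1
    - (nth (0, 0) (projective_relations c X) k).2).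
  by move=> k21; apply: proj_Id; exists (nth (0, 0) (projective_relations c X) k);
    rewrite ?mem_nth.
have step d f g : Id (f - g) -> WtI d g -> WtI d f.
  by move=> Ifg Wg; rewrite -[f](subrK g); apply: WtID => //; apply: WtI_Id.
have pE : p = nth (0, 0)%N pairs7 (index p pairs7) by rewrite nth_index.
have k21 : (index p pairs7 < 21)%N by rewrite -[21%N]/(size pairs7) index_mem.
have := rel _ k21; move: pE k21; move: (index p pairs7) => k pE k21.
rewrite pE {pE}.
case: k k21 => [|[|[|[|[|[|[|[|[|[|[|[|[|[|[|[|[|[|[|[|[|k]]]]]]]]]]]]]]]]]]]]] // _ r;
  apply: (step _ _ _ r); rewrite /= ?acommD;
  repeat first [ apply: WtIN | apply: WtID => // | apply: WtIB => // | apply: WtIZ => //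
    | apply: WtI0 | apply: WtI_mul | apply: WtI_var];
  try exact: Id_ideal; by rewrite /wt7 ?inordK.
Qed.

Lemma projective_quadratic : Id (projective_extra X) ->
  WtI 4 (X (inord 1) * X (inord 2) - X (inord 3) ^+ 2 - X (inord 6) ^+ 2).
Proof.
move=> Iex; have := projective_rel (inord 1) (inord 2).
rewrite {1 2}/wt7 !inordK //= => W12.
have -> : X (inord 1) * X (inord 2) - X (inord 3) ^+ 2 - X (inord 6) ^+ 2
    = projective_extra X + (2^-1 *: (X (inord 1) * X (inord 2) - X (inord 2) * X (inord 1))
      + 4^-1 *: (X (inord 0) * X (inord 0) + X (inord 4) * X (inord 4)
                 + X (inord 5) * X (inord 5))).
  by rewrite /projective_extra /acomm !expr2; nc_coefs F (freealg F 'I_7); field.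
apply: WtID => //; first exact: WtI_Id.
apply: WtID => //; apply: WtIZ => //.
by repeat (apply: WtID => //); apply: WtI_mul; rewrite /wt7 !inordK.
Qed.

Lemma projective_central_free f : Id (comm (projective_central X) f).
Proof.
have [I0 IB IM] := Id_ideal.
have d_rel r : r \in projective_relations c X -> Id (r.1 - r.2).
  by move=> rp; apply: proj_Id; exists r.
elim/freealg_ind: f => [|a f g If Ig|s].
- by rewrite /comm mulr0 mul0r subrr.
- by rewrite commR; apply: IdD => //; apply: IdZ.
elim: s => [|j s IH]; first by rewrite big_nil /comm mulr1 mul1r subrr.
rewrite big_cons commMr; apply: IdD => //.
  rewrite -[_ * _]mul1r mulrA; apply: IM.
  exact: (projective_central_comm Id_ideal d_rel).
by rewrite -[_ * _]mulr1; apply: IM.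
Qed.
End Straight.
End FreeRelations.

(** * The theorem over complex projective space *)

Local Open Scope complex_scope.

Section Projective.
Variables (R : realType) (m : nat).
Hypothesis m_gt0 : (0 < m)%N.
Local Notation C := R[i].
Local Notation V := (su_enveloping R m).
Local Notation c := (m%:R ^+ 2 / 4 : C).
Local Notation X := (@fvar C 'I_7).
Local Notation D := (@D R m.+1 : 'I_7 -> ualg V).
Local Notation invariant := (@K0_invariant R m.+1).
Local Notation proj := (differences (projective_relations c X)).

Lemma projective_Jk r : r \in projective_relations c D -> Jk (r.1 - r.2).
Proof.
have -> : D = blockD 'i%C (Kmx V) (Zmx V) by apply/funext => j; apply: D_blocks.
apply: (blocks_projective (imul2 R) (@JkL _ _ V) (Jk0 V) (Kmx11 V)) => i j p q.
- by rewrite comm_Kmx subrr; apply: Jk0.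
- by rewrite comm_Kmx_Zmx subrr; apply: Jk0.
- exact: comm_Zmx.
Qed.

Lemma projective_extra_Jk : m = 1%N -> Jk (projective_extra D).
Proof.
move=> m1; have -> : D = blockD 'i%C (Kmx V) (Zmx V).
  by apply/funext => j; apply: D_blocks.
have mF : m%:R = 1 :> C := congr1 (fun k => k%:R) m1.
apply: (@blocks_extra C 'i%C c (ualg V) (imul2 R) _ (@JkL _ _ V) (Jk0 V) _ _ (Kmx11 V)).
- by move=> i j p q; rewrite comm_Kmx subrr; apply: Jk0.
- by move=> i j p q; rewrite comm_Kmx_Zmx subrr; apply: Jk0.
- exact: comm_Zmx.
- by rewrite mF expr1n mul1r.
- exact: Zmx_det.
Qed.

Lemma Diff_eqE (u v : ualg V) :
  @Diff_eq R m.+1 u v <-> invariant (u - v) /\ Jk (u - v).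
Proof.
by split=> -[Iuv Juv]; split=> //; apply/left_ideal_Jk.
Qed.

Lemma invariantB (u v : ualg V) : invariant u -> invariant v -> invariant (u - v).
Proof.
by move=> Iu Iv; rewrite addrC -scaleN1r; apply: K0_invariantL.
Qed.

Lemma invariant_D f : invariant (feval D f).
Proof. exact/K0_invariant_feval/D_invariant. Qed.

Lemma proj_Jk f : proj f -> Jk (feval D f).
Proof.
move=> [r rp ->]; rewrite fevalB.
have : (feval D r.1, feval D r.2) \in projective_relations c D.
  by rewrite [projective_relations c D]feval_projective; apply: map_f.
by move/projective_Jk.
Qed.

Theorem projective_satisfy : satisfy (projective_relations c D).
Proof.
move=> r rp; apply/Diff_eqE; split; last exact: projective_Jk.
move: rp; rewrite [projective_relations c D]feval_projective => /mapP[r' _ ->].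
by apply: invariantB; apply: invariant_D.
Qed.

Theorem projective_generate : generate_Diff D.
Proof.
split=> [j|u Iu]; first exact: D_invariant.
have [f fE] := generation (imul2 R) (@D_fil R m) (@D_symb R m) (@K0_invariantL R m)
  invariant_D (@invariant_symbol R m) (@su_fil R m) m_gt0 Iu.
by exists f; apply/Diff_eqE; split=> //; apply: invariantB => //; apply: invariant_D.
Qed.

Lemma relations_generatedE (S : freealg C 'I_7 -> Prop) :
  (forall f, ideal_gen S f <-> Jk (feval D f)) -> relations_generated_by D S.
Proof.
move=> H f; split=> [/Diff_eqE|/H Jf]; first by rewrite subr0 => -[_ /H].
by apply/Diff_eqE; rewrite subr0; split=> //; apply: invariant_D.
Qed.

Theorem projective_relations_large : (1 < m)%N -> relations_generated_by D proj.
Proof.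
move=> m2; apply: relations_generatedE => f; split.
  exact: (ideal_Jk (@D_comm R m) proj_Jk).
have str := straightens_all (ideal_gen_ideal proj)
  (projective_rel (ideal_gen_ideal proj) (fun f pf => ideal_gen_sub pf)).
exact: (relations_in_ideal (@D_fil R m) (@D_symb R m) (@D_comm R m) proj_Jk str
  (symv_indep_large (imul2 R) m2 (good := _))).
Qed.

Theorem projective_relations_small : m = 1%N ->
  relations_generated_by D (fun f => proj f \/ f = projective_extra X).
Proof.
move=> m1; set S := (fun f => _); apply: relations_generatedE => f.
have S_Jk g : S g -> Jk (feval D g).
  move=> [/proj_Jk//|->].
  by rewrite [feval D _]feval_projective_extra; apply: projective_extra_Jk.
split; first exact: (ideal_Jk (@D_comm R m) S_Jk).
have S_id := ideal_gen_ideal S.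
have pS g : proj g -> ideal_gen S g by move=> pg; apply: ideal_gen_sub; left.
have eS : ideal_gen S (projective_extra X) by apply: ideal_gen_sub; right.
have str := straightens_no_D1D2 S_id (projective_rel S_id pS)
  (projective_quadratic S_id pS eS).
exact: (relations_in_ideal (@D_fil R m) (@D_symb R m) (@D_comm R m) S_Jk str
  (symv_indep_small (imul2 R) m_gt0)).
Qed.

Theorem projective_center : central_in_Diff (projective_central D).
Proof.
have zE : projective_central D = feval D (projective_central X).
  by rewrite [RHS]feval_projective_central.
rewrite zE; set z := projective_central X.
split=> [|u Iu]; first exact: invariant_D.
apply/Diff_eqE; rewrite subr0; split.
  by apply: invariantB; apply: K0_invariantM => //; apply: invariant_D.
have [f fE] := (projective_generate).2 u Iu; move/Diff_eqE: fE => [_ Jf].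
have -> : comm (feval D z) u = feval D (comm z f)
    + ((-1) *: ((u - feval D f) * feval D z) + feval D z * (u - feval D f)).
  by rewrite (comm_shift _ _ (feval D f)) [in RHS]/comm fevalB !fevalM.
rewrite -[feval D (comm z f)]scale1r; apply: JkL.
  apply: (ideal_Jk (@D_comm R m) proj_Jk).
  exact: (projective_central_free (ideal_gen_ideal proj) (fun f pf => ideal_gen_sub pf)).
apply: JkL; first exact: (Jk_mulr (@D_comm R m)).
exact: JkM.
Qed.
End Projective.

(** * Complex hyperbolic space *)

Lemma imaginary_neq0 (F : fieldType) (I : F) : I * I = -1 -> I != 0.
Proof.
by move=> II; apply: contra_eqN II => /eqP->; rewrite mul0r eq_sym oppr_eq0 oner_neq0.
Qed.

Section Rescaling.
Variables (F : numFieldType) (c I : F) (A : algType F).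
Hypothesis II : I * I = -1.

(* The inverses of the factors i, -1, 1, i, i, 1, i between the two families. *)
Definition dbar_scale (j : 'I_7) : F := nth 0 [:: - I; -1; 1; - I; - I; 1; - I] j.
Definition dbar (d : 'I_7 -> A) (j : 'I_7) : A := dbar_scale j *: d j.

(** Both sides of the relation with left hand side [d_i, d_j] carry the product of
    the factors of d_i and d_j. *)
Lemma hyperbolic_relation d k : (k < 21)%N ->
  exists2 a : F, a != 0 &
    (nth (0, 0) (hyperbolic_relations c (dbar d)) k).1
      - (nth (0, 0) (hyperbolic_relations c (dbar d)) k).2
    = a *: ((nth (0, 0) (projective_relations c d) k).1
            - (nth (0, 0) (projective_relations c d) k).2).
Proof.
have I0 := imaginary_neq0 II.
pose s k := nth 0 [:: - I; -1; 1; - I; - I; 1; - I] k.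
pose p := nth (0, 0)%N pairs7 k.
move=> k21; exists (s p.1 * s p.2).
  rewrite /p; case: k k21 {p} =>
    [|[|[|[|[|[|[|[|[|[|[|[|[|[|[|[|[|[|[|[|[|k]]]]]]]]]]]]]]]]]]]]] //= _;
    by rewrite /s /= ?mulf_neq0 ?oppr_eq0 ?oner_neq0.
rewrite /p /s {s p}.
case: k k21 => [|[|[|[|[|[|[|[|[|[|[|[|[|[|[|[|[|[|[|[|[|k]]]]]]]]]]]]]]]]]]]]] // _;
  rewrite /= /dbar /dbar_scale !inordK //= /comm /acomm; by nc_coefs F A; field: II.
Qed.

Lemma hyperbolic_extra_dbar d : hyperbolic_extra (dbar d) = (-1) *: projective_extra d.
Proof.
rewrite /hyperbolic_extra /projective_extra /dbar /dbar_scale !inordK //= /acomm !expr2.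
by nc_coefs F A; field: II.
Qed.

Lemma hyperbolic_central_dbar d :
  hyperbolic_central (dbar d) = (-1) *: projective_central d.
Proof.
rewrite /hyperbolic_central /projective_central /dbar /dbar_scale !inordK //= !expr2.
by nc_coefs F A; field: II.
Qed.
End Rescaling.

Section RescaledIdeals.
Variables (F : numClosedFieldType) (s : 'I_7 -> F).
Hypothesis s0 : forall j, s j != 0.
Local Notation X := (@fvar F 'I_7).
Local Notation A := (freealg F 'I_7).

Definition rescale (f : A) : A := feval (fun j => s j *: X j) f.
Definition unscale (f : A) : A := feval (fun j => (s j)^-1 *: X j) f.

Lemma feval_comp (B : algType F) (d : 'I_7 -> B) (h : 'I_7 -> A) f :
  feval d (feval h f) = feval (fun j => feval d (h j)) f.
Proof.
elim/freealg_ind: f => [|a f g IHf IHg|w]; first by rewrite !raddf0.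
  by rewrite !(fevalD, fevalZ) IHf IHg.
elim: w => [|j w IH]; first by rewrite big_nil !feval1.
by rewrite big_cons !fevalM IH !feval_var.
Qed.

Lemma feval_ext (B : algType F) (d d' : 'I_7 -> B) f : d =1 d' -> feval d f = feval d' f.
Proof. by move=> /funext->. Qed.

Lemma feval_rescale (B : algType F) (d : 'I_7 -> B) f :
  feval d (rescale f) = feval (fun j => s j *: d j) f.
Proof. by rewrite /rescale feval_comp; apply: feval_ext => j; rewrite fevalZ feval_var. Qed.

Lemma feval_fvar f : feval X f = f.
Proof.
elim/freealg_ind: f => [|a f g IHf IHg|w]; first by rewrite raddf0.
  by rewrite fevalD fevalZ IHf IHg.
elim: w => [|j w IH]; first by rewrite big_nil feval1.
by rewrite big_cons fevalM IH feval_var.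
Qed.

Lemma rescaleK : cancel rescale unscale.
Proof.
move=> f; rewrite /unscale feval_rescale -[RHS]feval_fvar; apply: feval_ext => j.
by rewrite scalerA mulfV // scale1r.
Qed.

Lemma unscaleK : cancel unscale rescale.
Proof.
move=> f; rewrite /rescale feval_comp -[RHS]feval_fvar; apply: feval_ext => j.
by rewrite fevalZ feval_var scalerA mulVf // scale1r.
Qed.

Lemma rescale_ideal (S T : A -> Prop) :
  (forall f, S f -> exists a g, T g /\ rescale f = a *: g) ->
  (forall g, T g -> exists a f, S f /\ g = a *: rescale f) ->
  forall f, ideal_gen S f <-> ideal_gen T (rescale f).
Proof.
move=> ST TS f; have [T0 TB TM] := ideal_gen_ideal T; have [S0 SB SM] := ideal_gen_ideal S.
split=> [/(_ (fun f => ideal_gen T (rescale f)))|]; first apply.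
- split=> [|x y Tx Ty|a b x Tx]; first by rewrite /rescale raddf0.
    by rewrite /rescale fevalB; apply: TB.
  by rewrite /rescale !fevalM; apply: TM.
- move=> g /ST[a [h [Th ->]]].
  by apply: (IdZ (ideal_gen_ideal T)); apply: ideal_gen_sub.
move=> /(_ (fun g => ideal_gen S (unscale g))); rewrite rescaleK; apply.
- split=> [|x y Sx Sy|a b x Sx]; first by rewrite /unscale raddf0.
    by rewrite /unscale fevalB; apply: SB.
  by rewrite /unscale !fevalM; apply: SM.
move=> g /TS[a [h [Sh ->]]].
have -> : unscale (a *: rescale h) = a *: h by rewrite /unscale fevalZ [feval _ _]rescaleK.
by apply: (IdZ (ideal_gen_ideal S)); apply: ideal_gen_sub.
Qed.
End RescaledIdeals.

Section HyperbolicRelations.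
Variables (F : numClosedFieldType) (c I : F).
Hypothesis II : I * I = -1.
Local Notation X := (@fvar F 'I_7).
Local Notation A := (freealg F 'I_7).
Local Notation proj := (differences (projective_relations c X)).
Local Notation hyp := (differences (hyperbolic_relations c X)).
Local Notation rescale := (rescale (dbar_scale I)).

Lemma dbar_scale_neq0 j : dbar_scale I j != 0.
Proof.
have I0 := imaginary_neq0 II.
rewrite /dbar_scale; case: j => -[|[|[|[|[|[|[|//]]]]]]] lt /=;
  by rewrite ?oppr_eq0 ?oner_neq0.
Qed.

Lemma feval_hyperbolic (B : algType F) (d : 'I_7 -> B) :
  hyperbolic_relations c d
  = [seq (feval d r.1, feval d r.2) | r <- hyperbolic_relations c X].
Proof.
do 21 (congr cons; first by congr pair; rewrite /= ?(feval_comm, feval_acomm, feval_opp,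
  feval_zero, fevalB, fevalD, fevalZ, feval_var)).
Qed.

Lemma rescale_hyperbolic k : (k < 21)%N -> exists2 a : F, a != 0 &
  rescale ((nth (0, 0) (hyperbolic_relations c X) k).1
           - (nth (0, 0) (hyperbolic_relations c X) k).2)
  = a *: ((nth (0, 0) (projective_relations c X) k).1
          - (nth (0, 0) (projective_relations c X) k).2).
Proof.
move=> k21; have [a a0 E] := hyperbolic_relation c II X k21; exists a => //.
rewrite -E [in RHS]feval_hyperbolic (nth_map (0, 0)) //=.
by rewrite /rescale fevalB.
Qed.

Lemma rescale_hyperbolic_extra :
  rescale (hyperbolic_extra X) = (-1) *: projective_extra X.
Proof.
rewrite -(hyperbolic_extra_dbar II) /rescale /hyperbolic_extra /acomm !expr2.
by rewrite !(fevalB, fevalD, fevalM, fevalZ, feval_var).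
Qed.

Lemma hyp_proj f : hyp f -> exists a g, proj g /\ rescale f = a *: g.
Proof.
move=> [r rh ->]; set k := index r (hyperbolic_relations c X).
have k21 : (k < 21)%N by rewrite -[21%N]/(size (hyperbolic_relations c X)) index_mem.
have [a a0] := rescale_hyperbolic k21.
have -> : nth (0, 0) (hyperbolic_relations c X) k = r by rewrite nth_index.
have := mem_nth (0, 0) (k21 : (k < size (projective_relations c X))%N).
move: (nth _ _ k) => p pp E; exists a, (p.1 - p.2); split; last exact: E.
by exists p.
Qed.

Lemma proj_hyp g : proj g -> exists a f, hyp f /\ g = a *: rescale f.
Proof.
move=> [r rh ->]; set k := index r (projective_relations c X).
have k21 : (k < 21)%N by rewrite -[21%N]/(size (projective_relations c X)) index_mem.
have [a a0] := rescale_hyperbolic k21.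
have -> : nth (0, 0) (projective_relations c X) k = r by rewrite nth_index.
have := mem_nth (0, 0) (k21 : (k < size (hyperbolic_relations c X))%N).
move: (nth _ _ k) => p ph E; exists a^-1, (p.1 - p.2); split; first by exists p.
by rewrite E scalerA mulVf // scale1r.
Qed.

Lemma hyperbolic_ideal f : ideal_gen hyp f <-> ideal_gen proj (rescale f).
Proof. exact: (rescale_ideal dbar_scale_neq0 hyp_proj proj_hyp). Qed.

Lemma hyperbolic_extra_ideal f :
  ideal_gen (fun f => hyp f \/ f = hyperbolic_extra X) f
  <-> ideal_gen (fun f => proj f \/ f = projective_extra X) (rescale f).
Proof.
apply: (rescale_ideal dbar_scale_neq0) => g [].
- by move=> /hyp_proj[a [h [ph hE]]]; exists a, h; split=> //; left.
- move=> ->; exists (-1), (projective_extra X); rewrite rescale_hyperbolic_extra.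
  by split=> //; right.
- by move=> /proj_hyp[a [h [ph hE]]]; exists a, h; split=> //; left.
- move=> ->; exists (-1), (hyperbolic_extra X); rewrite rescale_hyperbolic_extra.
  by rewrite scalerA mulN1r opprK scale1r; split=> //; right.
Qed.

Lemma hyperbolic_extra_independent : ~ ideal_gen hyp (hyperbolic_extra X).
Proof.
rewrite hyperbolic_ideal rescale_hyperbolic_extra => Ie.
apply: (@extra_independent F c); rewrite -[projective_extra X]opprK -!scaleN1r.
exact: (IdZ (ideal_gen_ideal _)).
Qed.
End HyperbolicRelations.

Local Open Scope complex_scope.

Section Hyperbolic.
Variables (R : realType) (m : nat).
Hypothesis m_gt0 : (0 < m)%N.
Local Notation C := R[i].
Local Notation V := (su_enveloping R m).
Local Notation c := (m%:R ^+ 2 / 4 : C).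
Local Notation X := (@fvar C 'I_7).
Local Notation D := (@D R m.+1 : 'I_7 -> ualg V).
Local Notation Dbar := (@Dbar R m.+1 : 'I_7 -> ualg V).
Local Notation hyp := (differences (hyperbolic_relations c X)).
Let II := imul2 R.

Lemma Dbar_dbar : Dbar = dbar 'i%C D.
Proof.
apply/funext => j; rewrite /dbar /dbar_scale /Defs.Dbar /Defs.D !(tnth_nth 0).
have iV : ('i%C : C)^-1 = - 'i%C.
  have i0 : 'i%C != 0 :> C := imaginary_neq0 II.
  by apply: (mulfI i0); rewrite mulfV // mulrN II opprK.
case: j => -[|[|[|[|[|[|[|//]]]]]]] lt /=; by rewrite ?iV ?scaleN1r ?scale1r.
Qed.

Lemma feval_Dbar f : feval Dbar f = feval D (rescale (dbar_scale 'i%C) f).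
Proof. by rewrite Dbar_dbar feval_rescale. Qed.

Theorem hyperbolic_satisfy : satisfy (hyperbolic_relations c Dbar).
Proof.
rewrite Dbar_dbar => r rh; set k := index r (hyperbolic_relations c (dbar 'i%C D)).
have k21 : (k < 21)%N.
  by rewrite -[21%N]/(size (hyperbolic_relations c (dbar 'i%C D))) index_mem.
have [a a0] := hyperbolic_relation c II D k21; rewrite nth_index // => E.
have kP : (k < size (projective_relations c D))%N := k21.
have /Diff_eqE[Ir Jr] := projective_satisfy (mem_nth (0, 0) kP).
apply/Diff_eqE; rewrite E -[_ *: _]addr0; split.
  by apply: K0_invariantL => //; have := invariantB Ir Ir; rewrite subrr.
by apply: JkL => //; apply: Jk0.
Qed.

Theorem hyperbolic_generate : generate_Diff Dbar.
Proof.
have [_ genD] := @projective_generate R m m_gt0.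
split=> [j|u /genD[f fE]].
  rewrite -[Dbar j](feval_var Dbar j) feval_Dbar; apply: invariant_D.
exists (unscale (dbar_scale 'i%C) f).
by rewrite [feval _ _]feval_Dbar unscaleK // => j; apply: dbar_scale_neq0.
Qed.

Theorem hyperbolic_relations_large : (1 < m)%N -> relations_generated_by Dbar hyp.
Proof.
move=> m2 f; rewrite [feval _ _]feval_Dbar (hyperbolic_ideal c II f).
exact: (projective_relations_large m2).
Qed.

Theorem hyperbolic_relations_small : m = 1%N ->
  relations_generated_by Dbar (fun f => hyp f \/ f = hyperbolic_extra X).
Proof.
move=> m1 f; rewrite [feval _ _]feval_Dbar (hyperbolic_extra_ideal c II f).
exact: (projective_relations_small m_gt0 m1).
Qed.

Theorem hyperbolic_center : central_in_Diff (hyperbolic_central Dbar).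
Proof.
have [Iz zc] := @projective_center R m m_gt0.
rewrite Dbar_dbar [hyperbolic_central _](hyperbolic_central_dbar II).
rewrite -[(-1) *: _]addr0; split=> [|u Iu].
  by apply: K0_invariantL => //; have := invariantB Iz Iz; rewrite subrr.
have /Diff_eqE[Ic Jc] := zc u Iu; apply/Diff_eqE.
have -> : comm ((-1) *: projective_central D + 0) u - 0
    = (-1) *: (comm (projective_central D) u - 0) + 0.
  by rewrite !addr0 commZ !subr0.
split; last by apply: JkL => //; apply: Jk0.
by apply: K0_invariantL => //; have := invariantB Ic Ic; rewrite subrr.
Qed.
End Hyperbolic.

Theorem mainTheorem2 (R : realType) (n : nat) (n_ge2 : (2 <= n)%N) :
  let c : R[i] := (n%:R - 1) ^+ 2 / 4 in
  let X : 'I_7 -> freealg R[i] 'I_7 := @fvar R[i] 'I_7 in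
  let D := @D R n in
  let Dbar := @Dbar R n in
  let proj := differences (projective_relations c X) in
  let hyp := differences (hyperbolic_relations c X) in
  generate_Diff D
  /\ satisfy (projective_relations c D)
  /\ ((2 < n)%N -> relations_generated_by D proj)
  /\ (n = 2%N ->
        relations_generated_by D
          (fun f => proj f \/ f = projective_extra X)
        /\ ~ ideal_gen proj (projective_extra X))
  /\ central_in_Diff (projective_central D)
  /\ generate_Diff Dbar
  /\ satisfy (hyperbolic_relations c Dbar)
  /\ ((2 < n)%N -> relations_generated_by Dbar hyp)
  /\ (n = 2%N ->
        relations_generated_by Dbar
          (fun f => hyp f \/ f = hyperbolic_extra X)
        /\ ~ ideal_gen hyp (hyperbolic_extra X))
  /\ central_in_Diff (hyperbolic_central Dbar).
Proof.
case: n n_ge2 => [//|m]; rewrite ltnS => m_gt0 c X D Dbar proj hyp.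
have cE : c = m%:R ^+ 2 / 4 by rewrite /c -natr1 addrK.
rewrite /proj /hyp cE.
split; first exact: projective_generate.
split; first exact: projective_satisfy.
split; first by rewrite ltnS; apply: projective_relations_large.
split.
  move=> [m1]; split; first exact: projective_relations_small.
  exact: extra_independent.
split; first exact: projective_center.
split; first exact: hyperbolic_generate.
split; first exact: hyperbolic_satisfy.
split; first by rewrite ltnS; apply: hyperbolic_relations_large.
split.
  move=> [m1]; split; first exact: hyperbolic_relations_small.
  exact: (hyperbolic_extra_independent (imul2 R)).
exact: hyperbolic_center.
Qed.
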